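(* Let $\Omega\subset\mathbb{R}^d$ be a bounded, open, connected set with $C^2$ boundary and let $A$ be a second-order uniformly elliptic operator of the form described in the context, generating the semigroup $(S_t)_{t\ge0}$ on $L^2(\Omega)$. Let $\mathcal U_+\subset\{u\in L^2(\Omega):u\ge0\}$ be a constraint set of nonnegative controls, and assume that there exists a ball $B(x,r)\subset\Omega$ (with $x\in\Omega$, $r>0$) such that $$\forall u\in\mathcal U_+,\qquad \operatorname{supp}(u)\cap B(x,r)=\emptyset.$$ Let $y_0=0$ and let $y_f\in L^2(\Omega)$ be any target such that $y_f\ge0$, $y_f\ne0$ and $\operatorname{supp}(y_f)\subset B(x,r)$. Then there exist $T^\star>0$ and $\varepsilon>0$ such that for any time $T\le T^\star$, no control with values in $\mathcal U_+$ can steer $0$ to $\overline B(y_f,\varepsilon)$ in time $T$; that is, for every $0<T\le T^\star$ and every $u\in L^2((0,T)\times\Omega)$ with $u(t,\cdot)\in\mathcal U_+$ for a.e. $t\in(0,T)$, the solution of $y_t-Ay=u$, $y(0)=0$ satisfies $\|y(T)-y_f\|_{L^2(\Omega)}>\varepsilon$.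
   Context: The operator has domain $D(A)=H^2(\Omega)\cap H^1_0(\Omega)$ and $$Ay=\sum_{1\le i,j\le d}\partial_{x_j}(a_{ij}(x)\partial_{x_i}y)-\sum_{i=1}^db_i(x)\partial_{x_i}y+c(x)y,$$ where $a_{ij}=a_{ji}\in W^{1,\infty}(\Omega)$, $b_i\in W^{1,\infty}(\Omega)$, $c\in L^\infty(\Omega)$, and there is $\theta>0$ with $\sum_{i,j}a_{ij}(x)\xi_i\xi_j\ge\theta|\xi|^2$ for all $x\in\Omega$, $\xi\in\mathbb{R}^d$. The solution of $y_t-Ay=u$, $y(0)=y_0$ is the mild solution $y(t)=S_ty_0+\int_0^tS_{t-s}u(s)\,ds$. $\operatorname{supp}$ denotes the essential support, and $\overline B(y_f,\varepsilon)$ is the closed ball in $L^2(\Omega)$. *)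

(* Defs.v *)
From HB Require Import structures.
From mathcomp Require Import all_boot all_order all_algebra.
From mathcomp Require Import all_classical all_reals all_analysis.
From mathcomp Require Import measurable_realfun.

Set Implicit Arguments.
Unset Strict Implicit.
Unset Printing Implicit Defensive.

Import Order.TTheory GRing.Theory Num.Theory.
Import numFieldNormedType.Exports.

Local Open Scope classical_set_scope.
Local Open Scope ring_scope.

(* R^d is 'rV[R]_d, whose library norm is the sup norm; the topology is the
   usual one, and 'rV[R]_d carries its Borel sigma-algebra. *)
Section borel_rV.
Context (R : realType) (d : nat).

Let borel := <<s [set U : set 'rV[R]_d | open U] >>.

Let borel0 : borel set0.
Proof. exact: sigma_algebra0. Qed.

Let borelC A : borel A -> borel (~` A).
Proof. exact: sigma_algebraC. Qed.

Let borel_bigcup (F : (set 'rV[R]_d)^nat) :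
  (forall i, borel (F i)) -> borel (\bigcup_i F i).
Proof. exact: sigma_algebra_bigcup. Qed.

HB.instance Definition _ := @isMeasurable.Build default_measure_display
  'rV[R]_d borel borel0 borelC borel_bigcup.

Lemma open_measurable_rV (U : set 'rV[R]_d) : open U -> measurable U.
Proof. by move=> oU; exact: sub_gen_smallest. Qed.

End borel_rV.

Section lebesgue_rV.
Context (R : realType).

Definition cons_rV d (p : R * 'rV[R]_d) : 'rV[R]_d.+1 :=
  row_mx (const_mx p.1 : 'rV_1) p.2.

Definition uncons_rV d (v : 'rV[R]_d.+1) : R * 'rV[R]_d :=
  (v ord0 ord0, rsubmx (v : 'rV_(1 + d))).

Lemma cons_rVK d : cancel (@cons_rV d) (@uncons_rV d).
Proof.
move=> [x v]; rewrite /uncons_rV /cons_rV row_mxKr; congr pair.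
by rewrite mxE; case: splitP => // k _; rewrite mxE.
Qed.

Lemma uncons_rVK d : cancel (@uncons_rV d) (@cons_rV d).
Proof.
move=> v; apply/rowP => i; rewrite mxE; case: splitP => k ik; rewrite !mxE /=.
  by congr (v _ _); apply/val_inj; rewrite /= ik ord1.
by congr (v _ _); apply/val_inj; rewrite /= ik.
Qed.

Lemma cons_rV_ball d (p q : R * 'rV[R]_d) e :
  ball p e q -> ball (cons_rV p) e (cons_rV q).
Proof.
move=> [b1 [e0 b2]]; split=> // i j; rewrite !mxE.
by case: splitP => k _; rewrite ?mxE//; rewrite (ord1 i).
Qed.

Lemma measurable_cons_rV d : measurable_fun setT (@cons_rV d).
Proof.
apply: (@measurability _ _ _ _ _ _ [set U : set 'rV[R]_d.+1 | open U]) => //.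
move=> _ [U oU <-]; rewrite setTI.
pose box (k : rat * 'rV[rat]_d * nat) : set (R * 'rV[R]_d) :=
  ball (ratr k.1.1 : R) k.2.+1%:R^-1 `*`
  (ball (map_mx ratr k.1.2 : 'rV[R]_d) k.2.+1%:R^-1).
have -> : @cons_rV d @^-1` U = \bigcup_(k in [set k | box k `<=` @cons_rV d @^-1` U]) box k.
  apply/seteqP; split=> [[x v] Uxv|p [k kU /kU //]].
  have /nbhs_ballP[e /= e0 eU] : nbhs (cons_rV (x, v)) U by exact: open_nbhs_nbhs.
  have [n ne] : exists n, 2 * n.+1%:R^-1 < e.
    exists (Num.bound (2 / e)); rewrite -[_ * _^-1]/(2 / _) ltr_pdivrMr//.
    rewrite mulrC -ltr_pdivrMr// (lt_le_trans (archi_boundP _))//.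
      by rewrite divr_ge0// ltW.
    by rewrite ler_nat.
  have n0 : 0 < n.+1%:R^-1 :> R by rewrite invr_gt0.
  have approx (y : R) : exists q : rat, ball (ratr q : R) n.+1%:R^-1 y.
    have [q] : exists q, ratr q \in `]y - n.+1%:R^-1, y + n.+1%:R^-1[.
      by apply: rat_in_itvoo; rewrite ltrD2l gtrN.
    rewrite in_itv/= => /andP[h1 h2]; exists q; rewrite /ball/= ltr_norml.
    by rewrite ltrBrDr ltrBlDr [- _ + y]addrC h1 [_ + y]addrC.
  have [qx bx] := approx x.
  have /choice[qv bv] : forall i, exists q : rat, ball (ratr q : R) n.+1%:R^-1 (v ord0 i).
    by move=> i; exact: approx.
  exists (qx, \row_i qv i, n); last first.
    by split=> //=; split=> // i j; rewrite (ord1 i) !mxE.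
  move=> p [/= b1 b2]; apply: eU.
  apply: (@le_ball _ _ _ (2 * n.+1%:R^-1)); first exact: ltW.
  apply: cons_rV_ball; rewrite mulrDl !mul1r; split=> /=.
    by apply: ball_triangle b1; exact: ball_sym.
  apply: ball_triangle b2; apply: ball_sym; split=> // i j.
  by rewrite (ord1 i) !mxE.
rewrite bigcup_mkcond; apply: countable_bigcupT_measurable => // k.
case: ifPn => // _; apply: measurableX.
  by apply: open_measurable; exact: ball_open.
by apply: open_measurable_rV; exact: ball_open.
Qed.

Lemma measurable_uncons_rV d : measurable_fun setT (@uncons_rV d).
Proof.
apply/measurable_fun_pairP; split.
  apply: (measurability _ (RGenOpens.measurableE R)) => _ [_ [a [b ->]] <-].
  rewrite setTI; apply: open_measurable_rV.
  apply: open_comp => [v _|]; last exact: interval_open.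
  exact: coord_continuous.
apply: (@measurability _ _ _ _ _ _ [set U : set 'rV[R]_d | open U]) => //.
move=> _ [U oU <-]; rewrite setTI; apply: open_measurable_rV.
apply: open_comp => [v _|//] /=.
move=> A /nbhs_ballP[e /= e0 eA]; apply/nbhs_ballP; exists e => //= w [_ vw].
by apply: eA; split=> // i j; rewrite !mxE; exact: vw.
Qed.

Section cons_measure.
Context d (mu : {sigma_finite_measure set 'rV[R]_d -> \bar R}).

Definition cons_measure : set 'rV[R]_d.+1 -> \bar R :=
  pushforward (lebesgue_measure \x mu)%E (@cons_rV d).

Let cons_measure0 : cons_measure set0 = 0%E.
Proof. by rewrite /cons_measure /pushforward preimage_set0 measure0. Qed.

Let cons_measure_ge0 A : (0 <= cons_measure A)%E.
Proof. by apply: measure_ge0; exact: measurable_cons_rV. Qed.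

Let cons_measure_sigma_additive : semi_sigma_additive cons_measure.
Proof.
by apply: measure_semi_sigma_additive; exact: measurable_cons_rV.
Qed.

HB.instance Definition _ := isMeasure.Build _ _ _ cons_measure
  cons_measure0 cons_measure_ge0 cons_measure_sigma_additive.

Let cons_measure_sigma_finite : sigma_finite setT cons_measure.
Proof.
have /sigma_finiteP[F [TF ndF Foo]] := sigma_finiteT (@lebesgue_measure R).
have /sigma_finiteP[G [TG ndG Goo]] := sigma_finiteT mu.
exists (fun n => @uncons_rV d @^-1` (F n `*` G n)).
  rewrite -preimage_bigcup -[LHS](preimage_setT (@uncons_rV d)); congr (_ @^-1` _).
  rewrite -setXTT TF TG predeqE => -[x y]; split.
    move=> [/= [n _ Fnx] [k _ Gky]]; exists (maxn n k) => //; split.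
    - by move: x Fnx; exact/subsetPset/ndF/leq_maxl.
    - by move: y Gky; exact/subsetPset/ndG/leq_maxr.
  by move=> [n _ []/= ? ?]; split; exists n.
move=> k; have [? ?] := Foo k; have [? ?] := Goo k; split.
  rewrite -[X in measurable X]setTI; apply: measurable_uncons_rV => //.
  exact: measurableX.
rewrite /cons_measure /pushforward -comp_preimage.
rewrite (_ : _ \o _ = id); last exact/funext/cons_rVK.
by rewrite preimage_id product_measure1E// lte_mul_pinfty// ge0_fin_numE.
Qed.

HB.instance Definition _ := @Measure_isSigmaFinite.Build _ _ _ cons_measure
  cons_measure_sigma_finite.

End cons_measure.

(* Lebesgue measure on R^d, as the d-fold product of the one on R. *)
Fixpoint lebesgue_rV d : {sigma_finite_measure set 'rV[R]_d -> \bar R} :=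
  match d return {sigma_finite_measure set 'rV[R]_d -> \bar R} with
  | 0 => [the {sigma_finite_measure set _ -> \bar R} of \d_ (0 : 'rV[R]_0)]
  | n.+1 =>
      [the {sigma_finite_measure set _ -> \bar R} of cons_measure (lebesgue_rV n)]
  end.

End lebesgue_rV.

Section euclidean.
Context (R : realType) (d : nat).
Local Notation E := 'rV[R]_d.

Definition eucl_norm (x : E) : R := Num.sqrt (\sum_i x ord0 i ^+ 2).

Definition eucl_ball (x : E) (r : R) : set E := [set y | eucl_norm (y - x) < r].

Definition partial (i : 'I_d) (f : E -> R) (x : E) : R :=
  'D_(delta_mx ord0 i) f x.

Fixpoint Ck (k : nat) (f : E -> R) : Prop :=
  match k with
  | 0 => continuous f
  | k'.+1 => continuous f /\
      forall i, (forall x, derivable f x (delta_mx ord0 i)) /\ Ck k' (partial i f)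
  end.

Definition Cinfty (f : E -> R) : Prop := forall k, Ck k f.

Definition test_function (Omega : set E) (phi : E -> R) : Prop :=
  [/\ Cinfty phi, compact (closure [set x | phi x != 0]) &
      closure [set x | phi x != 0] `<=` Omega].

End euclidean.

(* Near each boundary point Omega is, up to relabelling and reorienting the
   coordinate axes, the region above the graph of a C^2 function of the
   remaining d - 1 coordinates; col' i x is x with its i-th coordinate removed. *)
Definition C2_boundary (R : realType) (d : nat) (Omega : set 'rV[R]_d) : Prop :=
  forall x0, (closure Omega `\` Omega) x0 ->
  exists (r : R) (i : 'I_d) (s : bool) (gamma : 'rV[R]_d.-1 -> R),
    [/\ 0 < r, Ck 2 gamma &
      Omega `&` eucl_ball x0 r =
      [set x | gamma (col' i x) < (-1) ^+ s * x ord0 i] `&` eucl_ball x0 r].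

Section function_spaces.
Context (R : realType) (d : nat) (Omega : set 'rV[R]_d) (oO : open Omega).
Local Notation E := 'rV[R]_d.

(* Lebesgue measure restricted to Omega: "a.e." below means a.e. in Omega, and
   values of functions outside Omega play no role (a function on Omega is
   extended by 0 to a Borel function on R^d). *)
Definition leb_on : {measure set E -> \bar R} :=
  [the {measure set E -> \bar R} of
     mrestr (lebesgue_rV R d) (open_measurable_rV oO)].

(* Elements of L2 are representatives; equality in L^2(Omega) is a.e. equality. *)
Definition L2 : Type := LfunType leb_on (lee1n 2).

Definition nrm2 (f : L2) : R := fine ('N[leb_on]_2%:E[EFin \o f])%E.

(* g is the weak i-th partial derivative of f in Omega. It is only used for f
   and g in L^2(Omega) or L^infty(Omega), so that both integrals exist. *)
Definition weak_partial (i : 'I_d) (f g : E -> R) : Prop :=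
  forall phi, test_function Omega phi ->
    \int[leb_on]_x (f x * partial i phi x) = - \int[leb_on]_x (g x * phi x).

Definition Linfty (f : E -> R) : Prop := f \in Lfun leb_on +oo%E.

Definition W1infty (f : E -> R) : Prop :=
  Linfty f /\ forall i, exists2 g, Linfty g & weak_partial i f g.

Definition weak_grad (f : L2) (p : 'I_d -> L2) : Prop :=
  forall i, weak_partial i f (p i).

Definition H2 (f : L2) : Prop :=
  exists2 p : 'I_d -> L2, weak_grad f p &
    exists h : 'I_d -> 'I_d -> L2, forall i, weak_grad (p i) (h i).

(* H^1_0: the closure of the test functions in H^1. *)
Definition H10 (f : L2) : Prop :=
  exists2 p : 'I_d -> L2, weak_grad f p &
    exists phi : nat -> E -> R,
    [/\ forall n, test_function Omega (phi n),
        'N[leb_on]_2%:E[EFin \o (phi n \- f)%R]%E @[n --> \oo] --> 0%E &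
        forall i, 'N[leb_on]_2%:E[EFin \o (partial i (phi n) \- p i)%R]%E
                    @[n --> \oo] --> 0%E].

(* Relative to Omega: the complement in Omega of the largest open set on which
   f vanishes a.e. *)
Definition ess_supp (f : E -> R) : set E :=
  [set x | Omega x /\
     forall U, open U -> U x -> ~ (\forall y \ae leb_on, U y -> f y = 0)].

Definition uniformly_elliptic (a : 'I_d -> 'I_d -> E -> R) : Prop :=
  exists2 theta : R, 0 < theta &
    \forall x \ae leb_on, forall xi : E,
      theta * eucl_norm xi ^+ 2 <=
      \sum_i \sum_j a i j x * xi ord0 i * xi ord0 j.

(* The graph of A: f is in D(A) and A f = g in L^2(Omega). Here p i is the weak
   derivative of f along x_i, and q i j that of a_ij * p i along x_j. *)
Definition elliptic_op (a : 'I_d -> 'I_d -> E -> R) (b : 'I_d -> E -> R)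
    (c : E -> R) (f g : L2) : Prop :=
  [/\ H2 f, H10 f &
    exists (p : 'I_d -> L2) (q : 'I_d -> 'I_d -> L2),
    [/\ weak_grad f p,
        forall i j, weak_partial j (fun x => a i j x * p i x) (q i j) &
        \forall x \ae leb_on, g x =
          \sum_i \sum_j q i j x - \sum_i b i x * p i x + c x * f x]].

Record C0_semigroup (S : R -> L2 -> L2) : Prop := {
  C0_linear : forall t k f g, 0 <= t ->
    S t (k *: f + g) = k *: S t f + S t g %[ae leb_on] ;
  C0_bounded : forall t, 0 <= t ->
    exists M, forall f, nrm2 (S t f) <= M * nrm2 f ;
  C0_id : forall f, S 0 f = f %[ae leb_on] ;
  C0_comp : forall s t f, 0 <= s -> 0 <= t ->
    S (s + t) f = S s (S t f) %[ae leb_on] ;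
  C0_cont : forall f, nrm2 (S t f - f) @[t --> 0^'+] --> 0 }.

(* The graph of the infinitesimal generator of S. *)
Definition generator (S : R -> L2 -> L2) (f g : L2) : Prop :=
  nrm2 (t^-1 *: (S t f - f) - g) @[t --> 0^'+] --> 0.

Definition generates (A : L2 -> L2 -> Prop) (S : R -> L2 -> L2) : Prop :=
  C0_semigroup S /\ forall f g, generator S f g <-> A f g.

Record simple_curve := SimpleCurve {
  sc_size : nat ;
  sc_set : 'I_sc_size -> set R ;
  sc_val : 'I_sc_size -> L2 ;
  sc_meas : forall i, measurable (sc_set i) }.
Arguments sc_set : clear implicits.
Arguments sc_val : clear implicits.

Definition sc_eval (s : simple_curve) (t : R) : L2 :=
  \sum_i (\1_(sc_set s i) t : R) *: sc_val s i.

Definition sc_int (D : set R) (s : simple_curve) : L2 :=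
  \sum_i fine (lebesgue_measure (sc_set s i `&` D)) *: sc_val s i.

(* I is the L^2(Omega)-valued Bochner integral of F over the (bounded) set D. *)
Definition bochner_integral (D : set R) (F : R -> L2) (I : L2) : Prop :=
  exists s : nat -> simple_curve,
  [/\ \forall t \ae @lebesgue_measure R, D t ->
        nrm2 (F t - sc_eval (s n) t) @[n --> \oo] --> 0,
      (\int[lebesgue_measure]_(t in D) (nrm2 (F t - sc_eval (s n) t))%:E)%E
        @[n --> \oo] --> 0%E &
      nrm2 (I - sc_int D (s n)) @[n --> \oo] --> 0].

(* y t = S_t y0 + \int_0^t S_(t-s) u(s) ds for t in [0, T]. *)
Definition mild_solution (S : R -> L2 -> L2) (y0 : L2) (u : R -> L2) (T : R)
    (y : R -> L2) : Prop :=
  forall t, 0 <= t <= T -> exists I : L2,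
    bochner_integral `]0, t[ (fun s => S (t - s) (u s)) I /\
    y t = S t y0 + I %[ae leb_on].

Definition leb_cyl (T : R) : {measure set (measurableTypeR R * E) -> \bar R} :=
  [the {measure set (measurableTypeR R * E) -> \bar R} of
     mrestr (lebesgue_measure \x lebesgue_rV R d)%E
       (@measurableX _ _ (measurableTypeR R) E `]0, T[ Omega
          (measurable_itv `]0, T[) (open_measurable_rV oO))].

Definition L2cyl (T : R) : Type := LfunType (leb_cyl T) (lee1n 2).

(* u(t, .) as an element of L^2(Omega); the default 0 is only used for the
   null set of times t at which u(t, .) is not square integrable. *)
Definition slice (T : R) (u : L2cyl T) (t : R) : L2 :=
  insubd (0 : L2) (fun x => u (t, x)).

End function_spaces.

(* Main.v *)
(* Duality. Fix a test function Q that vanishes outside B(x, r) and has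
   <y_f, Q> > 0. If <S_t v, Q> <= 0 for all small t and all v >= 0 that vanish on
   B(x, r), then <y(T), Q> <= 0 by the variation of constants formula, so that
   ||y(T) - y_f|| >= <y_f, Q> / ||Q||.

   For the sign of <S_t v, Q>, build a supersolution q(s) = Q + s G of the
   adjoint equation, q' >= A* q, with G supported in B(x, r) as well. Then
   <S_t v, q(tau - t)> is nonincreasing in t because S_t v >= 0, and it vanishes
   at t = 0. With e(t) = exp(-1/t) for t > 0 and w = rho - |. - x|^2, one takes
   Q = e(w - delta) - eta e(w) and G = M e(w - delta / 2): near the sphere w = 0
   the term e(w) is a strict subsolution, hence A* Q < 0 there.

   Positivity of S_t follows from - <A f, f^-> <= K |f^-|^2 on D(A) by a
   Gronwall argument for |(S_t f)^-|^2, and from the density of D(A). *)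
Require Import Defs.
From HB Require Import structures.
From mathcomp Require Import all_boot all_order all_algebra.
From mathcomp Require Import all_classical all_reals all_analysis.
From mathcomp Require Import measurable_realfun ring lra.

Set Implicit Arguments.
Unset Strict Implicit.
Unset Printing Implicit Defensive.

Import Order.TTheory GRing.Theory Num.Theory.
Import numFieldNormedType.Exports.

Local Open Scope classical_set_scope.
Local Open Scope ring_scope.

(** [Q] has to change sign: by the strong maximum principle [S_t v] becomes positive on all of Omega
    at once, so a nonnegative [Q] would give a positive pairing. The sign of [Q] costs nothing at
    time 0, because [v] vanishes on the ball. The bound on the time comes from [s A* G], which is
    merely bounded: [q(s)] stays a supersolution as long as [s] is small enough for the gap in
    [A* Q <= G] to absorb it.

    An element of D(A) close to some [v >= 0] need not be nonnegative. Positivity is therefore used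
    in the quantitative form [|(S_t f)^-| <= exp(K t) |f^-|], and the comparison along orbits
    carries [|f^-|] as an error that disappears only in the limit [f -> v].

    The generator gives orbits a right derivative, so each differential inequality is integrated by
    a one-sided criterion, which also asks for left semicontinuity; hence the left continuity of
    orbits. Integrations by parts against [f^-] or against coefficients in W^(1,infty) go through
    test functions that approximate [f] in H^1. *)

(** * Inner product and norm of L^2 over a finite measure *)

Section L2_toolkit.
Context d (T : measurableType d) (R : realType) (mu : {measure set T -> \bar R}).
Hypothesis mu_fin : (mu setT < +oo)%E.
Implicit Types f g h k : T -> R.

Local Notation L2f := (Lfun mu 2%:E).
Local Notation itg f := (mu.-integrable setT (EFin \o f)).

(** Defined on bare functions, with membership in [L2f] as a separate hypothesis, so that
    coefficients, test functions and elements of [L2 oO] can be paired without packing them. *)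
Definition ip f g : R := \int[mu]_x (f x * g x).
Definition n2 f : R := Num.sqrt (ip f f).

Lemma L2_meas f : f \in L2f -> measurable_fun setT f.
Proof. by rewrite inE => /andP[/[!inE]]. Qed.

Lemma L2P f : f \in L2f <-> measurable_fun setT f /\ itg (fun x => f x ^+ 2).
Proof.
split=> [fL|[mf fi]]; first by split; [exact: L2_meas|exact: Lfun2_integrable_sqr].
rewrite inE; apply/andP; split; rewrite inE//= /finite_norm unlock /Lnorm.
rewrite poweR_lty//.
under eq_integral => x _ do rewrite /= powR_mulrn// -normrX ger0_norm ?sqr_ge0//.
by move/integrableP : fi => [_]; under eq_integral => x _ do
  rewrite /= ger0_norm ?sqr_ge0//.
Qed.

Lemma L2_ipitg f g : f \in L2f -> g \in L2f -> itg (fun x => f x * g x).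
Proof. by move=> fL gL; apply/Lfun1_integrable; exact: Lfun2_mul_Lfun1. Qed.

Lemma L2_itg f : f \in L2f -> itg f.
Proof.
move=> fL; apply/Lfun1_integrable; apply: Lfun_subset12 => //.
by rewrite ge0_fin_numE.
Qed.

Lemma L2D f g : f \in L2f -> g \in L2f -> (fun x => f x + g x) \in L2f.
Proof. by move=> fL gL; apply: (proj2 (Lfun_addr_closed mu (lee1n 2))). Qed.

Lemma L2N f : f \in L2f -> (fun x => - f x) \in L2f.
Proof.
exact: Lfun_oppr_closed.
Qed.

Lemma L2B f g : f \in L2f -> g \in L2f -> (fun x => f x - g x) \in L2f.
Proof. by move=> fL gL; apply: L2D => //; exact: L2N. Qed.

Lemma L2_0 : (fun=> 0) \in L2f.
Proof. exact: (proj1 (Lfun_addr_closed mu (lee1n 2))). Qed.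

Lemma L2_sum (I : Type) (s : seq I) (F : I -> T -> R) :
  (forall i, F i \in L2f) -> (fun x => \sum_(i <- s) F i x) \in L2f.
Proof.
move=> FL; elim: s => [|i s ih].
  by under eq_fun do rewrite big_nil; exact: L2_0.
by under eq_fun do rewrite big_cons; exact: L2D.
Qed.

(** The common class of coefficients, their weak derivatives and test functions: closed under sums
    and products, and multiplying L^2 into itself. The bound holds only a.e. because that is what
    [Linfty] gives. *)
Definition abdd k := measurable_fun setT k /\
  exists M : R, \forall x \ae mu, `|k x| <= M.

Lemma itg_dom f g : measurable_fun setT f -> itg g ->
  (\forall x \ae mu, `|f x| <= `|g x|) -> itg f.
Proof.
move=> mf /integrableP[mg gi] fg; apply/integrableP; split.
  exact/measurable_EFinP.
apply: le_lt_trans gi; apply: ae_ge0_le_integral => //=.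
- exact/measurable_EFinP/measurableT_comp.
- by apply/measurable_EFinP/measurableT_comp => //; exact/measurable_EFinP.
- by apply: filterS fg => x /= ? _; rewrite lee_fin.
Qed.

Lemma L2_dom f g : measurable_fun setT f -> g \in L2f ->
  (\forall x \ae mu, `|f x| <= `|g x|) -> f \in L2f.
Proof.
move=> mf /L2P[mg gi] fg; apply/L2P; split => //.
apply: itg_dom gi _; first exact: measurable_funX.
by apply: filterS fg => x fg; rewrite !normrX lerXn2r ?nnegrE.
Qed.

Lemma L2Z (a : R) f : f \in L2f -> (fun x => a * f x) \in L2f.
Proof.
move=> /[dup] fL /L2P[mf fi]; apply/L2P; split.
  exact: measurable_funM.
under [X in itg X]eq_fun do rewrite exprMn.
by apply: eq_integrable (integrableZl _ (a ^+ 2) fi).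
Qed.

Lemma L2_bmul k f : abdd k -> f \in L2f -> (fun x => k x * f x) \in L2f.
Proof.
move=> [mk [M kM]] fL.
apply: L2_dom (L2Z M fL) _.
  by apply: measurable_funM => //; exact: L2_meas.
apply: filterS kM => x kM; rewrite !normrM ler_wpM2r//.
by rewrite (le_trans kM)// ler_norm.
Qed.

Lemma abdd_cst (a : R) : abdd (fun=> a).
Proof. by split; [exact: measurable_cst|exists `|a|; exact: nearW]. Qed.

Lemma abddL2 k : abdd k -> k \in L2f.
Proof.
move=> [mk [M kM]]; apply: L2_dom (_ : (cst M) \in L2f) _ => //; last first.
  by apply: filterS kM => x kM; rewrite (le_trans kM)// ler_norm.
apply/L2P; split => //.
apply/integrableP; split; first exact: (@measurable_cst _ _ _ _ setT (M ^+ 2)%:E).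
by rewrite (integral_cst mu measurableT `|M ^+ 2|%:E) lte_mul_pinfty// lee_fin.
Qed.

Lemma abddD k h : abdd k -> abdd h -> abdd (fun x => k x + h x).
Proof.
move=> [mk [M kM]] [mh [N hN]]; split; first exact: measurable_funD.
exists (M + N); apply: filterS2 kM hN => x kM hN.
by rewrite (le_trans (ler_normD _ _))// lerD.
Qed.

Lemma abddM k h : abdd k -> abdd h -> abdd (fun x => k x * h x).
Proof.
move=> [mk [M kM]] [mh [N hN]]; split; first exact: measurable_funM.
by exists (M * N); apply: filterS2 kM hN => x kM hN; rewrite normrM ler_pM.
Qed.

Lemma abdd_sum (I : Type) (s : seq I) (F : I -> T -> R) :
  (forall i, abdd (F i)) -> abdd (fun x => \sum_(i <- s) F i x).
Proof.
move=> FL; elim: s => [|i s ih].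
  by under eq_fun do rewrite big_nil; exact: abdd_cst.
by under eq_fun do rewrite big_cons; exact: abddD.
Qed.

Lemma RintD f g : itg f -> itg g ->
  \int[mu]_x (f x + g x) = \int[mu]_x f x + \int[mu]_x g x.
Proof. by move=> fi gi; rewrite RintegralD. Qed.

Lemma RintB f g : itg f -> itg g ->
  \int[mu]_x (f x - g x) = \int[mu]_x f x - \int[mu]_x g x.
Proof. by move=> fi gi; rewrite RintegralB. Qed.

Lemma RintZ (a : R) f : itg f -> \int[mu]_x (a * f x) = a * \int[mu]_x f x.
Proof. by move=> fi; rewrite RintegralZl. Qed.

Lemma itgD f g : itg f -> itg g -> itg (fun x => f x + g x).
Proof. by move=> fi gi; apply: eq_integrable (integrableD _ fi gi). Qed.

Lemma itgB f g : itg f -> itg g -> itg (fun x => f x - g x).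
Proof. by move=> fi gi; apply: eq_integrable (integrableB _ fi gi). Qed.

Lemma itgZ (a : R) f : itg f -> itg (fun x => a * f x).
Proof. by move=> fi; apply: eq_integrable (integrableZl _ a fi). Qed.

Lemma itg_sum (I : Type) (s : seq I) (F : I -> T -> R) :
  (forall i, itg (F i)) -> itg (fun x => \sum_(i <- s) F i x).
Proof.
move=> Fi; elim: s => [|i s ih].
  by under [X in itg X]eq_fun do rewrite big_nil; exact: integrable0.
by under [X in itg X]eq_fun do rewrite big_cons; exact: itgD.
Qed.

Lemma Rint_sum (I : Type) (s : seq I) (F : I -> T -> R) :
  (forall i, itg (F i)) ->
  \int[mu]_x (\sum_(i <- s) F i x) = \sum_(i <- s) \int[mu]_x F i x.
Proof.
move=> Fi; elim: s => [|i s ih].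
  under eq_Rintegral do rewrite big_nil.
  by rewrite big_nil Rintegral_cst// mul0r.
under eq_Rintegral do rewrite big_cons.
by rewrite RintD ?ih ?big_cons//; exact: itg_sum.
Qed.

Lemma Rint_ae f g : measurable_fun setT f -> measurable_fun setT g ->
  (\forall x \ae mu, f x = g x) ->
  \int[mu]_x f x = \int[mu]_x g x.
Proof.
move=> fi gi fg; rewrite /Rintegral; congr fine; apply: ae_eq_integral => //.
- exact/measurable_EFinP.
- exact/measurable_EFinP.
- by apply: filterS fg => x -> _.
Qed.

Lemma Rint_ge0 f : itg f -> (\forall x \ae mu, 0 <= f x) -> 0 <= \int[mu]_x f x.
Proof.
move=> /integrableP[/measurable_EFinP mf _] f0.
rewrite (_ : \int[mu]_x f x = \int[mu]_x `|f x|); last first.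
  apply: Rint_ae => //; first exact: measurableT_comp.
  by apply: filterS f0 => x /ger0_norm.
exact: Rintegral_ge0.
Qed.

Lemma Rint_le f g : itg f -> itg g -> (\forall x \ae mu, f x <= g x) ->
  \int[mu]_x f x <= \int[mu]_x g x.
Proof.
move=> fi gi fg; rewrite -subr_ge0 -RintB//; apply: Rint_ge0; first exact: itgB.
by apply: filterS fg => x; rewrite subr_ge0.
Qed.

Lemma ipC f g : ip f g = ip g f.
Proof. by apply: eq_Rintegral => x _; rewrite mulrC. Qed.

Lemma ipDl f g h : f \in L2f -> g \in L2f -> h \in L2f ->
  ip (fun x => f x + g x) h = ip f h + ip g h.
Proof.
move=> *; rewrite /ip -RintD; try exact: L2_ipitg.
by apply: eq_Rintegral => x _; rewrite mulrDl.
Qed.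

Lemma ipBl f g h : f \in L2f -> g \in L2f -> h \in L2f ->
  ip (fun x => f x - g x) h = ip f h - ip g h.
Proof.
move=> *; rewrite /ip -RintB; try exact: L2_ipitg.
by apply: eq_Rintegral => x _; rewrite mulrBl.
Qed.

Lemma ipZl a f h : f \in L2f -> h \in L2f ->
  ip (fun x => a * f x) h = a * ip f h.
Proof.
move=> *; rewrite /ip -RintZ; try exact: L2_ipitg.
by apply: eq_Rintegral => x _; rewrite mulrA.
Qed.

Lemma ipDr f g h : f \in L2f -> g \in L2f -> h \in L2f ->
  ip h (fun x => f x + g x) = ip h f + ip h g.
Proof. by move=> *; rewrite ipC ipDl// !(ipC h). Qed.

Lemma ipBr f g h : f \in L2f -> g \in L2f -> h \in L2f ->
  ip h (fun x => f x - g x) = ip h f - ip h g.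
Proof. by move=> *; rewrite ipC ipBl// !(ipC h). Qed.

Lemma ipZr a f h : f \in L2f -> h \in L2f ->
  ip h (fun x => a * f x) = a * ip h f.
Proof. by move=> *; rewrite ipC ipZl// (ipC h). Qed.

Lemma ip_suml (I : Type) (s : seq I) (F : I -> T -> R) h :
  (forall i, F i \in L2f) -> h \in L2f ->
  ip (fun x => \sum_(i <- s) F i x) h = \sum_(i <- s) ip (F i) h.
Proof.
move=> FL hL; rewrite /ip -Rint_sum; last by move=> i; exact: L2_ipitg.
by apply: eq_Rintegral => x _; rewrite mulr_suml.
Qed.

Lemma ip_ae f f' g g' : f \in L2f -> f' \in L2f -> g \in L2f -> g' \in L2f ->
  (\forall x \ae mu, f x = f' x) -> (\forall x \ae mu, g x = g' x) ->
  ip f g = ip f' g'.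
Proof.
move=> fL fL' gL gL' ff' gg'; apply: Rint_ae.
- by apply: measurable_funM; exact: L2_meas.
- by apply: measurable_funM; exact: L2_meas.
- by apply: filterS2 ff' gg' => x -> ->.
Qed.

Lemma ip_ge0 f : f \in L2f -> 0 <= ip f f.
Proof.
move=> fL; apply: Rint_ge0; first exact: L2_ipitg.
by apply: nearW => x; rewrite -expr2 sqr_ge0.
Qed.

Lemma n2_ge0 f : 0 <= n2 f. Proof. exact: sqrtr_ge0. Qed.

Lemma n2_sqr f : f \in L2f -> n2 f ^+ 2 = ip f f.
Proof. by move=> fL; rewrite /n2 sqr_sqrtr// ip_ge0. Qed.

(** The square of [n2 (f - t g)] is a nonnegative quadratic in [t], evaluated at its minimiser. *)
Lemma ip_CS f g : f \in L2f -> g \in L2f -> `|ip f g| <= n2 f * n2 g.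
Proof.
move=> fL gL.
have quad (t : R) : 0 <= ip f f - 2 * t * ip f g + t ^+ 2 * ip g g.
  have -> : ip f f - 2 * t * ip f g + t ^+ 2 * ip g g =
      ip (fun x => f x - t * g x) (fun x => f x - t * g x).
    rewrite ipBl ?ipBr ?ipZl ?ipZr//; try (by rewrite ?L2B ?L2Z).
    by rewrite (ipC g f); ring.
  by apply: ip_ge0; rewrite L2B// L2Z.
rewrite -ler_sqr ?nnegrE ?mulr_ge0 ?n2_ge0//.
rewrite real_normK ?num_real// exprMn !n2_sqr//.
have [g0|g0] := eqVneq (ip g g) 0; last first.
  have := quad (ip f g / ip g g).
  have gp : 0 < ip g g by rewrite lt_neqAle eq_sym g0 ip_ge0.
  rewrite (_ : _ + _ = (ip f f * ip g g - ip f g ^+ 2) / ip g g); last by field.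
  by rewrite pmulr_lge0 ?invr_gt0// subr_ge0.
rewrite g0 mulr0; have [->|fg0] := eqVneq (ip f g) 0; first by rewrite expr0n.
(* With [ip g g = 0] the quadratic is affine in [t]; this [t] is where it would equal [-1]. *)
have := quad ((ip f f + 1) / (2 * ip f g)).
rewrite g0 mulr0 addr0 (_ : _ - _ = - 1); last by field.
by rewrite leNgt ltrN10.
Qed.

Lemma ip_le_n2 f g : f \in L2f -> g \in L2f -> ip f g <= n2 f * n2 g.
Proof. by move=> fL gL; exact: le_trans (ler_norm _) (ip_CS fL gL). Qed.

Lemma n2_D f g : f \in L2f -> g \in L2f ->
  n2 (fun x => f x + g x) <= n2 f + n2 g.
Proof.
move=> fL gL; rewrite -(ler_sqr (n2_ge0 _)) ?nnegrE ?addr_ge0 ?n2_ge0//.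
have fgL := L2D fL gL.
rewrite sqrrD !n2_sqr// ipDl// !ipDr// (ipC g f).
have := ip_le_n2 fL gL; lra.
Qed.

Lemma n2_Z a f : f \in L2f -> n2 (fun x => a * f x) = `|a| * n2 f.
Proof.
move=> fL; rewrite /n2 ipZl ?ipZr ?L2Z// mulrA -expr2 sqrtrM ?sqr_ge0//.
by rewrite sqrtr_sqr.
Qed.

Lemma n2_mono f g : f \in L2f -> g \in L2f ->
  (\forall x \ae mu, `|f x| <= `|g x|) -> n2 f <= n2 g.
Proof.
move=> fL gL fg; apply: ler_wsqrtr; apply: Rint_le; try exact: L2_ipitg.
by apply: filterS fg => x fg; rewrite -!expr2 -(real_normK (num_real (f x)))
  -(real_normK (num_real (g x))) lerXn2r ?nnegrE.
Qed.

Lemma n2_ae f g : f \in L2f -> g \in L2f ->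
  (\forall x \ae mu, f x = g x) -> n2 f = n2 g.
Proof. by move=> fL gL fg; rewrite /n2 (@ip_ae f g f g). Qed.

Lemma n2_N f : f \in L2f -> n2 (fun x => - f x) = n2 f.
Proof.
move=> fL; apply/eqP; rewrite eq_le; apply/andP; split; apply: n2_mono;
  rewrite ?L2N//; by apply: nearW => x; rewrite normrN.
Qed.

Lemma n2_eq0 f : f \in L2f -> n2 f = 0 -> \forall x \ae mu, f x = 0.
Proof.
move=> fL f0; have mf := L2_meas fL.
have ff0 : ip f f = 0 by rewrite -n2_sqr// f0 expr0n.
have mff : measurable_fun setT (fun x => (f x * f x)%:E).
  exact/measurable_EFinP/measurable_funM.
have : (\int[mu]_x `|(f x * f x)%:E| = 0)%E.
  under eq_integral => x _ do rewrite /= ger0_norm -?expr2 ?sqr_ge0// expr2.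
  have : (\int[mu]_x (f x * f x)%:E)%E \is a fin_num.
    by have := integrable_fin_num measurableT (L2_ipitg fL fL).
  by move=> /fineK <-; congr EFin; exact: ff0.
move=> /(ae_eq_integral_abs mu measurableT mff).
apply: filterS => x /(_ I) [/eqP].
by rewrite mulf_eq0 orbb => /eqP.
Qed.

Lemma Lnorm_n2 f : f \in L2f -> 'N[mu]_2%:E[EFin \o f]%E = (n2 f)%:E.
Proof.
move=> fL; rewrite unlock /Lnorm.
under eq_integral => x _ do rewrite /= powR_mulrn// -normrX ger0_norm ?sqr_ge0// expr2.
rewrite -[X in (X `^ _)%E]fineK; last exact/integrable_fin_num/L2_ipitg.
by rewrite poweR_EFin powR12_sqrt// ip_ge0.
Qed.

End L2_toolkit.

(** Continuous induction: the estimate with a slightly larger slope holds up to some supremum, the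
    left hypothesis carries it to the supremum itself, and the right hypothesis pushes it beyond.
    Only right difference quotients enter, which is all that the generator controls. *)
Lemma dini_le (R : realType) (f : R -> R) (T g : R) : 0 <= T ->
  (forall t e, 0 <= t < T -> 0 < e ->
     \forall h \near 0^'+, f (t + h) <= f t + h * (g + e)) ->
  (forall t e, 0 < t <= T -> 0 < e ->
     \forall h \near 0^'+, f t <= f (t - h) + e) ->
  f T <= f 0 + g * T.
Proof.
move=> T0 Hr Hl; apply/ler_addgt0Pr => e e0.
(* The extra slope contributes [e' * T <= e]; the [+ 1] covers [T = 0]. *)
pose e' := e / (T + 1).
have e'0 : 0 < e' by rewrite divr_gt0// ltr_wpDl.
suff H : f T <= f 0 + (g + e') * T.
  have : e' * T <= e.
    by rewrite /e' mulrAC ler_pdivrMr ?ltr_wpDl// ler_pM2l//; lra.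
  by move: H; lra.
(* Asking for the estimate on all of [[0, t]] makes [A] an interval, so it holds everywhere below
   [sup A]. *)
pose A := [set t | 0 <= t <= T /\
  forall s, 0 <= s <= t -> f s <= f 0 + (g + e') * s].
have A0 : A 0.
  split; first by rewrite lexx.
  by move=> s; rewrite -eq_le => /eqP <-; rewrite mulr0 addr0.
have supA : has_sup A by split; [exists 0|exists T => t [/andP[]]].
have ub t : A t -> t <= sup A by move=> At; apply: ub_le_sup => //; case: supA.
set m := sup A.
have m0 : 0 <= m by exact: ub.
have mT : m <= T by apply: ge_sup; [exists 0|move=> t [/andP[]]].
have Alt s : 0 <= s -> s < m -> f s <= f 0 + (g + e') * s.
  move=> s0 sm; have [t [_ At] st] := sup_adherent (ltac:(by rewrite subr_gt0) : 0 < m - s) supA.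
  by apply: At; rewrite s0/= ltW//; move: st; rewrite -/m; lra.
have Am : f m <= f 0 + (g + e') * m.
  move: m0; rewrite le_eqVlt => /orP[/eqP <-|m0]; first by rewrite mulr0 addr0.
  apply/ler_addgt0Pr => r r0.
  have r20 : 0 < r / 2 by rewrite divr_gt0.
  have /(_ _ r20) := Hl m _ (ltac:(by rewrite m0 mT) : 0 < m <= T).
  have c0 : 0 < Num.min m (r / 2 / (`|g + e'| + 1)).
    by rewrite lt_min m0 divr_gt0// ltr_wpDl.
  move=> Hm; near (0 : R)^'+ => h.
  have h0 : 0 < h by near: h; exact: nbhs_right_gt.
  have hc : h < Num.min m (r / 2 / (`|g + e'| + 1)) by near: h; exact: nbhs_right_lt.
  move: hc; rewrite lt_min => /andP[hm]; rewrite ltr_pdivlMr ?ltr_wpDl// => hr.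
  have H1 : f m <= f (m - h) + r / 2 by near: h.
  have H2 : f (m - h) <= f 0 + (g + e') * (m - h) by apply: Alt; lra.
  have H3 : `|g + e'| * h <= r / 2 by lra.
  have H4 : - (g + e') * h <= r / 2.
    apply: le_trans H3; apply: ler_wpM2r; first exact: ltW.
    by rewrite -(normrN (g + e')) ler_norm.
  nra.
suff : ~~ (m < T).
  by rewrite -leNgt => Tm; have -> : T = m by apply/eqP; rewrite eq_le Tm mT.
apply/negP => mltT.
have H := Hr m _ (ltac:(by rewrite m0 mltT) : 0 <= m < T) e'0.
have [/= d d0 dH] : exists2 d : R, 0 < d & forall h, 0 < h < d -> f (m + h) <= f m + h * (g + e').
  move: H => /nbhs_ballP[d /= d0 dH]; exists d => // h /andP[h0 hd].
  by apply: dH => //; rewrite /ball/= sub0r normrN gtr0_norm.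
pose h := Num.min (d / 2) (T - m).
have h0 : 0 < h by rewrite lt_min divr_gt0//= subr_gt0.
have hd : h < d by rewrite gt_min ltr_pdivrMr// ltr_pMr// ltr1n.
have hT : h <= T - m by rewrite ge_min lexx orbT.
have : A (m + h).
  split; first by apply/andP; split; lra.
  move=> s /andP[s0 sh]; have [sm|ms] := ltP s m; first exact: Alt.
  move: ms; rewrite le_eqVlt => /orP[/eqP <-//|ms].
  have := dH (s - m) (ltac:(by apply/andP; split; lra)); rewrite addrC subrK.
  by move=> /le_trans; apply; move: Am; lra.
by move/ub; rewrite -/m; lra.
Unshelve. all: by end_near.
Qed.

(** If no [E n] were dense in a ball, the complements of their closures would be open and dense, and
    by Baire they would share a point of the interval, which no [E n] could contain. *)
Lemma Baire_interval (R : realType) (a b : R) (E : nat -> set R) : a < b ->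
  `]a, b[ `<=` \bigcup_n E n ->
  exists n t r, [/\ 0 < r, a < t < b & ball t r `<=` closure (E n)].
Proof.
move=> ab cov; apply: contrapT => Hn.
(* Cutting [E n] down to the interval puts the centre of the ball inside []a, b[]: it is taken in
   [E n] itself. *)
pose F n : set R^o := ~` closure (E n `&` `]a, b[).
have FD n : open (F n) /\ dense (F n).
  split; first by apply: closed_openC; exact: closed_closure.
  move=> O [x Ox] oO; apply: contrapT => FO0.
  have Ocl : O `<=` closure (E n `&` `]a, b[).
    by move=> y Oy; apply: contrapT => Fy; apply: FO0; exists y.
  have [y [[Ey]]] := Ocl _ Ox _ (open_nbhs_nbhs (conj oO Ox)).
  rewrite /= in_itv/= => yab Oy; apply: Hn.
  have /nbhs_ballP[r /= r0 rO] := open_nbhs_nbhs (conj oO Oy : open_nbhs y O).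
  exists n, y, r; split => // z /rO /Ocl; apply: closure_subset.
  by move=> ? [].
have /(_ `]a, b[%classic) := @Baire _ R^o F FD.
case.
- by exists ((a + b) / 2); rewrite /= in_itv/=; lra.
- exact: interval_open.
move=> x [xab xF]; have [n _ En] := cov x xab.
by apply: (xF n I); apply: subset_closure.
Qed.

(** * Elements of L^2(Omega) and strongly continuous semigroups on them *)

Section L2_elements.
Context (R : realType) (d : nat) (Omega : set 'rV[R]_d) (oO : open Omega).
Local Notation mu := (leb_on oO).
Local Notation L2O := (L2 oO).
Implicit Types f g : L2O.

Lemma L2_in f : (f : 'rV[R]_d -> R) \in Lfun mu 2%:E.
Proof. exact: LfunP. Qed.

Lemma L2DE f g x : (f + g : L2O) x = f x + g x. Proof. by []. Qed.

Lemma L2BE f g x : (f - g : L2O) x = f x - g x. Proof. by []. Qed.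

Lemma L2ZE k f x : (k *: f : L2O) x = k * f x. Proof. by []. Qed.

Lemma L2_0E x : (0 : L2O) x = 0. Proof. by []. Qed.

Lemma nrm2E f : nrm2 f = n2 mu f.
Proof. by rewrite /nrm2 Lnorm_n2// L2_in. Qed.

Lemma nrm2_ge0 f : 0 <= nrm2 f. Proof. by rewrite nrm2E n2_ge0. Qed.

Lemma nrm2_ae f g : f = g %[ae mu] -> nrm2 f = nrm2 g.
Proof.
move=> fg; rewrite !nrm2E; apply: n2_ae; try exact: L2_in.
by apply: filterS fg => x; apply.
Qed.

Lemma nrm2D f g : nrm2 (f + g) <= nrm2 f + nrm2 g.
Proof. by rewrite !nrm2E; exact: (n2_D (L2_in f) (L2_in g)). Qed.

Lemma nrm2Z k f : nrm2 (k *: f) = `|k| * nrm2 f.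
Proof. by rewrite !nrm2E; exact: (n2_Z k (L2_in f)). Qed.

Lemma nrm2N f : nrm2 (- f) = nrm2 f.
Proof. by rewrite -scaleN1r nrm2Z normrN1 mul1r. Qed.

Lemma nrm2_dist f g : nrm2 (f - g) = nrm2 (g - f).
Proof. by rewrite -nrm2N opprB. Qed.

Lemma nrm2_sub f g : nrm2 f <= nrm2 g + nrm2 (f - g).
Proof. by rewrite -{1}[f](subrK g) addrC [leRHS]addrC; rewrite addrC nrm2D. Qed.

Lemma ae_refl f : f = f %[ae mu]. Proof. exact: ae_eq_refl. Qed.

Section semigroup.
Variable S : R -> L2O -> L2O.
Hypothesis S_C0 : C0_semigroup S.

Lemma C0_sub t f g : 0 <= t -> S t (f - g) = S t f - S t g %[ae mu].
Proof.
move=> t0; rewrite addrC -scaleN1r.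
apply: (ae_eq_trans (C0_linear S_C0 (-1) g f t0)).
by rewrite scaleN1r addrC; exact: ae_refl.
Qed.

Lemma C0_zero t : 0 <= t -> S t 0 = (0 : L2O) %[ae mu].
Proof.
move=> t0; have := C0_sub 0 0 t0; rewrite subrr => H.
apply: (ae_eq_trans H); apply: nearW => x _.
by rewrite L2BE subrr.
Qed.

Lemma C0_bounded_ge0 t : 0 <= t ->
  exists2 M, 0 <= M & forall f, nrm2 (S t f) <= M * nrm2 f.
Proof.
move=> t0; have [M HM] := C0_bounded S_C0 t0.
exists `|M| => // f; apply: (le_trans (HM f)).
by rewrite ler_wpM2r ?nrm2_ge0// ler_norm.
Qed.

Lemma C0_sub_bounded t : 0 <= t -> exists2 M, 0 <= M &
  forall f g, nrm2 (S t f - S t g) <= M * nrm2 (f - g).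
Proof.
move=> t0; have [M M0 HM] := C0_bounded_ge0 t0; exists M => // f g.
by rewrite -(nrm2_ae (C0_sub f g t0)).
Qed.

Lemma C0_right t f e : 0 <= t -> 0 < e ->
  \forall h \near 0^'+, nrm2 (S (t + h) f - S t f) < e.
Proof.
move=> t0 e0; have /cvgrPdist_lt/(_ e e0) := C0_cont S_C0 (S t f).
move=> H; near=> h.
have h0 : 0 <= h by apply: ltW; near: h; exact: nbhs_right_gt.
have -> : nrm2 (S (t + h) f - S t f) = nrm2 (S h (S t f) - S t f).
  apply: nrm2_ae; rewrite (addrC t); apply: filterS (C0_comp S_C0 f h0 t0).
  by move=> x H' _; rewrite !L2BE H'.
rewrite -[ltLHS]ger0_norm ?nrm2_ge0// -normrN -sub0r.
by near: h.
Unshelve. all: by end_near.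
Qed.

(* L^2 is not known to be complete here, so uniform boundedness of S near s is
   obtained from the Baire property of the time axis instead: the sets
   [S_t is bounded by n] are closed under limits from the right. *)
Lemma C0_left s f e : 0 < s -> 0 < e ->
  \forall h \near 0^'+, nrm2 (S s f - S (s - h) f) < e.
Proof.
move=> s0 e0.
pose E (n : nat) := [set t : R | 0 < t /\ forall g, nrm2 (S t g) <= n%:R * nrm2 g].
have [n [t0 [r [r0 /andP[t00 t0s] rE]]]] := @Baire_interval R 0 s E s0 (ltac:(
  move=> t; rewrite /= in_itv/= => /andP[tp _];
  have [M M0 HM] := C0_bounded_ge0 (ltW tp);
  exists (Num.bound M) => //; split => // g; apply: le_trans (HM g) _;
  by rewrite ler_wpM2r ?nrm2_ge0// ltW// archi_boundP)).
have Sn t g : 0 <= t -> ball t0 r t -> nrm2 (S t g) <= n%:R * nrm2 g.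
  move=> tp tb; apply/ler_addgt0Pr => z z0.
  have [/= d' d0 dH] : exists2 d : R, 0 < d &
      forall h, 0 < h < d -> nrm2 (S (t + h) g - S t g) < z.
    have /nbhs_ballP[d' /= d0 dH] := C0_right g tp z0.
    exists d' => // h /andP[h0 hd].
    by apply: dH => //; rewrite /ball/= sub0r normrN gtr0_norm.
  have [a /andP[ta ad] ar] : exists2 a, t < a < t + d' & ball t0 r a.
    move: tb; rewrite /ball/= ltr_norml => /andP[tb1 tb2].
    (* A point right of [t] but still in the ball, so that [E n], dense there, has points [a']
       arbitrarily close to it. *)
    exists (Num.min (t + d' / 2) ((t + (t0 + r)) / 2)).
      apply/andP; split; first by rewrite lt_min; apply/andP; split; lra.
      by rewrite gt_min; apply/orP; left; lra.
    rewrite ltr_norml; apply/andP; split.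
      by rewrite ltrBrDl -ltrBrDr gt_min; apply/orP; right; lra.
    by rewrite ltrBlDr -ltrBlDl lt_min; apply/andP; split; lra.
  have : nbhs a `]t, (t + d')[%classic.
    by apply: open_nbhs_nbhs; split; [exact: interval_open|rewrite /= in_itv/= ta].
  move=> /(rE _ ar) [a' [[_ Ea']]]; rewrite /= in_itv/= => /andP[ta' a'd].
  rewrite (le_trans (nrm2_sub _ (S a' g)))// lerD//.
  have -> : a' = t + (a' - t) by rewrite addrC subrK.
  by rewrite nrm2_dist ltW// dH//; lra.
have [M M0 HM] := C0_bounded_ge0 (ltac:(by lra) : 0 <= s - t0).
have e1 : 0 < e / (n%:R * M + 1) by rewrite divr_gt0// ltr_wpDl// mulr_ge0.
have := C0_cont S_C0 f => /cvgrPdist_lt/(_ _ e1) H.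
near=> h.
have h0 : 0 < h by near: h; exact: nbhs_right_gt.
have hm : h < Num.min r t0 by near: h; apply: nbhs_right_lt; rewrite lt_min r0 t00.
move: hm; rewrite lt_min => /andP[hr ht].
have Hh : nrm2 (S h f - f) < e / (n%:R * M + 1).
  rewrite -[ltLHS]ger0_norm ?nrm2_ge0// -normrN -sub0r; by near: h.
have sh0 : 0 <= s - h by lra.
(* The uniform bound is available near [t0 < s] only, so [S (s - h)] is factored as [S (t0 - h)]
   after the fixed operator [S (s - t0)], both applied to the small vector [S h f - f]. *)
have -> : nrm2 (S s f - S (s - h) f) = nrm2 (S (t0 - h) (S (s - t0) (S h f - f))).
  apply: nrm2_ae; apply: ae_eq_sym.
  have st0 : 0 <= s - t0 by lra.
  have th0 : 0 <= t0 - h by lra.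
  apply: ae_eq_trans (ae_eq_sym (C0_comp S_C0 _ th0 st0)) _.
  rewrite (_ : t0 - h + (s - t0) = s - h); last by ring.
  apply: ae_eq_trans (C0_sub _ _ sh0) _.
  have := C0_comp S_C0 f sh0 (ltW h0); rewrite subrK.
  by apply: filterS => x H' _; rewrite !L2BE -H'.
rewrite (le_lt_trans (Sn _ _ _ _))//; first by lra.
  by rewrite /ball/= opprB addrC subrK gtr0_norm.
rewrite (@le_lt_trans _ _ (n%:R * M * (e / (n%:R * M + 1))))//.
  rewrite -mulrA ler_wpM2l// (le_trans (HM _))// ler_wpM2l//; exact: ltW.
rewrite mulrA ltr_pdivrMr ?ltr_wpDl ?mulr_ge0//.
by rewrite mulrC ltr_pM2l// ltrDl.
Unshelve. all: by end_near.
Qed.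

(** [S t] commutes with the difference quotients and is bounded, so it passes through the limit that
    defines the generator; in particular D(A) is invariant. *)
Lemma generator_orbit t f g : 0 <= t -> generator S f g ->
  generator S (S t f) (S t g).
Proof.
move=> t0 Gfg; rewrite /generator.
have [M M0 HM] := C0_sub_bounded t0.
have B h : 0 < h -> nrm2 (h^-1 *: (S h (S t f) - S t f) - S t g) <=
    M * nrm2 (h^-1 *: (S h f - f) - g).
  move=> h0; apply: le_trans (HM _ _); rewrite le_eqVlt; apply/orP; left.
  apply/eqP/nrm2_ae.
  have A1 := C0_comp S_C0 f (ltW h0) t0.
  have A2 := C0_comp S_C0 f t0 (ltW h0).
  have A3 := C0_linear S_C0 (h^-1) (S h f - f) 0 t0.
  have A4 := C0_sub (S h f) f t0; have A5 := C0_zero t0.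
  rewrite addr0 in A3.
  move: A1; apply: filter_app; move: A2; apply: filter_app.
  move: A3; apply: filter_app; move: A4; apply: filter_app.
  apply: filterS A5 => x A5 A4 A3 A2 A1 _.
  have {}A1 := A1 I; have {}A2 := A2 I; have {}A3 := A3 I.
  have {}A4 := A4 I; have {}A5 := A5 I.
  rewrite L2DE in A3; rewrite L2ZE A4 A5 in A3.
  rewrite L2BE in A3; rewrite !L2BE A3 L2ZE L2BE -A1 -A2.
  by rewrite addr0 (addrC h).
apply: (@squeeze_cvgr _ _ _ _ (fun=> 0) (fun h => M * nrm2 (h^-1 *: (S h f - f) - g))).
- near=> h; rewrite nrm2_ge0/= B//; near: h; exact: nbhs_right_gt.
- exact: cvg_cst.
- by rewrite -[X in _ --> X](mulr0 M); apply: cvgMr.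
Unshelve. all: by end_near.
Qed.

End semigroup.
End L2_elements.

(** * The flat function exp(-1/t) and its derivatives *)

Section flat_functions.
Context (R : realType).
Implicit Types (P : {poly R}) (t : R).

(** [P = 1] gives the [e] of the overview. General [P] are there because the family is then closed
    under differentiation, so smoothness follows from one derivative formula. *)
Definition flat P t : R := if 0 < t then P.[t^-1] * expR (- t^-1) else 0.

(** With [u = 1/t] one has [d/dt = - u^2 d/du], which sends [P(u) exp(-u)] to
    [u^2 (P - P')(u) exp(-u)]. *)
Definition flat_next P : {poly R} := 'X^2 * (P - P^`()).

Lemma is_derive_horner P (x : R) : is_derive x 1 (fun y => P.[y]) P^`().[x].
Proof.
elim/poly_ind: P => [|P c ih].
  under eq_fun do rewrite horner0.
  by rewrite derivC horner0; exact: is_derive_cst.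
under eq_fun do rewrite hornerMXaddC.
rewrite derivMXaddC hornerD hornerMX.
have H := is_deriveD (is_deriveM ih (is_derive_id x 1)) (is_derive_cst c x 1).
apply: is_derive_eq H _ => /=.
by rewrite /GRing.scale /= mulr1 addr0 (mulrC x).
Qed.

(** The exponential beats every polynomial in [1/h]. A quadratic bound at 0 is what makes the
    derivative there exist and vanish, for every [P] at once. *)
Lemma flat_le_sqr P : exists2 C, 0 <= C &
  forall h, `|h| <= 1 -> `|flat P h| <= C * h ^+ 2.
Proof.
pose A := \sum_(i < size P) `|P`_i|.
have A0 : 0 <= A by apply: sumr_ge0.
(* [m.+1 = size P + 2]: the two spare powers of [u = 1/h] become [h ^+ 2]. *)
pose m := (size P).+1.
exists (A * (m.+1)`!%:R); first by rewrite mulr_ge0.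
move=> h h1; rewrite /flat; case: ifPn => h0; last first.
  by rewrite normr0 mulr_ge0 ?sqr_ge0// mulr_ge0.
rewrite gtr0_norm// in h1.
set u := h^-1.
have u1 : 1 <= u by rewrite /u invf_ge1.
have u0 : 0 < u by rewrite invr_gt0.
have Pu : `|P.[u]| <= A * u ^+ size P.
  rewrite horner_coef (le_trans (ler_norm_sum _ _ _))// mulr_suml ler_sum// => i _.
  rewrite normrM ler_wpM2l// (ger0_norm (exprn_ge0 _ (ltW u0))).
  exact: (ler_weXn2l u1 (ltnW (ltn_ord i))).
have Eu : u ^+ m.+1 <= (m.+1)`!%:R * expR u.
  have := @expR_ge1Dxn R u m (ltW u0).
  rewrite -ler_pdivrMl ?ltr0n ?fact_gt0//.
  by apply: le_trans; rewrite mulrC lerDr.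
rewrite normrM (ger0_norm (expR_ge0 _)) expRN ler_pdivrMr ?expR_gt0//.
apply: (le_trans Pu).
have -> : u ^+ size P = u ^+ m.+1 * h ^+ 2.
  by rewrite /m -addn2 exprD -mulrA -exprMn mulVf ?gt_eqF// expr1n mulr1.
rewrite [leRHS](_ : _ = A * (((m.+1)`!%:R * expR u) * h ^+ 2)); last by ring.
by rewrite ler_wpM2l// ler_wpM2r ?sqr_ge0.
Qed.

Lemma is_derive_flat P t : is_derive t 1 (flat P) (flat (flat_next P) t).
Proof.
have [t0|t0|->] := ltgtP t 0.
- have -> : flat (flat_next P) t = 0 by rewrite /flat ltNge ltW.
  apply: (@near_eq_is_derive _ _ _ (cst 0)).
  near=> x; rewrite /flat ltNge ltW//.
  by near: x; apply: lt_nbhsl.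
- have tN0 : t != 0 by rewrite gt_eqF.
  have -> : flat (flat_next P) t =
      (t ^- 2 * (P - P^`()).[t^-1]) * expR (- t^-1).
    by rewrite /flat t0 /flat_next hornerM hornerXn exprVn.
  have near_t : \forall x \near t, P.[x^-1] * expR (- x^-1) = flat P x.
    near=> x; rewrite /flat ifT//.
    by near: x; apply: lt_nbhsr.
  apply: (near_eq_is_derive near_t).
  have dV : is_derive t 1 (fun x : R => x^-1) (- t ^- 2).
    have H := @is_deriveV R id t 1 1 tN0 (is_derive_id t 1).
    by apply: is_derive_eq H _; rewrite /GRing.scale/= mulr1.
  have d1 := is_derive1_comp (is_derive_horner P t^-1) dV.
  have d2 := is_derive1_comp (f := expR) (g := fun x : R => - x^-1) (is_derive_expR (- t^-1)) (is_deriveN dV).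
  have H := is_deriveM d1 d2.
  apply: is_derive_eq H _ => /=.
  by rewrite /GRing.scale /= hornerD hornerN opprK; ring.
(* At 0 the difference quotient is at most [C |h|] by [flat_le_sqr]. *)
- have -> : flat (flat_next P) 0 = 0 by rewrite /flat ltxx.
  have [C C0 HC] := flat_le_sqr P.
  have f0 : flat P 0 = 0 by rewrite /flat ltxx.
  have H : h^-1 *: ((flat P \o shift (0 : R)) (h *: (1 : R)) - flat P 0) @[h --> 0^'] --> (0 : R).
    apply/cvgr0Pnorm_le => e e0; near=> h.
    have h0 : h != 0 by near: h; exact: nbhs_dnbhs_neq.
    have h1 : `|h| <= 1.
      by near: h; apply: dnbhs0_le.
    have he : `|h| <= e / (C + 1) by near: h; apply: dnbhs0_le; rewrite divr_gt0// ltr_wpDl.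
    rewrite /= f0 subr0 addr0 /GRing.scale /= mulr1 normrM normfV.
    rewrite mulrC ler_pdivrMr ?normr_gt0//.
    apply: (le_trans (HC _ h1)).
    rewrite -(real_normK (num_real h)) expr2 mulrA ler_wpM2r//.
    move: he; rewrite ler_pdivlMr ?ltr_wpDl// => he.
    by have := normr_ge0 h; lra.
  by apply: DeriveDef; [apply/cvg_ex; exists 0|apply: cvg_lim].
Unshelve. all: by end_near.
Qed.

Lemma is_derive_flat_iter P n t :
  is_derive t 1 (flat (iter n flat_next P)) (flat (iter n.+1 flat_next P) t).
Proof. exact: is_derive_flat. Qed.

Lemma flat_le0 P t : t <= 0 -> flat P t = 0.
Proof. by move=> t0; rewrite /flat ltNge t0. Qed.

End flat_functions.

(** * Calculus of C^k functions, test functions and the squared distance *)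

Section smooth.
Context (R : realType) (d : nat).
Local Notation E := 'rV[R]_d.
Implicit Types (f g : E -> R) (i : 'I_d).
Local Notation e_ i := (delta_mx ord0 i : E).

Lemma derivable_line f x v : derivable f x v <->
  derivable (fun h : R => f (h *: v + x)) 0 1.
Proof.
rewrite /derivable.
suff -> : (fun h : R => h^-1 *: ((f \o shift x) (h *: v) - f x)) =
  (fun h : R => h^-1 *: (((fun h : R => f (h *: v + x)) \o shift 0) (h *: 1) -
       (f (0 *: v + x)))) by [].
by apply/funext => h /=; rewrite scale0r add0r addr0 /GRing.scale/= mulr1.
Qed.

Lemma derive_line f x v : 'D_v f x = 'D_1 (fun h : R => f (h *: v + x)) 0.
Proof.
rewrite /derive.
suff -> : (fun h : R => h^-1 *: ((f \o shift x) (h *: v) - f x)) =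
  (fun h : R => h^-1 *: (((fun h : R => f (h *: v + x)) \o shift 0) (h *: 1) -
       (f (0 *: v + x)))) by [].
by apply/funext => h /=; rewrite scale0r add0r addr0 /GRing.scale/= mulr1.
Qed.

(** [Ck] provides partial derivatives rather than a differential, so the chain rule is taken along
    lines, where it is the one-variable rule. *)
Lemma is_derive_line f x v a : is_derive x v f a <->
  is_derive (0 : R) 1 (fun h : R => f (h *: v + x)) a.
Proof.
split=> -[df <-].
  by apply: DeriveDef; [exact: (iffLR (derivable_line f x v))|rewrite -derive_line].
by apply: DeriveDef; [exact: (iffRL (derivable_line f x v))|rewrite derive_line].
Qed.

Lemma is_derive_comp1 (g : R -> R) f x v a b :
  is_derive (f x) 1 g a -> is_derive x v f b -> is_derive x v (g \o f) (a * b).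
Proof.
move=> dg /is_derive_line df; apply/is_derive_line.
apply: (is_derive1_comp (f := g) (g := fun h : R => f (h *: v + x))) df.
by rewrite scale0r add0r.
Qed.

Definition pdiff i f := forall x, derivable f x (e_ i).

Lemma pdiff_cst i (k : R) : pdiff i (fun _ : E => k).
Proof. by move=> x; exact: derivable_cst. Qed.

Lemma pdiffP i f x : pdiff i f -> is_derive x (e_ i) f (partial i f x).
Proof. by move=> pf; apply: DeriveDef. Qed.

Lemma partialP i f x a : is_derive x (e_ i) f a -> partial i f x = a.
Proof. by move=> [_ <-]. Qed.

Lemma CkW k f : Ck k.+1 f -> Ck k f.
Proof.
elim: k f => [|k ih] f; first by case.
by case=> cf df; split => // i; have [di /ih] := df i.
Qed.

Lemma CinftyP f : Cinfty f -> forall i, pdiff i f /\ Cinfty (partial i f).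
Proof.
move=> Cf i; split=> [|k]; first by have [_ /(_ i)[]] := Cf 1%N.
by have [_ /(_ i)[]] := Cf k.+1.
Qed.

Lemma Cinfty_cont f : Cinfty f -> continuous f.
Proof. by move=> /(_ 0%N). Qed.

Lemma partial_cst i (a : R) : partial i (fun=> a) = (fun=> 0).
Proof. by apply/funext => x; apply: partialP; exact: is_derive_cst. Qed.

Lemma Ck_cst k (a : R) : Ck k (fun _ : E => a).
Proof.
elim: k a => [|k ih] a /=; first exact: cst_continuous.
split; first exact: cst_continuous.
by move=> i; split; [move=> x; exact: derivable_cst|rewrite partial_cst; exact: ih].
Qed.

Lemma is_derive_coord i j x : is_derive x (e_ i) (fun y => y ord0 j) (i == j)%:R.
Proof.
apply/is_derive_line.
have -> : (fun h : R => (h *: e_ i + x) ord0 j) = (fun h => h * (i == j)%:R + x ord0 j).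
  by apply/funext => h; rewrite !mxE eqxx (eq_sym j).
have H := is_deriveD (is_deriveM (is_derive_id (0 : R) 1) (is_derive_cst ((i == j)%:R : R) (0 : R) 1)) (is_derive_cst (x ord0 j) (0 : R) 1).
apply: is_derive_eq H _.
by rewrite /GRing.scale/= mulr1 mulr0 add0r addr0.
Qed.

Lemma partial_coord i j : partial i (fun y : E => y ord0 j) = (fun=> (i == j)%:R).
Proof. by apply/funext => x; apply: partialP; exact: is_derive_coord. Qed.

Lemma Ck_coord k j : Ck k (fun x : E => x ord0 j).
Proof.
case: k => [|k] /=; first exact: coord_continuous.
split; first exact: coord_continuous.
move=> i; split; first by move=> x; case: (is_derive_coord i j x).
by rewrite partial_coord; exact: Ck_cst.
Qed.

Lemma partialD i f g : pdiff i f -> pdiff i g ->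
  partial i (fun x => f x + g x) = (fun x => partial i f x + partial i g x).
Proof.
move=> df dg; apply/funext => x; apply: partialP.
by apply: is_deriveD; exact: pdiffP.
Qed.

Lemma partialM i f g : pdiff i f -> pdiff i g ->
  partial i (fun x => f x * g x) = (fun x => f x * partial i g x + g x * partial i f x).
Proof.
move=> df dg; apply/funext => x; apply: partialP.
by apply: is_deriveM; exact: pdiffP.
Qed.

Lemma pdiffD i f g : pdiff i f -> pdiff i g -> pdiff i (fun x => f x + g x).
Proof. by move=> df dg x; apply: derivableD. Qed.

Lemma pdiffM i f g : pdiff i f -> pdiff i g -> pdiff i (fun x => f x * g x).
Proof. by move=> df dg x; have := derivableM (df x) (dg x). Qed.

Lemma CkD k f g : Ck k f -> Ck k g -> Ck k (fun x => f x + g x).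
Proof.
elim: k f g => [|k ih] f g.
  by move=> cf cg x; exact: cvgD (cf x) (cg x).
move=> [cf df] [cg dg]; split; first by move=> x; exact: cvgD (cf x) (cg x).
move=> i; have [dfi cfi] := df i; have [dgi cgi] := dg i.
split; first exact: (pdiffD dfi dgi).
by rewrite (partialD dfi dgi); exact: ih.
Qed.

Lemma CkM k f g : Ck k f -> Ck k g -> Ck k (fun x => f x * g x).
Proof.
elim: k f g => [|k ih] f g; first by move=> cf cg x; exact: cvgM (cf x) (cg x).
move=> Cf Cg; have := Cf; have := Cg => -[cg dg] [cf df]; split.
  by move=> x; exact: cvgM (cf x) (cg x).
move=> i; have [dfi cfi] := df i; have [dgi cgi] := dg i.
split; first exact: (pdiffM dfi dgi).
rewrite (partialM dfi dgi); apply: CkD.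
  by apply: ih; [exact: (CkW Cf)|exact: cgi].
by apply: ih; [exact: (CkW Cg)|exact: cfi].
Qed.

Lemma Ck_sum (I : Type) (s : seq I) (F : I -> E -> R) k :
  (forall j, Ck k (F j)) -> Ck k (fun x => \sum_(j <- s) F j x).
Proof.
move=> FC; elim: s => [|j s ih].
  by under eq_fun do rewrite big_nil; exact: Ck_cst.
by under eq_fun do rewrite big_cons; exact: CkD.
Qed.

Lemma is_derive_cont1 (g : R -> R) (g' : R -> R) :
  (forall t : R, is_derive t 1 g (g' t)) -> continuous g.
Proof.
move=> dg t; apply: differentiable_continuous; apply/derivable1_diffP.
by case: (dg t).
Qed.

(** [G] lists a function with all its derivatives. A partial derivative of [G n \o f] brings in
    [G n.+1 \o f], hence the induction on [k] for all [n] simultaneously. *)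
Lemma Ck_comp (G : nat -> R -> R) k f :
  (forall n (t : R), is_derive t 1 (G n) (G n.+1 t)) ->
  Ck k f -> forall n, Ck k (fun x => G n (f x)).
Proof.
move=> dG; have cG n : continuous (G n) := is_derive_cont1 (dG n).
elim: k f => [|k ih] f Cf n.
  by move=> x; apply: (@continuous_comp _ _ _ f (G n)); [exact: Cf|exact: cG].
have [cf df] := Cf; split.
  by move=> x; apply: (@continuous_comp _ _ _ f (G n)); [exact: cf|exact: cG].
move=> i; have [dfi cfi] := df i.
have H x := is_derive_comp1 (dG n (f x)) (pdiffP x dfi).
split; first by move=> x; case: (H x).
have -> : partial i (fun x => G n (f x)) = (fun x => G n.+1 (f x) * partial i f x).
  by apply/funext => x; apply: partialP.
by apply: CkM => //; apply: ih; exact: CkW.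
Qed.

Lemma Cinfty_flat P f : Cinfty f -> Cinfty (fun x => flat P (f x)).
Proof.
move=> Cf k; apply: (@Ck_comp (fun n => flat (iter n (@flat_next R) P)) k f _ (Cf k) 0%N).
by move=> n t; exact: is_derive_flat_iter.
Qed.

Lemma partial_flat P f i : pdiff i f ->
  partial i (fun x => flat P (f x)) =
  (fun x => flat (flat_next P) (f x) * partial i f x).
Proof.
move=> df; apply/funext => x; apply: partialP.
by apply: is_derive_comp1; [exact: is_derive_flat|exact: pdiffP].
Qed.

Lemma Cinfty_cst (a : R) : Cinfty (fun _ : E => a).
Proof. by move=> k; exact: Ck_cst. Qed.

Lemma Cinfty_coord j : Cinfty (fun x : E => x ord0 j).
Proof. by move=> k; exact: Ck_coord. Qed.

Lemma CinftyD f g : Cinfty f -> Cinfty g -> Cinfty (fun x => f x + g x).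
Proof. by move=> ? ? k; apply: CkD. Qed.

Lemma CinftyM f g : Cinfty f -> Cinfty g -> Cinfty (fun x => f x * g x).
Proof. by move=> ? ? k; apply: CkM. Qed.

Lemma Cinfty_sum (I : Type) (s : seq I) (F : I -> E -> R) :
  (forall j, Cinfty (F j)) -> Cinfty (fun x => \sum_(j <- s) F j x).
Proof. by move=> FC k; apply: Ck_sum => j; exact: FC. Qed.

Section tests.
Variable Omega : set E.

Lemma test_sub phi psi : test_function Omega phi -> Cinfty psi ->
  [set x | psi x != 0] `<=` closure [set x | phi x != 0] ->
  test_function Omega psi.
Proof.
move=> [_ cphi sphi] Cpsi sub.
have sub' : closure [set x | psi x != 0] `<=` closure [set x | phi x != 0].
  by rewrite [X in _ `<=` X](iffLR (closure_id _))//; [exact: closure_subset|exact: closed_closure].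
split => //; last exact: subset_trans sphi.
by apply: subclosed_compact sub' => //; exact: closed_closure.
Qed.

Lemma testM phi psi : test_function Omega phi -> Cinfty psi ->
  test_function Omega (fun x => psi x * phi x).
Proof.
move=> tphi Cpsi; apply: (test_sub tphi).
  by apply: CinftyM => //; case: tphi.
by move=> x /= H; apply: subset_closure; move: H; apply: contraNN => /= /eqP ->; rewrite mulr0.
Qed.

(** A point off the support of [phi] has a neighbourhood on which [phi] is zero, so the derivative
    vanishes there too. *)
Lemma test_partial phi i : test_function Omega phi ->
  test_function Omega (partial i phi).
Proof.
move=> tphi; have [Cphi _ _] := tphi; apply: (test_sub tphi).
  by have [] := CinftyP Cphi i.
move=> x /= H; apply: contrapT => nx; move/eqP : H; apply.
have : \forall y \near x, phi y = (fun=> 0) y.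
  have : nbhs x (~` closure [set x | phi x != 0]).
    by apply: open_nbhs_nbhs; split => //; apply: closed_openC; exact: closed_closure.
  apply: filterS => y ny; apply/eqP; apply: contrapT => /negP Hy; apply: ny.
  exact: subset_closure.
by move=> /(near_eq_derive (e_ i)); rewrite /partial => ->; rewrite derive_cst.
Qed.

Lemma testD phi psi : test_function Omega phi -> test_function Omega psi ->
  test_function Omega (fun x => phi x + psi x).
Proof.
move=> [C1 c1 s1] [C2 c2 s2].
have sub : closure [set x | phi x + psi x != 0] `<=`
    closure [set x | phi x != 0] `|` closure [set x | psi x != 0].
  rewrite -closureU; apply: closure_subset => x /=.
  by have [->|] := eqVneq (phi x) 0; [rewrite add0r; right|left].
split; first exact: CinftyD.
  by apply: subclosed_compact sub; [exact: closed_closure|exact: compactU].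
by apply: subset_trans sub _; rewrite subUset.
Qed.

Lemma test0 : test_function Omega (fun=> 0).
Proof.
have E0 : [set x : E | (0 : R) != 0] = set0.
  by apply/seteqP; split => x //=; rewrite eqxx.
split; [exact: Cinfty_cst| |]; rewrite E0 closure0; first exact: compact0.
by [].
Qed.

Lemma test_sum (I : Type) (s : seq I) (F : I -> E -> R) :
  (forall j, List.In j s -> test_function Omega (F j)) ->
  test_function Omega (fun x => \sum_(j <- s) F j x).
Proof.
elim: s => [|j s ih] H.
  by under eq_fun do rewrite big_nil; exact: test0.
under eq_fun do rewrite big_cons; apply: testD; first by apply: H; left.
by apply: ih => k ks; apply: H; right.
Qed.

Lemma test_flat P phi : test_function Omega phi ->
  test_function Omega (fun x => flat P (phi x)).
Proof.
move=> tphi; apply: (test_sub tphi); first by apply: Cinfty_flat; case: tphi.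
move=> x /= H; apply: subset_closure; move: H; apply: contraNN => /= /eqP ->.
by rewrite flat_le0.
Qed.

End tests.

(** Kept squared so that it is a polynomial, hence smooth also at [x]. *)
Definition sqdist (x y : E) : R := \sum_i (y ord0 i - x ord0 i) ^+ 2.

Lemma sqdist_ge0 x y : 0 <= sqdist x y.
Proof. by apply: sumr_ge0 => i _; exact: sqr_ge0. Qed.

Lemma eucl_norm_ge0 (x : E) : 0 <= eucl_norm x.
Proof. exact: sqrtr_ge0. Qed.

Lemma eucl_norm_sqr (x y : E) : eucl_norm (y - x) ^+ 2 = sqdist x y.
Proof.
rewrite /eucl_norm; under eq_bigr do rewrite !mxE.
by rewrite sqr_sqrtr// sqdist_ge0.
Qed.

Lemma eucl_ballE x r : 0 < r -> eucl_ball x r = [set y | sqdist x y < r ^+ 2].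
Proof.
move=> r0; apply/seteqP; split => y /=; rewrite /eucl_ball /= -eucl_norm_sqr;
  by rewrite ltr_sqr ?nnegrE ?eucl_norm_ge0// ltW.
Qed.

Lemma Cinfty_sqdist x : Cinfty (sqdist x).
Proof.
apply: Cinfty_sum => i; apply: CinftyM; apply: CinftyD;
  by [exact: Cinfty_coord|exact: Cinfty_cst].
Qed.

Lemma partial_sqdist x i : partial i (sqdist x) = (fun y => 2 * (y ord0 i - x ord0 i)).
Proof.
apply/funext => y; apply: partialP.
have H j : is_derive y (e_ i) (fun y => (y ord0 j - x ord0 j) ^+ 2)
    (2 * (y ord0 j - x ord0 j) * (i == j)%:R).
  have p1 : pdiff i (fun y : E => y ord0 j - x ord0 j).
    by apply: pdiffD => z; [case: (is_derive_coord i j z)|exact: derivable_cst].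
  have p2 : partial i (fun y : E => y ord0 j - x ord0 j) = (fun=> (i == j)%:R).
    rewrite partialD ?partial_coord ?partial_cst => [| z | z].
    - by under eq_fun do rewrite addr0.
    - by case: (is_derive_coord i j z).
    - exact: derivable_cst.
  have := pdiffP y (pdiffM p1 p1); rewrite partialM// p2 => H.
  by apply: is_derive_eq H _; ring.
have := is_derive_sum (h := fun j (y : E) => (y ord0 j - x ord0 j) ^+ 2) H.
rewrite fct_sumE => H'; apply: is_derive_eq H' _.
by rewrite (bigD1 i)//= eqxx mulr1 big1 ?addr0// => j /negbTE; rewrite eq_sym => ->; rewrite mulr0.
Qed.

Lemma sqdist_ball x y r : 0 < r -> sqdist x y < r ^+ 2 -> ball x r y.
Proof.
move=> r0 H; split => // i j; rewrite (ord1 i) /ball /= distrC.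
rewrite -ltr_sqr ?nnegrE//; last exact: ltW.
rewrite real_normK ?num_real//.
apply: le_lt_trans H; rewrite /sqdist (bigD1 j)//= lerDl.
by apply: sumr_ge0 => k _; exact: sqr_ge0.
Qed.

Lemma sqdist_le_compact x r : compact [set y | sqdist x y <= r].
Proof.
apply: bounded_closed_compact; last first.
  rewrite (_ : [set y | _] = sqdist x @^-1` [set t | t <= r])//.
  apply: preimage_closed; first by move=> y _; exact: (Cinfty_cont (Cinfty_sqdist x)).
  exact: closed_le.
exists (`|x| + (`|r| + 1)); split; first by rewrite num_real.
move=> M HM y /= yr; apply: ltW; apply: le_lt_trans HM.
rewrite -[y](subrK x) addrC (le_trans (ler_normD _ _))// lerD2l.
have : ball x (`|r| + 1) y.
  apply: sqdist_ball; first by rewrite ltr_wpDl.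
  apply: (le_lt_trans yr); apply: le_lt_trans (ler_norm _) _.
  rewrite expr2; have := normr_ge0 r; nra.
by rewrite -ball_normE /= distrC => /ltW.
Qed.

Lemma test_sqdist Omega x r g : Cinfty g ->
  (forall y, r <= sqdist x y -> g y = 0) ->
  [set y | sqdist x y <= r] `<=` Omega ->
  test_function Omega g.
Proof.
move=> Cg g0 sub.
have cl : closure [set y | g y != 0] `<=` [set y | sqdist x y <= r].
  rewrite [X in _ `<=` X](iffLR (closure_id _)).
    apply: closure_subset => y /=; apply: contraNT; rewrite -ltNge => /ltW /g0 ->.
    by rewrite eqxx.
  apply: compact_closed; [exact: norm_hausdorff|exact: sqdist_le_compact].
split => //; last exact: subset_trans sub.
by apply: subclosed_compact cl; [exact: closed_closure|exact: sqdist_le_compact].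
Qed.

End smooth.

(** * Lebesgue measure on R^d: finiteness on bounded sets and vanishing integrals of derivatives *)

Section lebesgue_rV_theory.
Context (R : realType).

Lemma cons_rV_rshift d (t : R) (v : 'rV[R]_d) (j : 'I_d) :
  cons_rV (t, v) ord0 (lift ord0 j) = v ord0 j.
Proof.
have -> : lift ord0 j = rshift 1 j by apply/val_inj.
exact: (@row_mxEr _ 1 1 d (const_mx t) v ord0 j).
Qed.

Lemma cons_rV0 d (t : R) (v : 'rV[R]_d) : cons_rV (t, v) ord0 ord0 = t.
Proof.
have -> : ord0 = lshift d (ord0 : 'I_1) :> 'I_d.+1 by apply/val_inj.
exact: etrans (@row_mxEl _ 1 1 d (const_mx t) v ord0 ord0) (mxE _ _ _ _).
Qed.

Lemma cons_rV_shift d (t h : R) (v : 'rV[R]_d) (j : 'I_d) :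
  cons_rV (t, h *: delta_mx ord0 j + v) =
  h *: delta_mx ord0 (lift ord0 j) + cons_rV (t, v).
Proof.
apply/rowP => k; rewrite [in RHS]mxE [X in _ = X + _]mxE [X in _ = _ * X + _]mxE eqxx /=.
have [k' ->|->] := unliftP ord0 k; last first.
  by rewrite !cons_rV0 mulr0 add0r.
by rewrite !cons_rV_rshift !mxE eqxx /= (inj_eq lift_inj).
Qed.

Lemma cons_rV_shift0 d (t h : R) (v : 'rV[R]_d) :
  cons_rV (h + t, v) = h *: delta_mx ord0 ord0 + cons_rV (t, v).
Proof.
apply/rowP => k; rewrite [in RHS]mxE [X in _ = X + _]mxE [X in _ = _ * X + _]mxE eqxx /=.
have [k' ->|->] := unliftP ord0 k; last first.
  by rewrite !cons_rV0 eqxx mulr1.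
by rewrite !cons_rV_rshift mulr0 add0r.
Qed.

(** Stated by coordinates so that [cons_rV] splits it into an interval times a box of one dimension
    less. *)
Definition box d (M : R) : set 'rV[R]_d := [set x | forall j, `|x ord0 j| <= M].

Lemma closed_box d M : closed (@box d M).
Proof.
have -> : @box d M = \bigcap_(j in [set: 'I_d]) ((fun x : 'rV[R]_d => `|x ord0 j|) @^-1` [set t | t <= M]).
  by apply/seteqP; split => [x Mx j _|x Mx j]; [exact: Mx|exact: Mx j I].
apply: closed_bigI => j _; apply: preimage_closed; last exact: closed_le.
move=> x _; apply: (@continuous_comp _ _ _ (fun x : 'rV[R]_d => x ord0 j) (@Num.norm _ R)).
  exact: coord_continuous.
exact: norm_continuous.
Qed.

Lemma closed_measurable_rV d (A : set 'rV[R]_d) : closed A -> measurable A.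
Proof.
move=> cA; rewrite -(setCK A); apply: measurableC; apply: open_measurable_rV.
exact: closed_openC.
Qed.

Lemma continuous_measurable_rV d (f : 'rV[R]_d -> R) : continuous f ->
  measurable_fun setT f.
Proof.
move=> cf; apply: (measurability _ (RGenOpens.measurableE R)) => _ [_ [a [b ->]] <-].
rewrite setTI; apply: open_measurable_rV; apply: open_comp => [x _|]; first exact: cf.
exact: interval_open.
Qed.

Lemma lebesgue_rV_box d M : (lebesgue_rV R d (box M) < +oo)%E.
Proof.
elim: d => [|d ih] /=; first by rewrite diracE ltry.
rewrite /cons_measure /pushforward.
have -> : @cons_rV R d @^-1` @box d.+1 M = `[- M, M]%classic `*` @box d M.
  apply/seteqP; split => [[t v] /= H|[t v] /= [H1 H2] j].
    split => [|j].
      by have := H ord0; rewrite cons_rV0 in_itv/= -ler_norml.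
    by have := H (lift ord0 j); rewrite cons_rV_rshift.
  have [k ->|->] := unliftP ord0 j; first by rewrite cons_rV_rshift.
  by rewrite cons_rV0 ler_norml; move: H1; rewrite in_itv.
rewrite product_measure1E//=; last first.
  by apply: closed_measurable_rV; exact: closed_box.
rewrite lebesgue_measure_itv/=; case: ifPn => [MM|_]; last by rewrite mul0e ltry.
by rewrite -EFinB lte_mul_pinfty// lee_fin subr_ge0 ltW// -lte_fin.
Qed.

Lemma bounded_box d (A : set 'rV[R]_d) : bounded_set A -> exists M, A `<=` box M.
Proof.
move=> [M [Mr HM]]; exists (`|M| + 1 + 1) => x Ax j.
have := HM (`|M| + 1) (ltac:(by rewrite (le_lt_trans (ler_norm _))// ltrDl)) x Ax.
move=> xM; have : ball (0 : 'rV[R]_d) (`|M| + 1 + 1) x.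
  by rewrite -ball_normE /= sub0r normrN (le_lt_trans xM)// ltrDl.
by move=> [_ /(_ ord0 j)]; rewrite /ball/= mxE sub0r normrN => /ltW.
Qed.

Lemma lebesgue_rV_bounded d (A : set 'rV[R]_d) : bounded_set A -> measurable A ->
  (lebesgue_rV R d A < +oo)%E.
Proof.
move=> /bounded_box[M AM] mA; apply: le_lt_trans (lebesgue_rV_box d M).
by apply: le_measure => //; rewrite inE//; exact: closed_measurable_rV (@closed_box d M).
Qed.

Lemma compact_bounded_fun d (f : 'rV[R]_d -> R) (K : set 'rV[R]_d) :
  compact K -> continuous f -> exists2 M, 0 <= M & forall x, K x -> `|f x| <= M.
Proof.
move=> cK cf; have [[x0 Kx0]|K0] := pselect (K !=set0); last first.
  by exists 0 => // x Kx; case: K0; exists x.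
have [c _ Hc] : exists2 c, c \in K & forall t, t \in K -> `|f t| <= `|f c|.
  apply: (@EVT_max_rV R d (fun x => `|f x|)) => //; first by exists x0.
  apply: continuous_subspaceT => x; apply: (@continuous_comp _ _ _ f (@Num.norm _ R)).
    exact: cf.
  exact: norm_continuous.
by exists `|f c| => // x Kx; apply: Hc; rewrite inE.
Qed.

Lemma box_compact d M : compact (@box d M).
Proof.
apply: bounded_closed_compact; last exact: closed_box.
exists `|M|; split; first by rewrite num_real.
move=> N MN x /= Mx.
have : ball (0 : 'rV[R]_d) N x.
  split; first exact: le_lt_trans MN.
  by move=> i j; rewrite (ord1 i) /ball/= mxE sub0r normrN (le_lt_trans (Mx j))// (le_lt_trans (ler_norm _)).
by rewrite -ball_normE /= sub0r normrN => /ltW.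
Qed.

Lemma itg_bounded_support d (f : 'rV[R]_d -> R) M : continuous f ->
  (forall x, ~ box M x -> f x = 0) ->
  (lebesgue_rV R d).-integrable setT (EFin \o f).
Proof.
move=> cf f0; have [C C0 fC] := compact_bounded_fun (@box_compact d M) cf.
have mb : measurable (@box d M) by exact: closed_measurable_rV (@closed_box d M).
apply/integrableP; split; first by apply/measurable_EFinP; exact: continuous_measurable_rV.
apply: (@le_lt_trans _ _ (\int[lebesgue_rV R d]_x (C * \1_(box M) x)%:E)%E).
  apply: ge0_le_integral => //=.
  - apply/measurable_EFinP/measurableT_comp => //; exact: continuous_measurable_rV.
  - exact/measurable_EFinP/measurable_funM.
  - move=> x _; rewrite lee_fin indicE; case: (boolP (x \in box M)) => [/set_mem /fC|/negP].
      by rewrite mulr1.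
    by rewrite inE => /f0 ->; rewrite normr0 mulr0.
under eq_integral do rewrite EFinM.
rewrite ge0_integralZl//=; last first.
  by apply/measurable_EFinP; exact: measurable_indic.
by rewrite integral_indic// setIT lte_mul_pinfty ?lee_fin// lebesgue_rV_box.
Qed.

(** Fundamental theorem on [[-N, N]] with [N > M]: both end values are zero, and [F'] vanishes
    outside because [F] is locally zero there. *)
Lemma integral_deriv_support (F F' : R -> R) M :
  (forall t : R, is_derive t 1 F (F' t)) -> continuous F' ->
  (forall t : R, M < `|t| -> F t = 0) ->
  (\int[lebesgue_measure]_t (F' t)%:E = 0)%E.
Proof.
move=> dF cF' F0.
pose N : R := `|M| + 1.
have N0 : - N < N by rewrite gtrN// ltr_wpDl.
have cF : continuous F := is_derive_cont1 dF.
have F'0 t : M < `|t| -> F' t = 0.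
  move=> Mt; have [_ <-] := dF t.
  rewrite (@near_eq_derive _ _ _ F (cst 0) t 1) ?derive_cst//.
  have : nbhs t ((@Num.norm _ R) @^-1` [set y : R | M < y]).
    apply: open_nbhs_nbhs; split => //; apply: open_comp; last exact: open_gt.
    by move=> ? _; exact: norm_continuous.
  by apply: filterS => y /F0.
have -> : (\int[lebesgue_measure]_t (F' t)%:E = \int[lebesgue_measure]_(t in `[(- N)%R, N]) (F' t)%:E)%E.
  rewrite [RHS]integral_mkcond; apply: eq_integral => t _.
  rewrite patchE; case: ifPn => //; rewrite notin_setE /= in_itv/= -ler_norml => /negP.
  rewrite -ltNge => Nt; rewrite F'0//; apply: le_lt_trans Nt.
  by rewrite (le_trans (ler_norm _))// lerDl.
rewrite (@continuous_FTC2 _ F' F)//.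
- have MN : M < N by rewrite (le_lt_trans (ler_norm _))// ltrDl.
  have Npos : 0 <= N by rewrite addr_ge0.
  by rewrite !F0 ?normrN ?ger0_norm// subee.
- exact: continuous_subspaceT.
- split; first by move=> t _; case: (dF t).
  + exact/cvg_at_right_filter/cF.
  + exact/cvg_at_left_filter/cF.
- by move=> t _; rewrite derive1E; case: (dF t).
Qed.

(** Fubini and induction on the dimension: the integral in the direction of differentiation is taken
    first, or hidden in the induction hypothesis. *)
Lemma integral_partial d (f : 'rV[R]_d -> R) i M : Ck 1 f ->
  (forall x, ~ box M x -> f x = 0) ->
  (\int[lebesgue_rV R d]_x (partial i f x)%:E = 0)%E.
Proof.
elim: d f i => [|d ih] f i; first by case: i.
move=> [cf df] f0; have [dfi cfi] := df i.
have p0 x : ~ box M x -> partial i f x = 0.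
  move=> Mx; rewrite /partial (@near_eq_derive _ _ _ f (cst 0) x) ?derive_cst//.
  have : nbhs x (~` box M).
    by apply: open_nbhs_nbhs; split => //; apply: closed_openC; exact: closed_box.
  by apply: filterS => y /f0.
have itg := itg_bounded_support cfi p0.
have mp : measurable_fun setT (EFin \o partial i f).
  by apply/measurable_EFinP; exact: continuous_measurable_rV.
have itg' : (lebesgue_measure \x lebesgue_rV R d)%E.-integrable setT
    ((EFin \o partial i f) \o @cons_rV R d).
  move/integrableP : (itg) => [_ fin]; apply/integrableP; split.
    by apply: measurableT_comp => //; exact: measurable_cons_rV.
  apply: le_lt_trans fin; rewrite le_eqVlt; apply/orP; left; apply/eqP.
  have := @ge0_integral_pushforward _ _ (measurableTypeR R * 'rV[R]_d)%type _ R _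
    (@measurable_cons_rV R d) (lebesgue_measure \x lebesgue_rV R d)%E setT (abse \o (EFin \o partial i f))
    measurableT (ltac:(exact: measurableT_comp)) (fun _ _ => abse_ge0 _).
  by rewrite preimage_setT => ->.
have -> : (\int[lebesgue_rV R d.+1]_x (partial i f x)%:E =
   \int[lebesgue_measure \x lebesgue_rV R d]_z (partial i f (cons_rV z))%:E)%E.
  have H := @integral_pushforward _ _ (measurableTypeR R * 'rV[R]_d)%type _ R _
    (@measurable_cons_rV R d) (lebesgue_measure \x lebesgue_rV R d)%E setT _ mp.
  by rewrite preimage_setT in H; exact: H itg' measurableT.
(* For a direction other than the first, the inner integral runs over the remaining coordinates,
   where the induction hypothesis applies to each slice [g]. *)
have [{p0 itg mp} j ij|i0] := unliftP ord0 i.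
  rewrite -(integral12_prod_meas1 itg') /fubini_F /=.
  rewrite integral0_eq// => t _.
  pose g v := f (cons_rV (t, v)).
  have dg v : is_derive v (delta_mx ord0 j) g (partial i f (cons_rV (t, v))).
    apply/is_derive_line; rewrite /g.
    under eq_fun do rewrite cons_rV_shift.
    by rewrite -ij; apply/is_derive_line; exact: pdiffP.
  have cc : continuous (fun v : 'rV[R]_d => cons_rV (t, v)).
    move=> v A /nbhs_ballP[e /= e0 eA]; apply/nbhs_ballP; exists e => // w vw.
    by apply/eA/cons_rV_ball; split => //; exact: ballxx.
  rewrite -[RHS](ih g j).
  - by apply: eq_integral => v _; congr EFin; symmetry; apply: partialP.
  - split.
      by move=> v; apply: (@continuous_comp _ _ _ (fun v => cons_rV (t, v)) f); [exact: cc|exact: cf].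
    move=> k.
    have dg' v : is_derive v (delta_mx ord0 k) g (partial (lift ord0 k) f (cons_rV (t, v))).
      apply/is_derive_line; rewrite /g.
      under eq_fun do rewrite cons_rV_shift.
      by apply/is_derive_line; apply: pdiffP; case: (df (lift ord0 k)).
    split; first by move=> v; case: (dg' v).
    have -> : partial k g = (fun v => partial (lift ord0 k) f (cons_rV (t, v))).
      by apply/funext => v; apply: partialP.
    move=> v; apply: (@continuous_comp _ _ _ (fun v => cons_rV (t, v)) (partial (lift ord0 k) f)); first exact: cc.
    by case: (df (lift ord0 k)) => _; exact.
  - move=> v Mv; apply: f0 => H; apply: Mv => k.
    by have := H (lift ord0 k); rewrite cons_rV_rshift.
(* For the first direction the order is exchanged and the inner integral is one-dimensional. *)
rewrite -(integral21_prod_meas1 itg') /fubini_G /=.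
rewrite integral0_eq// => v _.
have cc : continuous (fun t : R => cons_rV (t, v)).
  move=> t A /nbhs_ballP[e /= e0 eA]; apply/nbhs_ballP; exists e => // w vw.
  by apply/eA/cons_rV_ball; split => //; exact: ballxx.
apply: (@integral_deriv_support (fun t => f (cons_rV (t, v))) _ M).
- move=> t.
  have -> : (fun t => f (cons_rV (t, v))) = (fun t' => f ((t' - t) *: delta_mx ord0 ord0 + cons_rV (t, v))).
    by apply/funext => t'; rewrite -cons_rV_shift0 subrK.
  have /is_derive_line := pdiffP (cons_rV (t, v)) dfi; rewrite i0 => H.
  have H' := is_derive1_comp (f := fun h : R => f (h *: delta_mx ord0 ord0 + cons_rV (t, v))) (g := fun t' : R => t' - t) (x := t) (b := 1).
  rewrite -[X in is_derive _ _ _ X]mulr1; apply: H'; first by rewrite subrr.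
  have := is_deriveD (is_derive_id t 1) (is_derive_cst (- t) t 1).
  by rewrite addr0.
- by move=> t; apply: (@continuous_comp _ _ _ (fun t => cons_rV (t, v)) (partial i f)); [exact: cc|exact: cfi].
- move=> t Mt; apply: f0 => H; have := H ord0; rewrite cons_rV0.
  by rewrite leNgt Mt.
Qed.

End lebesgue_rV_theory.

(** * Integration over Omega and density of the test functions in L^2(Omega) *)

Section domain.
Context (R : realType) (d : nat) (Omega : set 'rV[R]_d) (oO : open Omega).
Hypothesis bO : bounded_set Omega.
Local Notation E := 'rV[R]_d.
Local Notation mu := (leb_on oO).
Local Notation L2f := (Lfun mu 2%:E).
Local Notation test := (test_function Omega).
Local Notation itg f := (mu.-integrable setT (EFin \o f)).
Implicit Types (f g : E -> R) (A : set E).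

Lemma leb_fin : (mu setT < +oo)%E.
Proof.
rewrite /= /mrestr setTI; apply: lebesgue_rV_bounded => //.
exact: open_measurable_rV.
Qed.

Lemma leb_setC : mu (~` Omega) = 0%E.
Proof. by rewrite /= /mrestr setICl measure0. Qed.

Lemma ae_Omega : \forall x \ae mu, Omega x.
Proof.
exists (~` Omega); split => //; last exact: leb_setC.
by apply: measurableC; exact: open_measurable_rV.
Qed.

Lemma integral_leb_on (f : E -> \bar R) : (forall x, ~ Omega x -> f x = 0%E) ->
  (\int[mu]_x f x = \int[lebesgue_rV R d]_x f x)%E.
Proof.
move=> f0.
have H (m : {measure set E -> \bar R}) : (\int[m]_x f x = \int[m]_(x in Omega) f x)%E.
  rewrite [RHS]integral_mkcond; apply: eq_integral => x _; rewrite patchE.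
  by case: ifPn => //; rewrite notin_setE => /f0.
rewrite !H; apply: eq_measure_integral => A mA AO.
by rewrite /= /mrestr (setIidl AO).
Qed.

Lemma test_out phi x : test phi -> ~ Omega x -> phi x = 0.
Proof.
move=> [_ _ sub] Ox; apply/eqP; apply: contrapT => /negP H; apply/Ox/sub.
exact: subset_closure.
Qed.

Lemma test_smooth phi : test phi -> Cinfty phi. Proof. by case. Qed.

Lemma test_pdiff i phi : test phi -> pdiff i phi.
Proof. by move=> /test_smooth /CinftyP /(_ i)[]. Qed.

Lemma test_bounded phi : test phi -> exists2 M, 0 <= M & forall x, `|phi x| <= M.
Proof.
move=> [C c s]; have [M M0 HM] := compact_bounded_fun c (Cinfty_cont C).
exists M => // x; have [->|x0] := eqVneq (phi x) 0; first by rewrite normr0.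
by apply: HM; exact: subset_closure.
Qed.

Lemma Cinfty_meas f : Cinfty f -> measurable_fun setT f.
Proof. by move=> /Cinfty_cont; exact: continuous_measurable_rV. Qed.

Lemma test_abdd phi : test phi -> abdd mu phi.
Proof.
move=> tphi; split; first by apply: Cinfty_meas; exact: test_smooth.
by have [M _ HM] := test_bounded tphi; exists M; exact: nearW.
Qed.

Lemma test_L2 phi : test phi -> phi \in L2f.
Proof. by move=> /test_abdd; apply: abddL2; exact: leb_fin. Qed.

Lemma Cinfty_abdd f : Cinfty f -> abdd mu f.
Proof.
move=> Cf; split; first exact: Cinfty_meas.
have [M HM] := bounded_box bO.
have [C _ fC] := compact_bounded_fun (@box_compact R d M) (Cinfty_cont Cf).
by exists C; apply: filterS ae_Omega => x /HM /fC.
Qed.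

Lemma abdd_itg f : abdd mu f -> itg f.
Proof. by move=> af; apply: L2_itg; [exact: leb_fin|apply: abddL2 => //; exact: leb_fin]. Qed.

Lemma Rint_partial_test phi i : test phi -> \int[mu]_x partial i phi x = 0.
Proof.
move=> tphi; rewrite /Rintegral integral_leb_on; last first.
  by move=> x Ox; rewrite (test_out (test_partial i tphi) Ox).
have [M HM] := bounded_box bO.
rewrite (@integral_partial _ _ _ _ M)//; first exact: (test_smooth tphi 1%N).
by move=> x Mx; apply: test_out tphi _ => /HM.
Qed.

(** The product [psi * phi] is a test function, so its partial derivative integrates to zero. *)
Lemma test_ibp phi psi i : test phi -> Cinfty psi ->
  \int[mu]_x (psi x * partial i phi x) = - \int[mu]_x (partial i psi x * phi x).
Proof.
move=> tphi Cpsi; have := Rint_partial_test i (testM tphi Cpsi).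
have [pd Cpd] := CinftyP Cpsi i.
rewrite (partialM pd (test_pdiff tphi)) RintD.
- move/eqP; rewrite addr_eq0 => /eqP ->; congr (- _).
  by apply: eq_Rintegral => x _; rewrite mulrC.
- by apply/abdd_itg/abddM; [exact: Cinfty_abdd|exact/test_abdd/test_partial].
- by apply/abdd_itg/abddM; [exact: test_abdd|exact: Cinfty_abdd].
Qed.

Lemma n2_dominated (f : nat -> E -> R) g h : (forall n, f n \in L2f) -> g \in L2f ->
  h \in L2f -> (forall n x, `|f n x - g x| <= `|h x|) ->
  (forall x, Omega x -> f n x @[n --> \oo] --> g x) ->
  forall e, 0 < e -> exists n, n2 mu (fun x => g x - f n x) < e.
Proof.
move=> fL gL hL fgh fg e e0.
have dL n : (fun x => g x - f n x) \in L2f by exact: L2B.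
have mO : measurable Omega by exact: open_measurable_rV.
pose F n x := ((g x - f n x) * (g x - f n x))%:E.
(* Pointwise convergence is assumed on Omega only, so the dominated convergence theorem is applied
   there. *)
have intO n : (\int[mu]_x F n x = \int[mu]_(x in Omega) F n x)%E.
  rewrite [RHS]integral_mkcond; apply: ae_eq_integral => //.
  - by apply/measurable_EFinP/measurable_funM; exact: L2_meas.
  - apply/(measurable_restrictT _ mO)/measurable_funTS.
    by apply/measurable_EFinP/measurable_funM; exact: L2_meas.
  - by apply: filterS ae_Omega => x Ox _; rewrite patchE ifT// inE.
have cv : (\int[mu]_(x in Omega) F n x)%E @[n --> \oo] --> (\int[mu]_(x in Omega) cst 0 x)%E.
  apply: (@dominated_cvg _ _ _ mu Omega mO F (cst 0%E) (fun x => (h x * h x)%:E)) => //.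
  - move=> n; apply: measurable_funTS.
    by apply/measurable_EFinP/measurable_funM; exact: L2_meas.
  - move=> x Ox; rewrite /F; apply: cvg_EFin; first exact: nearW.
    have : (g x - f n x) @[n --> \oo] --> g x - g x by apply: cvgB; [exact: cvg_cst|exact: fg].
    rewrite subrr => H; rewrite -[X in _ --> X](mulr0 0).
    by apply: cvgM.
  - by apply: integrableS (L2_ipitg hL hL).
  - move=> n x _; rewrite lee_fin normrM -[leRHS]ger0_norm -?expr2 ?sqr_ge0//.
    by rewrite normrX lerXn2r ?nnegrE// distrC.
rewrite integral0 in cv.
have cv' : fine (\int[mu]_(x in Omega) F n x)%E @[n --> \oo] --> (0 : R).
  exact: (fine_cvg cv).
have e20 : 0 < e ^+ 2 by rewrite exprn_gt0.
move/cvgrPdist_lt : cv' => /(_ _ e20)[n _ /(_ n (leqnn n))] /=.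
rewrite sub0r normrN -intO => H; exists n.
rewrite -ltr_sqr ?nnegrE ?n2_ge0 ?(ltW e0)// n2_sqr//.
by apply: le_lt_trans H; exact: ler_norm.
Qed.

(** A countable family of Euclidean balls, with squared radii to match [sqdist]. It serves both for
    the essential support and for filling open sets with bumps. *)
Definition rat_center (k : 'rV[rat]_d * nat) : E := map_mx ratr k.1.
Definition rat_radius (k : 'rV[rat]_d * nat) : R := k.2.+1%:R^-1 ^+ 2.

Lemma rat_ball_nbhs (W : set E) x : open W -> W x ->
  exists k, sqdist (rat_center k) x < rat_radius k /\
    [set y | sqdist (rat_center k) y <= rat_radius k] `<=` W.
Proof.
move=> oW Wx.
have /nbhs_ballP[e /= e0 eW] : nbhs x W by exact: open_nbhs_nbhs.
pose m := Num.bound (2 / e).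
pose r : R := m.+1%:R^-1.
have r0 : 0 < r by rewrite invr_gt0.
have re : 2 * r < e.
  rewrite /r -[_ * _]/(2 / _) ltr_pdivrMr// mulrC -ltr_pdivrMr//.
  rewrite (lt_le_trans (archi_boundP _))//; first by rewrite divr_ge0// ltW.
  by rewrite ler_nat.
(* Coordinate errors below [r / (d + 1)] have a sum of squares at most [d (r / (d + 1))^2 < r^2], in
   dimension 0 as well. *)
have dl0 : 0 < r / d.+1%:R by rewrite divr_gt0.
have approx (y : R) : exists q : rat, `|y - ratr q| < r / d.+1%:R.
  have [q] : exists q, ratr q \in `]y - r / d.+1%:R, y + r / d.+1%:R[.
    by apply: rat_in_itvoo; rewrite ltrD2l gtrN.
  by rewrite in_itv/= => /andP[h1 h2]; exists q; rewrite distrC ltr_distl h1 h2.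
have /choice[q qx] i := approx (x ord0 i).
exists (\row_i q i, m).
have xr : sqdist (rat_center (\row_i q i, m)) x < r ^+ 2.
  have : sqdist (rat_center (\row_i q i, m)) x <= \sum_(i < d) (r / d.+1%:R) ^+ 2.
    apply: ler_sum => i _; rewrite /rat_center !mxE.
    rewrite -(real_normK (num_real (_ - _))) lerXn2r ?nnegrE ?(ltW dl0)//.
    exact: ltW (qx i).
  rewrite sumr_const card_ord => /le_lt_trans; apply.
  rewrite (_ : _ *+ d = r ^+ 2 * (d%:R / d.+1%:R ^+ 2)); last first.
    by rewrite expr_div_n -mulr_natl; ring.
  rewrite gtr_pMr ?exprn_gt0// ltr_pdivrMr ?exprn_gt0// mul1r -natrX ltr_nat.
  by rewrite (@leq_trans d.+1)// expnS expn1 leq_pmull.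
split => // y /= yr; apply: eW.
apply: (@le_ball _ _ _ (2 * r)); first exact: ltW.
rewrite mulrDl !mul1r.
split; first by rewrite addr_gt0.
move=> i j; rewrite (ord1 i) /ball/=.
have cx : `|x ord0 j - rat_center (\row_i q i, m) ord0 j| < r.
  have [_ /(_ ord0 j)] := sqdist_ball r0 xr.
  by rewrite /ball/= distrC.
have cy : `|y ord0 j - rat_center (\row_i q i, m) ord0 j| <= r.
  rewrite -ler_sqr ?nnegrE// ?(ltW r0)// real_normK ?num_real//.
  apply: le_trans yr; rewrite /sqdist (bigD1 j)//= lerDl.
  by apply: sumr_ge0 => k _; exact: sqr_ge0.
have -> : x ord0 j - y ord0 j = (x ord0 j - rat_center (\row_i q i, m) ord0 j) -
   (y ord0 j - rat_center (\row_i q i, m) ord0 j) by ring.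
by rewrite (le_lt_trans (ler_normB _ _))// ltr_leD.
Qed.

(* By countability of the rational balls. *)
Lemma ess_supp_ae f : \forall x \ae mu, f x = 0 \/ ess_supp oO f x.
Proof.
pose null (k : 'rV[rat]_d * nat) :=
  \forall x \ae mu, sqdist (rat_center k) x < rat_radius k -> f x = 0.
pose N k := [set x | null k /\ sqdist (rat_center k) x < rat_radius k /\ f x <> 0].
have H : \forall x \ae mu, forall n : nat, forall k, pickle_inv n = Some k ->
    ~ N k x.
  apply: ae_foralln => n; case E1 : (pickle_inv n) => [k|]; last by exact: nearW.
  have [Hk|Hk] := pselect (null k).
    by apply: filterS Hk => x Hx _ [<-] [_ []]; move=> /Hx.
  by apply: nearW => x _ [<-] [].
apply: filterS2 H ae_Omega => x H Ox.
have [fx|fx] := pselect (f x = 0); [by left|right].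
split => // U oU Ux Uf.
have [k [kx kU]] := rat_ball_nbhs oU Ux.
apply: (H (pickle k) k); first by rewrite pickleK_inv.
split; last by split.
by apply: filterS Uf => y Uf /ltW /kU /Uf.
Qed.

Definition approximable f := forall e, 0 < e ->
  exists2 phi, test phi & n2 mu (fun x => f x - phi x) < e.

Lemma approximable_lim f : f \in L2f -> (forall e, 0 < e -> exists g, 
  [/\ g \in L2f, approximable g & n2 mu (fun x => f x - g x) < e]) ->
  approximable f.
Proof.
move=> fL H e e0; have e20 : 0 < e / 2 by rewrite divr_gt0.
have [g [gL ag fg]] := H _ e20; have [phi tphi gphi] := ag _ e20.
exists phi => //.
have -> : (fun x => f x - phi x) = (fun x => (f x - g x) + (g x - phi x)).
  by apply/funext => x; rewrite addrA subrK.
have pL := test_L2 tphi.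
rewrite (le_lt_trans (n2_D (L2B fL gL) (L2B gL pL)))//.
by rewrite (splitr e) ltrD.
Qed.

Lemma approximable_ae f g : f \in L2f -> g \in L2f ->
  (\forall x \ae mu, f x = g x) -> approximable f -> approximable g.
Proof.
move=> fL gL fg af e e0; have [phi tphi H] := af _ e0; exists phi => //.
have pL := test_L2 tphi.
rewrite (@n2_ae _ _ _ mu _ (fun x => f x - phi x)) ?L2B//.
by apply: filterS fg => x ->.
Qed.

Lemma approximableD f g : f \in L2f -> g \in L2f ->
  approximable f -> approximable g -> approximable (fun x => f x + g x).
Proof.
move=> fL gL af ag e e0; have e20 : 0 < e / 2 by rewrite divr_gt0.
have [phi tphi fphi] := af _ e20; have [psi tpsi gpsi] := ag _ e20.
exists (fun x => phi x + psi x); first exact: testD.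
have -> : (fun x => f x + g x - (phi x + psi x)) =
    (fun x => (f x - phi x) + (g x - psi x)).
  by apply/funext => x; ring.
rewrite (le_lt_trans (n2_D (L2B fL (test_L2 tphi)) (L2B gL (test_L2 tpsi))))//.
by rewrite (splitr e) ltrD.
Qed.

Lemma approximableZ a f : f \in L2f -> approximable f ->
  approximable (fun x => a * f x).
Proof.
move=> fL af e e0.
have [phi tphi fphi] := af _ (ltac:(by rewrite divr_gt0// ltr_wpDl) : 0 < e / (`|a| + 1)).
exists (fun x => a * phi x); first by apply: testM => //; exact: Cinfty_cst.
under [X in n2 _ X]eq_fun do rewrite -mulrBr.
rewrite n2_Z; last exact: L2B fL (test_L2 tphi).
move: fphi; rewrite ltr_pdivlMr ?ltr_wpDl//.
have := n2_ge0 mu (fun x => f x - phi x); lra.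
Qed.

Lemma approximable_sum (I : Type) (s : seq I) (F : I -> E -> R) :
  (forall i, F i \in L2f) -> (forall i, approximable (F i)) ->
  approximable (fun x => \sum_(i <- s) F i x).
Proof.
move=> FL aF; elim: s => [|i s ih].
  under eq_fun do rewrite big_nil.
  move=> e e0; exists (fun=> 0); first exact: test0.
  have L0 := L2_0 mu.
  under [X in n2 _ X]eq_fun do rewrite subr0.
  rewrite (_ : n2 _ _ = 0)//; apply/eqP; rewrite -sqrf_eq0 n2_sqr//; apply/eqP.
  rewrite /ip; under eq_Rintegral do rewrite mulr0.
  by rewrite Rintegral_cst// mul0r.
by under eq_fun do rewrite big_cons; apply: approximableD => //; exact: L2_sum.
Qed.

Lemma indic_L2 A : measurable A -> (\1_A : E -> R) \in L2f.
Proof.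
move=> mA; apply: abddL2; first exact: leb_fin.
split; first exact: measurable_indic.
by exists 1; apply: nearW => x; rewrite indicE; case: (_ \in _); rewrite ?normr1 ?normr0.
Qed.

(** [flat 1] sends 0 to 0 and tends to 1 at infinity. Applied to a growing sum of bumps on balls
    filling [W], it gives test functions with values in [[0, 1]] that converge pointwise to the
    indicator. *)
Lemma approximable_open U : open U -> approximable (\1_U : E -> R).
Proof.
move=> oU.
pose W := U `&` Omega.
have oW : open W by exact: openI.
pose good k := [set y | sqdist (rat_center k) y <= rat_radius k] `<=` W.
pose P : {poly R} := 1.
(* The bump on the [n]-th rational ball if the closed ball lies in [W]; the zero function
   otherwise. *)
pose b n : E -> R := if pickle_inv n is Some k then
  (if `[< good k >] then (fun y => flat P (rat_radius k - sqdist (rat_center k) y)) else fun=> 0)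
  else fun=> 0.
have tb n : test (b n).
  rewrite /b; case: pickle_inv => [k|]; last exact: test0.
  case: ifPn => [/asboolP gk|_]; last exact: test0.
  apply: (@test_sqdist R d Omega (rat_center k) (rat_radius k)).
  - apply: Cinfty_flat; have -> : (fun x => rat_radius k - sqdist (rat_center k) x) =
       (fun x => rat_radius k + (-1) * sqdist (rat_center k) x).
      by apply/funext => x; rewrite mulN1r.
    by apply: CinftyD; [exact: Cinfty_cst|apply: CinftyM; [exact: Cinfty_cst|exact: Cinfty_sqdist]].
  - by move=> y H; rewrite flat_le0// subr_le0.
  - by move=> y /gk [].
have b0 n y : 0 <= b n y.
  rewrite /b; case: pickle_inv => // k; case: ifP => // _.
  by rewrite /flat; case: ifP => // _; rewrite /P hornerC mul1r expR_ge0.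
(* The factor [n] drives the sum to infinity wherever a single bump is positive. *)
pose s n y := n%:R * \sum_(i < n) b i y.
have ts n : test (s n).
  apply: testM; last exact: Cinfty_cst.
  by apply: test_sum => j _; exact: tb.
pose f n y := flat P (s n y).
have tf n : test (f n) by exact: test_flat.
have f01 n y : 0 <= f n y <= 1.
  rewrite /f /flat; case: ifPn => [s0|]; last by rewrite lexx ler01.
  by rewrite /P hornerC mul1r expR_ge0/= -expR0 ler_expR oppr_le0 invr_ge0 ltW.
have mW : measurable W by exact: open_measurable_rV.
have mU : measurable U by exact: open_measurable_rV.
apply: (@approximable_ae (\1_W)); try exact: indic_L2.
  by apply: filterS ae_Omega => x Ox; rewrite !indicE in_setI (mem_set Ox) andbT.
move=> e e0.
have fcv x : Omega x -> f n x @[n --> \oo] --> (\1_W x : R).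
  move=> _; rewrite indicE; case: (boolP (x \in W)) => [/set_mem Wx|].
    have [k [kx kW]] := rat_ball_nbhs oW Wx.
    pose n0 := pickle k.
    have bx : 0 < b n0 x.
      rewrite /b /n0 pickleK_inv asboolT//.
      by rewrite /flat subr_gt0 kx /P hornerC mul1r expR_gt0.
    apply/cvgrPdist_le => z z0.
    near=> n.
    have n0n : (n0 < n)%N by near: n; exists n0.+1.
    have sn : n%:R * b n0 x <= s n x.
      rewrite /s ler_wpM2l// (bigD1 (Ordinal n0n))//= lerDl.
      by apply: sumr_ge0 => i _; exact: b0.
    have n_gt : (z * b n0 x)^-1 <= n%:R.
      near: n; exists (Num.bound (z * b n0 x)^-1) => // n /= Hn.
      rewrite ltW// (lt_le_trans (archi_boundP _))// ?ler_nat//.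
      by rewrite invr_ge0 mulr_ge0// ltW.
    have zs : z^-1 <= s n x.
      apply: le_trans sn; rewrite -ler_pdivrMr//; apply: le_trans n_gt.
      by rewrite invfM.
    have s0 : 0 < s n x by apply: lt_le_trans zs; rewrite invr_gt0.
    have /andP[_ f1] := f01 n x.
    rewrite ger0_norm ?subr_ge0//.
    rewrite /f /flat s0 /P hornerC mul1r.
    have H1 : 1 <= (s n x)^-1 + expR (- (s n x)^-1).
      by rewrite -lerBlDl; exact: expR_ge1Dx.
    rewrite lerBlDr (le_trans H1)// lerD2r.
    by rewrite -[z]invrK lef_pV2 ?posrE ?invr_gt0.
  rewrite notin_setE => Wx.
  rewrite (_ : (fun n => f n x) = fun=> 0); first exact: cvg_cst.
  apply/funext => n; rewrite /f flat_le0// /s big1 ?mulr0// => i _.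
  rewrite /b; case: pickle_inv => // k; case: ifPn => // /asboolP gk.
  by apply: flat_le0; rewrite subr_le0 leNgt; apply/negP => /ltW /gk.
have [n Hn] := @n2_dominated f (\1_W) (fun=> 1) (fun n => test_L2 (tf n)) (indic_L2 mW)
   (abddL2 leb_fin (abdd_cst _ 1)) (ltac:(
    move=> n x; rewrite normr1 ler_norml; have /andP[] := f01 n x;
    rewrite indicE; case: (_ \in _) => /=; lra)) fcv e e0.
by exists (f n).
Unshelve. all: by end_near.
Qed.

(** Dynkin's theorem: open sets are stable under intersection and generate the Borel sets, so
    complements and countable disjoint unions suffice. *)
Lemma approximable_indic A : measurable A -> approximable (\1_A : E -> R).
Proof.
have aT : approximable (\1_setT : E -> R) by apply: approximable_open; exact: openT.
apply: (@dynkin_induction _ E [set U | open U] (fun A => approximable (\1_A : E -> R))) => //.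
- by move=> U V /= oU oV; exact: openI.
- by move=> U; exact: approximable_open.
- move=> S mS aS.
  have -> : \1_(~` S) = (fun x => (\1_setT x : R) + (-1) * \1_S x).
    apply/funext => x; rewrite !indicE in_setC in_setT.
    by case: (_ \in _); rewrite /= ?mulr1 ?mulr0 ?addr0 ?subrr.
  have SL := indic_L2 mS.
  apply: (@approximableD (\1_setT) (fun x => (-1) * \1_S x)) => //.
  - exact: indic_L2.
  - exact: L2Z.
  - exact: approximableZ.
- move=> F mF tF aF.
  have mU : measurable (\bigcup_k F k) by exact: bigcupT_measurable.
  apply: approximable_lim; first exact: indic_L2.
  move=> e e0.
  pose f n x : R := \sum_(i < n) \1_(F i) x.
  have fL n : f n \in L2f by apply: L2_sum => i; exact: indic_L2.
  have fE n x : f n x = \1_(\bigcup_(k < n) F k) x.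
    rewrite /f; elim: n => [|n ih].
      by rewrite big_ord0 bigcup_mkord big_ord0 indicE in_set0.
    rewrite big_ord_recr/= ih !indicE !bigcup_mkord big_ord_recr/=.
    rewrite in_setU.
    case: (boolP (x \in F n)) => [/set_mem Fn|_]; last by rewrite orbF addr0.
    rewrite orbT; case: (boolP (x \in _)) => [/set_mem|_]; last by rewrite add0r.
    rewrite -bigcup_mkord => -[k /= kn Fk].
    have := tF k n I I (ex_intro _ x (conj Fk Fn)).
    by move=> kn'; rewrite kn' ltnn in kn.
  have [n Hn] := @n2_dominated f (\1_(\bigcup_k F k)) (fun=> 1) fL (indic_L2 mU)
   (abddL2 leb_fin (abdd_cst _ 1)) (ltac:(
    move=> n x; rewrite fE normr1 !indicE;
    by do 2 case: (_ \in _); rewrite ?subrr ?subr0 ?sub0r ?normrN ?normr1 ?normr0)) (ltac:(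
    move=> x _; rewrite indicE; case: (boolP (x \in _)) => [/set_mem[k _ Fk]|nx];
     [apply: cvg_near_cst; exists k.+1 => // n /= kn; rewrite fE indicE mem_set//;
      by exists k
     |apply: cvg_near_cst; apply: nearW => n; rewrite fE indicE memNset//;
      by move=> [k _ Fk]; move/negP : nx; apply; apply/mem_set; exists k])) e e0.
  exists (f n); split => //.
  by apply: approximable_sum => i; [exact: indic_L2|exact: aF].
Qed.

Import HBNNSimple.

(** Positive and negative parts, each the limit of simple functions dominated by it. This yields
    both the density of D(A) and the uniqueness of weak derivatives. *)
Lemma approximable_L2 f : f \in L2f -> approximable f.
Proof.
suff pos g : g \in L2f -> (forall x, 0 <= g x) -> approximable g.
  move=> fL.
  have pL : (fun x => Num.max (f x) 0) \in L2f.
    have mf := L2_meas fL; apply: L2_dom fL _; first exact: measurable_maxr.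
    by apply: nearW => x; rewrite /Num.max; case: ifPn; rewrite // normr0.
  have nL : (fun x => Num.max (- f x) 0) \in L2f.
    have mf := L2_meas fL; apply: L2_dom fL _.
      by apply: measurable_maxr => //; exact: measurableT_comp.
    by apply: nearW => x; rewrite /Num.max; case: ifPn; rewrite ?normrN ?normr0.
  have -> : f = (fun x => Num.max (f x) 0 + (-1) * Num.max (- f x) 0).
    apply/funext => x; rewrite /Num.max; case: ifPn => h1; case: ifPn => h2; lra.
  apply: approximableD => //; first exact: L2Z.
  + by apply: pos => // x; rewrite le_max lexx orbT.
  + by apply: approximableZ => //; apply: pos => // x; rewrite le_max lexx orbT.
move=> gL g0.
have mg : measurable_fun setT (EFin \o g) by apply/measurable_EFinP; exact: L2_meas gL.
pose s n := nnsfun_approx measurableT mg n.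
have s_le n x : 0 <= s n x <= g x.
  apply/andP; split => //.
  rewrite -lee_fin /s nnsfun_approxE.
  by apply: (le_approx (f := EFin \o g)) => // t _ /=; rewrite lee_fin.
have sL n : (s n : E -> R) \in L2f.
  apply: L2_dom gL _; first exact: measurable_funP.
  by apply: nearW => x; have /andP[? ?] := s_le n x; rewrite !ger0_norm.
have as_ n : approximable (s n).
  have -> : (s n : E -> R) =
      (fun x => \sum_(y <- finmap.enum_fset (fset_set (range (s n)))) (y * \1_(s n @^-1` [set y]) x)).
    by apply/funext => x; rewrite fimfunE fsbig_finite.
  have mA y : measurable (s n @^-1` [set y]).
    by rewrite -[X in measurable X]setTI; exact: (measurable_funP (s n)).
  have aA y := approximable_indic (mA y); have LA y := indic_L2 (mA y).
  apply: approximable_sum => y; first exact: (L2Z y (LA y)).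
  by apply: approximableZ; [exact: LA|exact: aA].
have dom n x : `|s n x - g x| <= `|g x|.
  have /andP[s0 sg] := s_le n x; rewrite distrC ger0_norm ?subr_ge0// ger0_norm//.
  by rewrite gerBl.
have cv x : Omega x -> s n x @[n --> \oo] --> g x.
  move=> _; have := cvg_nnsfun_approx measurableT mg (fun t _ => g0 t) (I : setT x).
  by move=> /fine_cvg.
apply: (approximable_lim gL) => // e e0.
have [n Hn] := n2_dominated sL gL gL dom cv e0.
by exists (s n).
Qed.

(** For a test function [phi] within [e] of [f], orthogonality gives
    [|f|^2 = <f, f - phi> <= |f| e]. *)
Lemma test_ae0 f : f \in L2f ->
  (forall phi, test phi -> \int[mu]_x (f x * phi x) = 0) -> \forall x \ae mu, f x = 0.
Proof.
move=> fL f0; apply: n2_eq0 => //; apply/eqP; rewrite eq_le n2_ge0 andbT.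
apply/ler_addgt0Pr => e e0; rewrite add0r.
have [phi tphi H] := approximable_L2 fL e0; have pL := test_L2 tphi.
have [->|n0] := eqVneq (n2 mu f) 0; first exact: ltW.
have n0' : 0 < n2 mu f by rewrite lt_neqAle eq_sym n0 n2_ge0.
rewrite -(ler_pM2l n0') -expr2 n2_sqr//.
have -> : ip mu f f = ip mu f (fun x => f x - phi x).
  by rewrite ipBr// [X in _ - X](f0 _ tphi) subr0.
apply: (le_trans (ip_le_n2 fL (L2B fL pL))).
by rewrite ler_pM2l// ltW.
Qed.

End domain.

(** * Weak derivatives, the space H^1_0 and the formal adjoint of the operator *)

Section weak_derivatives.
Context (R : realType) (d : nat) (Omega : set 'rV[R]_d) (oO : open Omega).
Hypothesis bO : bounded_set Omega.
Local Notation E := 'rV[R]_d.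
Local Notation mu := (leb_on oO).
Local Notation L2f := (Lfun mu 2%:E).
Local Notation L2O := (L2 oO).
Local Notation test := (test_function Omega).
Local Notation itg f := (mu.-integrable setT (EFin \o f)).

Definition toL2 (f : E -> R) (fL : f \in L2f) : L2O := Lfun_Sub (lee1n 2) fL.

Lemma Linfty_abdd f : Linfty oO f -> abdd mu f.
Proof.
rewrite /Linfty inE => /andP[/[1!inE]/= mf]; rewrite inE/= /finite_norm unlock /Lnorm.
case: ifPn => [_ /ess_sup_inf.ess_supr_bounded[M HM]|]; first by split => //; exists M.
(* Here the whole space is null, so 0 is a bound a.e. *)
rewrite -leNgt => mu0 _; split => //; exists 0.
exists setT; split => //.
by apply/eqP; rewrite eq_le mu0 measure_ge0.
Qed.

Lemma weak_partial_test phi i : test phi -> weak_partial oO i phi (partial i phi).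
Proof. by move=> tphi psi tpsi; apply: test_ibp => //; exact: test_smooth tphi. Qed.

(** [phi * psi] is again a test function; the definition of [dk] tested on it is the Leibniz
    rule. *)
Lemma weak_partialM k dk phi i : abdd mu k -> abdd mu dk ->
  weak_partial oO i k dk -> test phi ->
  weak_partial oO i (fun x => k x * phi x)
    (fun x => dk x * phi x + k x * partial i phi x).
Proof.
move=> ak adk wk tphi psi tpsi.
have pphi : pdiff i phi := test_pdiff tphi; have ppsi : pdiff i psi := test_pdiff tpsi.
have aphi := test_abdd oO tphi; have apsi := test_abdd oO tpsi.
have adphi := test_abdd oO (test_partial i tphi).
have adpsi := test_abdd oO (test_partial i tpsi).
have := wk _ (testM tpsi (test_smooth tphi)).
rewrite (partialM pphi ppsi).
have -> : (fun x => k x * (phi x * partial i psi x + psi x * partial i phi x)) =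
  (fun x => k x * phi x * partial i psi x + k x * partial i phi x * psi x).
  by apply/funext => x; ring.
rewrite RintD; try by apply/(abdd_itg bO); do 2 (apply: abddM => //).
move=> H.
have -> : (fun x => (dk x * phi x + k x * partial i phi x) * psi x) =
  (fun x => dk x * (phi x * psi x) + k x * partial i phi x * psi x).
  by apply/funext => x; ring.
rewrite RintD; try by apply/(abdd_itg bO); do 2 (apply: abddM => //).
by rewrite opprD -H addrK.
Qed.

Lemma weak_partial_unique i f g h : f \in L2f -> g \in L2f -> h \in L2f ->
  weak_partial oO i f g -> weak_partial oO i f h -> \forall x \ae mu, g x = h x.
Proof.
move=> fL gL hL wg wh.
have : \forall x \ae mu, g x - h x = 0.
  apply: (@test_ae0 _ _ _ oO bO (fun x => g x - h x)); first exact: L2B.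
  move=> phi tphi; have pL := test_L2 oO bO tphi.
  rewrite -[LHS]/(ip mu _ _) ipBl// /ip; apply/eqP; rewrite subr_eq0 -eqr_opp.
  by rewrite -wg// -wh.
by apply: filterS => x /eqP; rewrite subr_eq0 => /eqP.
Qed.

(** [H10] comes with a weak gradient of its own; uniqueness identifies it with the given [p]. One
    index serves all directions since they are finite in number. *)
Lemma H10_approx (f : L2O) (p : 'I_d -> L2O) : H10 f -> weak_grad f p ->
  forall e, 0 < e -> exists phi, [/\ test phi, n2 mu (fun x => phi x - f x) < e &
    forall i, n2 mu (fun x => partial i phi x - p i x) < e].
Proof.
move=> [p' wp' [phi [tphi cphi cdphi]]] wp e e0.
have N_lt (u : nat -> E -> R) : (forall n, u n \in L2f) ->
    ('N[mu]_2%:E[EFin \o u n])%E @[n --> \oo] --> 0%E ->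
    \forall n \near \oo, n2 mu (u n) < e.
  move=> uL; under eq_fun do rewrite Lnorm_n2//.
  move=> /fine_cvg /cvgrPdist_lt /(_ _ e0); apply: filterS => n /=.
  by rewrite sub0r normrN ger0_norm// n2_ge0.
have H1 : \forall n \near \oo, n2 mu (fun x => phi n x - f x) < e.
  apply: (N_lt (fun n x => phi n x - f x)); last exact: cphi.
  by move=> n; apply: L2B; [exact: test_L2|exact: L2_in].
have H2 : \forall n \near \oo, forall i, n2 mu (fun x => partial i (phi n) x - p' i x) < e.
  apply: filter_forall => i; apply: (N_lt (fun n x => partial i (phi n) x - p' i x)); last exact: cdphi.
  move=> n.
  by apply: L2B; [by apply: (test_L2 oO bO); exact: test_partial|exact: L2_in].
have [n [n1 n2']] := filter_ex (filterI H1 H2).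
exists (phi n); split => // i; rewrite (le_lt_trans _ (n2' i))// le_eqVlt.
apply/orP; left; apply/eqP; apply: n2_ae.
- by apply: L2B; [by apply: (test_L2 oO bO); exact: test_partial|exact: L2_in].
- by apply: L2B; [by apply: (test_L2 oO bO); exact: test_partial|exact: L2_in].
- by apply: filterS (weak_partial_unique (L2_in f) (L2_in (p i)) (L2_in (p' i)) (wp i) (wp' i)) => x ->.
Qed.

Lemma ler_mul_eps (x c : R) : 0 <= c -> (forall e, 0 < e -> x <= c * e) -> x <= 0.
Proof.
move=> c0 H; apply/ler_addgt0Pr => e e0; rewrite add0r.
apply: le_trans (H (e / (c + 1)) _) _; first by rewrite divr_gt0// ltr_wpDl.
by rewrite mulrA ler_pdivrMr ?ltr_wpDl// mulrC ler_pM2l// lerDl.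
Qed.

(** For a test function in place of [f] this is [weak_partialM]. Both sides are continuous in [f]
    and [p i] for the L^2 norm, and [H10_approx] approximates the two together. *)
Lemma H10_partialM (f : L2O) (p : 'I_d -> L2O) k dk i psi : H10 f -> weak_grad f p ->
  abdd mu k -> abdd mu dk -> weak_partial oO i k dk -> test psi ->
  \int[mu]_x (k x * p i x * psi x) =
  - \int[mu]_x (f x * (dk x * psi x + k x * partial i psi x)).
Proof.
move=> Hf wp ak adk wk tpsi.
have apsi := test_abdd oO tpsi.
have adpsi := test_abdd oO (test_partial i tpsi).
pose w x := dk x * psi x + k x * partial i psi x.
have aw : abdd mu w by apply: abddD; apply: abddM.
have wL := abddL2 (leb_fin oO bO) aw.
have kpL : (fun x => k x * psi x) \in L2f by apply: L2_bmul => //; exact: test_L2.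
have -> : \int[mu]_x (k x * p i x * psi x) = ip mu (p i) (fun x => k x * psi x).
  by apply: eq_Rintegral => x _; ring.
rewrite -[X in - X]/(ip mu f w).
apply/eqP; rewrite -addr_eq0 -normr_le0; apply/eqP/eqP.
apply: (@ler_mul_eps _ (n2 mu (fun x => k x * psi x) + n2 mu w)).
  by rewrite addr_ge0// n2_ge0.
move=> e e0; have [phi [tphi Hphi Hdphi]] := H10_approx Hf wp e0.
have pL := test_L2 oO bO tphi; have dpL := test_L2 oO bO (test_partial i tphi).
have aphi := test_abdd oO tphi; have adphi := test_abdd oO (test_partial i tphi).
have key : ip mu (partial i phi) (fun x => k x * psi x) + ip mu phi w = 0.
  have := weak_partialM ak adk wk tpsi tphi.
  rewrite -/w => /eqP; rewrite -addr_eq0 => /eqP H; rewrite -[RHS]H; congr (_ + _);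
    by apply: eq_Rintegral => x _; rewrite mulrC.
rewrite -[X in `|X|]subr0 -key opprD addrACA.
have fL := L2_in f; have piL := L2_in (p i).
rewrite -!ipBl//.
apply: (le_trans (ler_normD _ _)).
rewrite mulrDl lerD//.
- apply: (le_trans (ip_CS (L2B piL dpL) kpL)).
  rewrite mulrC ler_wpM2l ?n2_ge0//.
  rewrite -n2_N ?L2B//; under [X in n2 _ X]eq_fun do rewrite opprB.
  exact: ltW.
- apply: (le_trans (ip_CS (L2B fL pL) wL)).
  rewrite mulrC ler_wpM2l ?n2_ge0//.
  rewrite -n2_N ?L2B//; under [X in n2 _ X]eq_fun do rewrite opprB.
  exact: ltW.
Qed.

Section operator.
Variables (a : 'I_d -> 'I_d -> E -> R) (b : 'I_d -> E -> R) (c : E -> R).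
Variables (da : 'I_d -> 'I_d -> 'I_d -> E -> R) (db : 'I_d -> E -> R).
Hypothesis a_b : forall i j, abdd mu (a i j).
Hypothesis da_b : forall i j k, abdd mu (da i j k).
Hypothesis da_w : forall i j k, weak_partial oO k (a i j) (da i j k).
Hypothesis b_b : forall i, abdd mu (b i).
Hypothesis db_b : forall i, abdd mu (db i).
Hypothesis db_w : forall i, weak_partial oO i (b i) (db i).
Hypothesis c_b : abdd mu c.

(** With the density of test functions, this makes D(A) dense. *)
Lemma test_domain phi : test phi ->
  exists f g : L2O, (f = phi :> (E -> R)) /\ elliptic_op a b c f g.
Proof.
move=> tphi.
have tp i := test_partial i tphi; have tpp i j := test_partial j (tp i).
have N0 (u : E -> R) : u \in L2f -> ('N[mu]_2%:E[EFin \o (u \- u)%R])%E @[n --> \oo] --> 0%E.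
  move=> uL; rewrite (_ : EFin \o _ = cst 0%E).
    by rewrite Lnorm0//; exact: cvg_cst.
  by apply/funext => x /=; rewrite subrr.
pose f := toL2 (test_L2 oO bO tphi).
pose p i := toL2 (test_L2 oO bO (tp i)).
pose h i j := toL2 (test_L2 oO bO (tpp i j)).
have qL i j : (fun x => da i j j x * partial i phi x + a i j x * partial j (partial i phi) x) \in L2f.
  by apply: L2D; apply: L2_bmul => //; exact: test_L2.
pose q i j := toL2 (qL i j).
have gL : (fun x => \sum_i \sum_j q i j x - \sum_i b i x * p i x + c x * f x) \in L2f.
  apply: L2D; last by apply: L2_bmul => //; exact: L2_in.
  apply: L2B.
    by apply: L2_sum => i; apply: L2_sum => j; exact: L2_in.
  by apply: L2_sum => i; apply: L2_bmul => //; exact: L2_in.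
exists f, (toL2 gL); split => //; split.
- exists p; first by move=> i; exact: weak_partial_test.
  by exists h => i j; exact: (weak_partial_test j (tp i)).
- exists p; first by move=> i; exact: weak_partial_test.
  exists (fun=> phi); split => //.
  + by apply: (N0 phi); exact: test_L2.
  + by move=> i; apply: (N0 (partial i phi)); exact: test_L2.
- exists p, q; split.
  + by move=> i; exact: weak_partial_test.
  + by move=> i j; exact: (weak_partialM (a_b i j) (da_b i j j) (da_w i j j) (tp i)).
  + exact: nearW.
Qed.

(** The expansion of [sum_ij d_i (a_ij d_j q) + sum_i d_i (b_i q) + c q], where [da i j k] stands
    for [d_k a_ij]; the drift changes sign under transposition. For a test function [q] it is an
    a.e. bounded function. *)
Definition adjoint_op (q : E -> R) (x : E) : R :=
  \sum_i \sum_j (da i j i x * partial j q x + a i j x * partial i (partial j q) x)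
  + \sum_i (db i x * q x + b i x * partial i q x) + c x * q x.

Lemma adjoint_abdd q : test q -> abdd mu (adjoint_op q).
Proof.
move=> tq; have aq := test_abdd oO tq.
have tdq i := test_partial i tq.
apply: abddD; last exact: abddM.
apply: abddD.
  apply: abdd_sum => i; apply: abdd_sum => j.
  by apply: abddD; apply: abddM => //; apply: (test_abdd oO) => //; exact: test_partial.
apply: abdd_sum => i; apply: abddD; apply: abddM => //.
by apply: (test_abdd oO).
Qed.

(** One integration by parts only. [adjointP] goes on to move the derivative off [p i], while
    [dissipative] keeps both gradients in order to use ellipticity. *)
Lemma Rint_opE f g psi (p : 'I_d -> L2O) (q : 'I_d -> 'I_d -> L2O) :
  f \in L2f -> g \in L2f ->
  (forall i j, weak_partial oO j (fun x => a i j x * p i x) (q i j)) ->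
  (\forall x \ae mu, g x =
          \sum_i \sum_j q i j x - \sum_i b i x * p i x + c x * f x) ->
  test psi ->
  \int[mu]_x (g x * psi x) = - \sum_i \sum_j \int[mu]_x (a i j x * p i x * partial j psi x)
   - \sum_i \int[mu]_x (b i x * p i x * psi x) + \int[mu]_x (c x * f x * psi x).
Proof.
move=> fL gL wq gE tpsi; have psiL := test_L2 oO bO tpsi.
have bpL i : (fun x => b i x * p i x) \in L2f by apply: L2_bmul => //; exact: L2_in.
have cfL : (fun x => c x * f x) \in L2f by exact: L2_bmul.
have sqL : (fun x => \sum_i \sum_j q i j x) \in L2f.
  by apply: L2_sum => i; apply: L2_sum => j; exact: L2_in.
have sbL : (fun x => \sum_i b i x * p i x) \in L2f by exact: L2_sum.
rewrite -[LHS]/(ip mu g psi).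
rewrite (ip_ae gL (L2D (L2B sqL sbL) cfL) psiL psiL gE); last exact: nearW.
rewrite ipDl ?L2B// ipBl// ip_suml => [|i|//]; last by apply: L2_sum => j; exact: L2_in.
rewrite ip_suml//; congr (_ - _ + _).
rewrite -sumrN; apply: eq_bigr => i _.
rewrite ip_suml => [|j|//]; last exact: L2_in.
rewrite -sumrN; apply: eq_bigr => j _.
by rewrite wq// opprK.
Qed.

(** The second integration by parts is [H10_partialM], with [k] an entry of [a] or of [b]. *)
Lemma adjointP (f g : L2O) psi : elliptic_op a b c f g -> test psi ->
  \int[mu]_x (g x * psi x) = \int[mu]_x (f x * adjoint_op psi x).
Proof.
move=> [_ Hf [p [q [wp wq gE]]]] tpsi.
have fL := L2_in f; have gL := L2_in g; have psiL := test_L2 oO bO tpsi.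
have tdpsi i := test_partial i tpsi.
rewrite (Rint_opE fL gL wq gE tpsi).
have apsi := test_abdd oO tpsi.
have adpsi i := test_abdd oO (tdpsi i).
have addpsi i j := test_abdd oO (test_partial i (tdpsi j)).
have w1 i j : abdd mu (fun x => da i j i x * partial j psi x + a i j x * partial i (partial j psi) x).
  by apply: abddD; apply: abddM.
have w2 i : abdd mu (fun x => db i x * psi x + b i x * partial i psi x).
  by apply: abddD; apply: abddM.
have itgf k : abdd mu k -> itg (fun x => f x * k x).
  by move=> ak; apply: L2_ipitg => //; apply: abddL2 => //; exact: leb_fin.
have -> : (fun x => f x * adjoint_op psi x) = (fun x =>
   \sum_i \sum_j f x * (da i j i x * partial j psi x + a i j x * partial i (partial j psi) x) +
   \sum_i f x * (db i x * psi x + b i x * partial i psi x) + f x * (c x * psi x)).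
  apply/funext => x; rewrite /adjoint_op !mulrDr; congr (_ + _ + _).
    by rewrite mulr_sumr; apply: eq_bigr => i _; rewrite mulr_sumr.
  by rewrite mulr_sumr.
rewrite RintD; last 2 first.
- by apply: itgD; apply: itg_sum => i; [apply: itg_sum => j|]; exact: itgf.
- by apply: itgf; exact: abddM.
rewrite RintD; last 2 first.
- by apply: itg_sum => i; apply: itg_sum => j; exact: itgf.
- by apply: itg_sum => i; exact: itgf.
congr (_ + _ + _).
- rewrite Rint_sum; last by move=> i; apply: itg_sum => j; exact: itgf.
  rewrite -sumrN; apply: eq_bigr => i _.
  rewrite Rint_sum; last by move=> j; exact: itgf.
  rewrite -sumrN; apply: eq_bigr => j _.
  by rewrite (@H10_partialM f p (a i j) (da i j i) i (partial j psi))// opprK.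
- rewrite Rint_sum; last by move=> i; exact: itgf.
  rewrite -sumrN; apply: eq_bigr => i _.
  by rewrite (@H10_partialM f p (b i) (db i) i psi)// opprK.
- by apply: eq_Rintegral => x _; ring.
Qed.

End operator.
End weak_derivatives.

(** * Negative parts and their smooth approximation *)

Definition negp (R : realDomainType) (s : R) : R := Num.max (- s) 0.

Section negative_part.
Context (R : realType).
Implicit Types s t : R.

Lemma negp_ge0 s : 0 <= negp s. Proof. by rewrite le_max lexx orbT. Qed.

Lemma negpP s : (s < 0 /\ negp s = - s) \/ (0 <= s /\ negp s = 0).
Proof.
rewrite /negp; have [s0|s0] := ltP s 0; [left|right]; split => //.
  by apply/max_idPl; rewrite oppr_ge0 ltW.
by apply/max_idPr; rewrite oppr_le0.
Qed.

Lemma negp_ge s : - negp s <= s.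
Proof. by case: (negpP s) => -[? ->]; lra. Qed.

Lemma negp_dist s t : `|negp s - negp t| <= `|s - t|.
Proof.
by case: (negpP s) => -[? ->]; case: (negpP t) => -[? ->];
  rewrite ler_norml; apply/andP; split;
  have := ler_norm (s - t); have := ler_norm (- (s - t)); rewrite normrN; lra.
Qed.

Lemma negp_le_norm s : negp s <= `|s|.
Proof.
by case: (negpP s) => -[s0 ->] //; rewrite -normrN ler_norm.
Qed.

Lemma negp_mul s : s * negp s = - negp s ^+ 2.
Proof. by case: (negpP s) => -[_ ->]; ring. Qed.

(** The square of the negative part is C^1 with second derivative at most 2; this second-order bound
    replaces a chain rule along orbits. *)
Lemma negp_sqrD s t : negp (s + t) ^+ 2 <= negp s ^+ 2 - 2 * negp s * t + t ^+ 2.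
Proof.
by case: (negpP s) => -[? ->]; case: (negpP (s + t)) => -[? ->]; nra.
Qed.

Lemma flat1E t : 0 < t -> flat 1 t = expR (- t^-1).
Proof. by move=> t0; rewrite /flat t0 hornerC mul1r. Qed.

Lemma flat1_next t : 0 < t -> flat (flat_next 1) t = t ^- 2 * expR (- t^-1).
Proof.
move=> t0; rewrite /flat t0 /flat_next hornerM hornerXn hornerD hornerN.
by rewrite -[1]/(1%:P) derivC hornerC horner0 subr0 mulr1 exprVn.
Qed.

(* A smooth version of [s |-> - negp s], within [e] of it. *)
Definition snegp (e s : R) : R := s * flat 1 (- e^-1 * s).

Definition snegp' (e s : R) : R :=
  flat 1 (- e^-1 * s) + s * (flat (flat_next 1) (- e^-1 * s) * (- e^-1)).

Section snegp_bounds.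
Variables (e s : R).
Hypothesis e0 : 0 < e.

Lemma snegp_ge0 : 0 <= s -> snegp e s = 0 /\ snegp' e s = 0.
Proof.
move=> s0; have t0 : - e^-1 * s <= 0.
  by rewrite mulNr oppr_le0 mulr_ge0// invr_ge0 ltW.
by rewrite /snegp /snegp' !flat_le0//; split; ring.
Qed.

Let t := - e^-1 * s.

(** The variable [t = |s| / e] reduces the bounds below to [1 + x <= expR x] and [expR (- x) <= 1]
    for [x >= 0]. *)
Lemma snegp_lt0 : s < 0 -> [/\ 0 < t, snegp e s = s * expR (- t^-1) &
  snegp' e s = expR (- t^-1) * (1 + t^-1)].
Proof.
move=> s0; have t0 : 0 < t.
  by rewrite /t mulNr -mulrN mulr_gt0 ?invr_gt0 ?oppr_gt0.
split => //; first by rewrite /snegp flat1E.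
rewrite /snegp' -/t flat1E// flat1_next//.
have eN0 : e != 0 by rewrite gt_eqF. 
have sN0 : s != 0 by rewrite lt_eqF.
rewrite {2 3 4 5}/t; set z := expR _; field.
by rewrite eN0 sN0.
Qed.

Lemma snegp'_ge0 : 0 <= snegp' e s.
Proof.
have [s0|s0] := ltP s 0; last by have [_ ->] := snegp_ge0 s0.
have [t0 _ ->] := snegp_lt0 s0.
by rewrite mulr_ge0 ?expR_ge0// addr_ge0// invr_ge0 ltW.
Qed.

Lemma snegp'_le1 : snegp' e s <= 1.
Proof.
have [s0|s0] := ltP s 0; last by have [_ ->] := snegp_ge0 s0.
have [t0 _ ->] := snegp_lt0 s0.
by rewrite mulrC expRN ler_pdivrMr ?expR_gt0// mul1r expR_ge1Dx.
Qed.

(** Needed by [young_drift]: the drift carries the factor [snegp] but the diffusion only the weight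
    [snegp'], so the former must be controlled by the latter and a term without derivatives. *)
Lemma snegp_sqr : snegp e s ^+ 2 <= snegp' e s * negp s ^+ 2.
Proof.
have [s0|s0] := ltP s 0; last by have [-> ->] := snegp_ge0 s0; rewrite mul0r expr0n.
have [t0 -> ->] := snegp_lt0 s0.
have -> : negp s = - s by case: (negpP s) => -[? ->] //; lra.
rewrite sqrrN exprMn mulrC ler_wpM2r ?sqr_ge0// expr2 ler_wpM2l ?expR_ge0//.
have ti : 0 <= t^-1 by rewrite invr_ge0 ltW.
have : expR (- t^-1) <= 1 by rewrite -expR0 ler_expR oppr_le0.
lra.
Qed.

Lemma snegp_dist : `|snegp e s + negp s| <= e.
Proof.
have [s0|s0] := ltP s 0; last first.
  have [-> _] := snegp_ge0 s0; case: (negpP s) => -[? ->]; first lra.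
  by rewrite addr0 normr0 ltW.
have [t0 -> _] := snegp_lt0 s0.
have -> : negp s = - s by case: (negpP s) => -[? ->] //; lra.
rewrite -[X in _ - X]mulr1 -mulrBr normrM (ltr0_norm s0).
have ti : 0 < t^-1 by rewrite invr_gt0.
have E1 : expR (- t^-1) <= 1 by rewrite -expR0 ler_expR oppr_le0 ltW.
rewrite distrC ger0_norm ?subr_ge0//.
have E2 := expR_ge1Dx (- t^-1).
have -> : e = - s * t^-1 by rewrite /t; field; rewrite gt_eqF// lt_eqF.
rewrite ler_wpM2l ?oppr_ge0 ?(ltW s0)//; lra.
Qed.

End snegp_bounds.

(** Young's inequality with weight [u']: the diffusion [theta x^2 u'] absorbs the drift. The
    constant comes from the square of [2 theta u' |x| - M |u|]. *)
Lemma young_drift (theta M x bb u u' m : R) : 0 < theta -> 0 <= M -> 0 <= u' ->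
  u ^+ 2 <= u' * m ^+ 2 -> `|bb| <= M ->
  - (theta * x ^+ 2 * u') - bb * x * u <= M ^+ 2 / (4 * theta) * m ^+ 2.
Proof.
move=> th0 M0 u'0 um bM.
have C0 : 0 <= M ^+ 2 / (4 * theta) * m ^+ 2.
  by rewrite mulr_ge0 ?sqr_ge0// divr_ge0 ?sqr_ge0// mulr_ge0// ltW.
have H1 : - (bb * x * u) <= M * `|x| * `|u|.
  apply: (le_trans (ler_norm _)); rewrite normrN !normrM -!mulrA ler_wpM2r// mulr_ge0//.
(* A vanishing weight forces [u = 0]; otherwise it is positive and the inequality may be multiplied
   by [4 theta u']. *)
move: u'0; rewrite le_eqVlt => /orP[/eqP u'0|u'0].
  have : u = 0.
    apply/eqP; rewrite -sqrf_eq0 eq_le sqr_ge0 andbT; apply: (le_trans um).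
    by rewrite -u'0 mul0r.
  by move=> ->; rewrite -u'0; lra.
have H2 : M * `|x| * `|u| <= theta * x ^+ 2 * u' + M ^+ 2 / (4 * theta) * m ^+ 2.
  have p : 0 < 4 * theta * u' by rewrite !mulr_gt0.
  rewrite -(ler_pM2l p).
  have -> : 4 * theta * u' * (theta * x ^+ 2 * u' + M ^+ 2 / (4 * theta) * m ^+ 2) =
     4 * theta ^+ 2 * u' ^+ 2 * `|x| ^+ 2 + M ^+ 2 * (u' * m ^+ 2).
    by rewrite real_normK ?num_real//; field; rewrite gt_eqF.
  have : M ^+ 2 * `|u| ^+ 2 <= M ^+ 2 * (u' * m ^+ 2).
    by rewrite ler_wpM2l ?sqr_ge0// real_normK ?num_real.
  have := sqr_ge0 (2 * theta * u' * `|x| - M * `|u|).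
  nra.
lra.
Qed.

End negative_part.

(** * The energy inequality for negative parts on D(A) *)

Section dissipativity.
Context (R : realType) (d : nat) (Omega : set 'rV[R]_d) (oO : open Omega).
Hypothesis bO : bounded_set Omega.
Local Notation E := 'rV[R]_d.
Local Notation mu := (leb_on oO).
Local Notation L2f := (Lfun mu 2%:E).
Local Notation L2O := (L2 oO).
Local Notation test := (test_function Omega).
Local Notation itg f := (mu.-integrable setT (EFin \o f)).

Lemma test_snegp e phi : test phi -> test (fun x => snegp e (phi x)).
Proof.
move=> tphi; have Cphi := test_smooth tphi.
have -> : (fun x => snegp e (phi x)) = (fun x => flat 1 (- e^-1 * phi x) * phi x).
  by apply/funext => x; rewrite /snegp mulrC.
apply: testM => //; apply: Cinfty_flat; apply: CinftyM => //; exact: Cinfty_cst.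
Qed.

Lemma partial_snegp (e : R) (phi : E -> R) i : pdiff i phi ->
  partial i (fun x => snegp e (phi x)) = (fun x => snegp' e (phi x) * partial i phi x).
Proof.
move=> dphi.
have d1 : pdiff i (fun x => - e^-1 * phi x).
  by apply: (pdiffM _ dphi) => x; exact: derivable_cst.
have d2 : pdiff i (fun x => flat 1 (- e^-1 * phi x)).
  by move=> x; case: (is_derive_comp1 (is_derive_flat 1 (- e^-1 * phi x)) (pdiffP x d1)).
rewrite /snegp (partialM dphi d2) (partial_flat 1 d1).
rewrite (partialM (fun x => derivable_cst (- e^-1) x (delta_mx ord0 i)) dphi) partial_cst.
by apply/funext => x; rewrite /snegp' /=; ring.
Qed.

Lemma measurable_negp (f : E -> R) : measurable_fun setT f ->
  measurable_fun setT (fun x => negp (f x)).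
Proof. by move=> mf; apply: measurable_maxr => //; exact: measurableT_comp. Qed.

Lemma L2_negp (f : E -> R) : f \in L2f -> (fun x => negp (f x)) \in L2f.
Proof.
move=> fL; have mf := L2_meas fL; apply: L2_dom fL _; first exact: measurable_negp.
by apply: nearW => x; rewrite (ger0_norm (negp_ge0 _)) negp_le_norm.
Qed.

Lemma ae_common_bound (I : finType) (k : I -> E -> R) : (forall i, abdd mu (k i)) ->
  exists2 M, 0 <= M & \forall x \ae mu, forall i, `|k i x| <= M.
Proof.
move=> ak.
have : abdd mu (fun x => \sum_i `|k i x|).
  apply: abdd_sum => i; have [mk [M HM]] := ak i; split; first exact: measurableT_comp.
  by exists M; apply: filterS HM => x; rewrite normr_id.
move=> [_ [M HM]]; exists `|M| => //; apply: filterS HM => x HM i.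
apply: (le_trans _ (ler_norm M)) => /=; apply: le_trans HM.
rewrite [leRHS]ger0_norm ?sumr_ge0// (bigD1 i)//= lerDl sumr_ge0//.
Qed.

Section operator.
Variables (a : 'I_d -> 'I_d -> E -> R) (b : 'I_d -> E -> R) (c : E -> R).
Hypothesis a_b : forall i j, abdd mu (a i j).
Hypothesis b_b : forall i, abdd mu (b i).
Hypothesis c_b : abdd mu c.
Hypothesis a_ell : uniformly_elliptic oO a.

(** [young_drift] in each coordinate, hence the factor [d]. The quantifiers on [p], [u], [u'], [m]
    stand inside the a.e. statement because they are later given values that depend on [x]. *)
Lemma ae_drift_bound : exists2 C, 0 <= C &
  \forall x \ae mu, forall (p : 'I_d -> R) (u u' m : R), 0 <= u' ->
    u ^+ 2 <= u' * m ^+ 2 ->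
    - (\sum_i \sum_j a i j x * p i * p j * u') - \sum_i b i x * p i * u <= C * m ^+ 2.
Proof.
have [theta th0 ell] := a_ell; have [M M0 HM] := ae_common_bound b_b.
exists (d%:R * (M ^+ 2 / (4 * theta))).
  by rewrite mulr_ge0// divr_ge0 ?sqr_ge0// mulr_ge0// ltW.
apply: filterS2 ell HM => x ell HM p u u' m u'0 um.
have := ell (\row_i p i).
rewrite /eucl_norm sqr_sqrtr ?sumr_ge0//; last by move=> i _; rewrite sqr_ge0.
under eq_bigr do rewrite mxE.
under [X in _ <= X]eq_bigr do under eq_bigr do rewrite !mxE.
move=> {}ell.
have H1 : theta * (\sum_i p i ^+ 2) * u' <= \sum_i \sum_j a i j x * p i * p j * u'.
  apply: (le_trans (ler_wpM2r u'0 ell)); rewrite mulr_suml.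
  by apply: ler_sum => i _; rewrite mulr_suml.
have : - (theta * (\sum_i p i ^+ 2) * u') - \sum_i b i x * p i * u <=
   \sum_(i < d) M ^+ 2 / (4 * theta) * m ^+ 2.
  rewrite mulr_sumr mulr_suml -!sumrN -big_split/=.
  by apply: ler_sum => i _; exact: young_drift.
rewrite sumr_const card_ord -mulr_natl mulrA.
lra.
Qed.

(** The weak form accepts only test functions, so [f] is replaced by a nearby test function [phi]
    and [- f^-] by [snegp e] of [phi]. The gradient of the latter is that of [phi] times a weight in
    [[0, 1]], so ellipticity still acts, and every error is [O(e)]. *)
Lemma dissipative : exists2 K, 0 <= K & forall f g : L2O, elliptic_op a b c f g ->
  - ip mu g (fun x => negp (f x)) <= K * n2 mu (fun x => negp (f x)) ^+ 2.
Proof.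
have [C C0 HC] := ae_drift_bound.
have [mc [M0 HM0]] := c_b; pose M := `|M0|.
have HM : \forall x \ae mu, `|c x| <= M.
  by apply: filterS HM0 => x /le_trans; apply; exact: ler_norm.
have Mge0 : 0 <= M := normr_ge0 _.
exists (C + M); first exact: addr_ge0.
move=> f g [_ Hf [p [q [wp wq gE]]]].
have fL := L2_in f; have gL := L2_in g.
pose fn x := negp (f x).
have fnL : fn \in L2f by exact: L2_negp.
have pL i : (p i : E -> R) \in L2f := L2_in (p i).
have apL i j : (fun x => a i j x * p i x) \in L2f by apply: L2_bmul.
have cfL : (fun x => c x * f x) \in L2f by exact: L2_bmul.
pose oneL : (fun=> 1) \in L2f := abddL2 (leb_fin oO bO) (abdd_cst mu 1).
pose n1 := n2 mu (fun=> 1).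
have n10 : 0 <= n1 := n2_ge0 _ _.
pose Sap := \sum_i \sum_j n2 mu (fun x => a i j x * p i x).
have Sap0 : 0 <= Sap by apply: sumr_ge0 => i _; apply: sumr_ge0 => j _; exact: n2_ge0.
pose N := n2 mu fn.
have N0 : 0 <= N := n2_ge0 _ _.
(* The coefficients of [e] in the errors: the replacement of [- f^-] by [psi] against [g] and [c f],
   the gradient error [Sap], and [(N + e)^2 <= N^2 + (2 N + 1) e] for [e <= 1]. *)
pose B := (n2 mu g + n2 mu (fun x => c x * f x)) * (n1 + 1) + Sap + C * (2 * N + 1).
have B0 : 0 <= B.
  rewrite /B !addr_ge0 ?mulr_ge0 ?addr_ge0 ?n2_ge0//.
  by rewrite mulr_ge0.
suff H e : 0 < e -> e <= 1 -> - ip mu g fn - (C + M) * N ^+ 2 <= B * e.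
  rewrite -subr_le0; apply: (@ler_mul_eps _ _ B) => // e e0.
  have [e1|e1] := leP e 1; first exact: H.
  by apply: (le_trans (H 1 _ _)) => //; rewrite ler_wpM2l// ltW.
move=> e0 e1.
have [phi [tphi Hphi Hdphi]] := H10_approx bO Hf wp e0.
have phiL := test_L2 oO bO tphi.
have dphiL i := test_L2 oO bO (test_partial i tphi).
pose psi x := snegp e (phi x).
have tpsi : test psi by exact: test_snegp.
have psiL := test_L2 oO bO tpsi.
have dpsi i : partial i psi = (fun x => snegp' e (phi x) * partial i phi x).
  by apply: partial_snegp; exact: test_pdiff tphi.
have dpsiL i : partial i psi \in L2f by exact/(test_L2 oO bO)/test_partial.
have rphi : (fun x => phi x - f x) \in L2f by exact: L2B.
have rdphi i : (fun x => partial i phi x - p i x) \in L2f by exact: L2B.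
(* One error [e] is that of [snegp], uniform in [x], whence [n1]; the other is the distance from
   [phi] to [f]. *)
have psifn : n2 mu (fun x => psi x + fn x) <= (n1 + 1) * e.
  apply: (@le_trans _ _ (n2 mu (fun x => e * 1 + `|phi x - f x|))).
    apply: n2_mono; first exact: L2D.
      apply: L2D; first exact: L2Z.
      by have mr := L2_meas rphi; apply: L2_dom rphi _; [exact: measurableT_comp|apply: nearW => x; rewrite normr_id].
    apply: nearW => x; rewrite mulr1 [leRHS]ger0_norm ?addr_ge0 ?(ltW e0)//.
    have -> : psi x + fn x = (snegp e (phi x) + negp (phi x)) + (fn x - negp (phi x)).
      by rewrite /psi; ring.
    rewrite (le_trans (ler_normD _ _))// lerD//; first exact: snegp_dist.
    by rewrite distrC negp_dist.
  have nL : (fun x => `|phi x - f x|) \in L2f.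
    by have mr := L2_meas rphi; apply: L2_dom rphi _; [exact: measurableT_comp|apply: nearW => x; rewrite normr_id].
  rewrite (le_trans (n2_D (L2Z e oneL) nL))// n2_Z// gtr0_norm// mulrDl mul1r -/n1 mulrC lerD2l.
  rewrite (le_trans _ (ltW Hphi))//; apply: n2_mono => //.
  by apply: nearW => x; rewrite normr_id.
have psfL : (fun x => psi x + fn x) \in L2f by exact: L2D.
have key : ip mu g psi <= e * Sap + C * (N + e) ^+ 2 +
    n2 mu (fun x => c x * f x) * ((n1 + 1) * e) + M * N ^+ 2.
  rewrite /ip (Rint_opE bO b_b c_b fL gL wq gE tpsi).
  have bpL i : (fun x => b i x * p i x) \in L2f by apply: L2_bmul.
  pose ap x := \sum_i \sum_j a i j x * p i x * partial j psi x.
  pose bp x := \sum_i b i x * p i x * psi x.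
  have iap : itg ap by apply: itg_sum => i; apply: itg_sum => j; exact: L2_ipitg.
  have ibp : itg bp by apply: itg_sum => i; exact: L2_ipitg.
  have icf : itg (fun x => c x * f x * psi x) by exact: L2_ipitg.
  have -> : \sum_i \sum_j \int[mu]_x (a i j x * p i x * partial j psi x) = \int[mu]_x ap x.
    rewrite Rint_sum; last by move=> i; apply: itg_sum => j; exact: L2_ipitg.
    by apply: eq_bigr => i _; rewrite Rint_sum// => j; exact: L2_ipitg.
  have -> : \sum_i \int[mu]_x (b i x * p i x * psi x) = \int[mu]_x bp x.
    by rewrite Rint_sum// => i; exact: L2_ipitg.
  pose phn x := negp (phi x).
  have phnL : phn \in L2f by exact: L2_negp.
  (* The gradient of [psi] involves that of [phi]. Splitting off [r] leaves a quadratic form in [p]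
     alone, to which ellipticity applies. *)
  pose r j x := partial j phi x - p j x.
  pose rr x := \sum_i \sum_j `|a i j x * p i x| * `|r j x|.
  have absL (u : E -> R) : u \in L2f -> (fun x => `|u x|) \in L2f.
    by move=> uL; have mr := L2_meas uL; apply: L2_dom uL _; [exact: measurableT_comp|apply: nearW => x; rewrite normr_id].
  have n2_abs (u : E -> R) : u \in L2f -> n2 mu (fun x => `|u x|) <= n2 mu u.
    by move=> uL; apply: n2_mono => //; [exact: absL|apply: nearW => x; rewrite normr_id].
  have irr : itg rr.
    apply: itg_sum => i; apply: itg_sum => j; apply: L2_ipitg; first exact: (absL _ (apL i j)).
    exact: (absL _ (rdphi j)).
  have iphn : itg (fun x => C * (phn x * phn x)) by apply: itgZ; exact: L2_ipitg.
  have icps : itg (fun x => `|c x * f x| * `|psi x + fn x|).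
    by apply: L2_ipitg; [exact: (absL _ cfL)|exact: (absL _ psfL)].
  have iMfn : itg (fun x => M * (fn x * fn x)) by apply: itgZ; exact: L2_ipitg.
  have -> : - (\int[mu]_x ap x) - (\int[mu]_x bp x) + \int[mu]_x (c x * f x * psi x) =
      \int[mu]_x ((c x * f x * psi x - ap x) - bp x).
    by rewrite RintB// ?RintB//; [ring|exact: itgB].
  apply: (@le_trans _ _ (\int[mu]_x (rr x + C * (phn x * phn x) +
     `|c x * f x| * `|psi x + fn x| + M * (fn x * fn x)))).
    apply: Rint_le.
    - by apply: itgB => //; exact: itgB.
    - by do 3 (apply: itgD => //).
    apply: filterS2 HC HM => x HC HM.
    have H1 := HC (fun i => p i x) (psi x) (snegp' e (phi x)) (phn x)
       (snegp'_ge0 _ e0) (snegp_sqr _ e0).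
    have H2 : - ap x <= - (\sum_i \sum_j a i j x * p i x * p j x * snegp' e (phi x)) + rr x.
      rewrite -!sumrN -big_split/= ; apply: ler_sum => i _.
      rewrite -!sumrN -big_split/= ; apply: ler_sum => j _.
      rewrite dpsi.
      have -> : partial j phi x = p j x + r j x by rewrite /r addrC subrK.
      rewrite mulrDr mulrDr opprD (mulrC (snegp' _ _) (p j x)) !mulrA lerD2l.
      apply: (le_trans (ler_norm _)); rewrite normrN normrM normrM -mulrA.
      rewrite ler_wpM2l// ger0_norm ?snegp'_ge0//.
      by rewrite ler_piMl// snegp'_le1.
    (* [psi] is close to [- fn], and [- f f^-] is exactly the square of [f^-]. *)
    have H3 : c x * f x * psi x <= `|c x * f x| * `|psi x + fn x| + M * (fn x * fn x).
      have -> : c x * f x * psi x = c x * f x * (psi x + fn x) + c x * (- (f x * fn x)).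
        by ring.
      rewrite negp_mul opprK expr2 lerD//.
        by rewrite -normrM ler_norm.
      by rewrite ler_wpM2r ?mulr_ge0 ?negp_ge0// (le_trans (ler_norm _)).
    rewrite expr2 in H1; rewrite /bp; lra.
  rewrite RintD//; last by do 2 (apply: itgD => //).
  rewrite RintD//; last by apply: itgD.
  rewrite RintD//.
  rewrite !RintZ; try exact: L2_ipitg.
  rewrite -[\int[mu]_x (fn x * fn x)]/(ip mu fn fn) -n2_sqr// -/N lerD2r.
  rewrite -[\int[mu]_x (phn x * phn x)]/(ip mu phn phn) -n2_sqr//.
  apply: lerD; first apply: lerD.
  - rewrite Rint_sum; last first.
      by move=> i; apply: itg_sum => j; apply: L2_ipitg; [exact: (absL _ (apL i j))|exact: (absL _ (rdphi j))].
    rewrite mulr_sumr; apply: ler_sum => i _.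
    rewrite Rint_sum; last first.
      by move=> j; apply: L2_ipitg; [exact: (absL _ (apL i j))|exact: (absL _ (rdphi j))].
    rewrite mulr_sumr; apply: ler_sum => j _.
    apply: (le_trans (ip_le_n2 (absL _ (apL i j)) (absL _ (rdphi j)))).
    rewrite mulrC ler_pM ?n2_ge0//; last exact: n2_abs.
    exact: (le_trans (n2_abs _ (rdphi j)) (ltW (Hdphi j))).
  - rewrite ler_wpM2l// ler_sqr ?nnegrE ?n2_ge0 ?addr_ge0 ?(ltW e0)//.
    have -> : phn = (fun x => fn x + (phn x - fn x)) by apply/funext => x; ring.
    have dL : (fun x => phn x - fn x) \in L2f by exact: L2B.
    rewrite (le_trans (n2_D fnL dL))// lerD2l (le_trans _ (ltW Hphi))//.
    by apply: n2_mono => //; apply: nearW => x; exact: negp_dist.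
  - apply: (le_trans (ip_le_n2 (absL _ cfL) (absL _ psfL))).
    rewrite ler_pM ?n2_ge0//; first exact: n2_abs.
    exact: le_trans (n2_abs _ psfL) psifn.
have H4 : - ip mu g fn <= ip mu g psi + n2 mu g * ((n1 + 1) * e).
  have -> : ip mu g fn = ip mu g (fun x => psi x + fn x) - ip mu g psi by rewrite ipDr//; ring.
  have := ip_CS gL psfL; rewrite ler_norml => /andP[H _].
  have : n2 mu g * n2 mu (fun x => psi x + fn x) <= n2 mu g * ((n1 + 1) * e).
    by rewrite ler_wpM2l ?n2_ge0.
  lra.
have e2 : e ^+ 2 <= e by rewrite expr2 ler_piMl// ltW.
have : C * e ^+ 2 <= C * e by rewrite ler_wpM2l.
rewrite /B; move: key H4; set X := ip mu g psi; set Y := ip mu g fn.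
set G := n2 mu g; set F := n2 mu (fun x => c x * f x).
move=> key H4 e2'; nra.
Qed.

End operator.
End dissipativity.

(** * Negative parts along orbits, and comparison with a supersolution of the adjoint equation *)

Section orbits.
Context (R : realType) (d : nat) (Omega : set 'rV[R]_d) (oO : open Omega).
Hypothesis bO : bounded_set Omega.
Local Notation E := 'rV[R]_d.
Local Notation mu := (leb_on oO).
Local Notation L2f := (Lfun mu 2%:E).
Local Notation L2O := (L2 oO).
Implicit Types (f g v : L2O) (u : E -> R).

Lemma ipOB f g u : u \in L2f -> ip mu (f - g : L2O) u = ip mu f u - ip mu g u.
Proof. by move=> uL; exact: (ipBl (L2_in f) (L2_in g) uL). Qed.

Lemma ipOD f g u : u \in L2f -> ip mu (f + g : L2O) u = ip mu f u + ip mu g u.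
Proof. by move=> uL; exact: (ipDl (L2_in f) (L2_in g) uL). Qed.

Lemma ipOZ k f u : u \in L2f -> ip mu (k *: f : L2O) u = k * ip mu f u.
Proof. by move=> uL; exact: (ipZl k (L2_in f) uL). Qed.

Lemma ip_nrm2 f u : u \in L2f -> `|ip mu f u| <= nrm2 f * n2 mu u.
Proof. by move=> uL; rewrite nrm2E; apply: ip_CS => //; exact: L2_in. Qed.

Lemma n2_negp_dist f g :
  n2 mu (fun x => negp (f x)) <= n2 mu (fun x => negp (g x)) + nrm2 (f - g).
Proof.
have fL := L2_negp (L2_in f); have gL := L2_negp (L2_in g).
rewrite nrm2E.
have -> : (fun x => negp (f x)) = (fun x => negp (g x) + (negp (f x) - negp (g x))).
  by apply/funext => x; ring.
apply: (le_trans (n2_D gL (L2B fL gL))); rewrite lerD2l.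
apply: n2_mono; [exact: L2B|exact: L2_in|].
by apply: nearW => x; exact: negp_dist.
Qed.

Variable S : R -> L2O -> L2O.
Hypothesis S_C0 : C0_semigroup S.

Lemma orbit_right f g t e : generator S f g -> 0 <= t -> 0 < e ->
  \forall h \near 0^'+, nrm2 (S (t + h) f - S t f - h *: S t g) <= h * e.
Proof.
move=> Gfg t0 e0.
have /cvgrPdist_lt/(_ e e0) := generator_orbit S_C0 t0 Gfg.
move=> H; near=> h.
have h0 : 0 < h by near: h; exact: nbhs_right_gt.
have Hh : `|0 - nrm2 (h^-1 *: (S h (S t f) - S t f) - S t g)| < e by near: h.
have -> : nrm2 (S (t + h) f - S t f - h *: S t g) =
    nrm2 (h *: (h^-1 *: (S h (S t f) - S t f) - S t g)).
  apply: nrm2_ae; rewrite (addrC t); apply: filterS (C0_comp S_C0 f (ltW h0) t0) => x H' _.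
  by rewrite !(L2BE, L2ZE) H'//; field; rewrite gt_eqF.
rewrite nrm2Z gtr0_norm// ler_wpM2l ?(ltW h0)//.
by move: Hh; rewrite sub0r normrN ger0_norm ?nrm2_ge0// => /ltW.
Unshelve. all: by end_near.
Qed.

Variable A : L2O -> L2O -> Prop.
Hypothesis SA : forall f g, generator S f g <-> A f g.
Variable K : R.
Hypothesis K0 : 0 <= K.
Hypothesis A_diss : forall f g, A f g ->
  - ip mu g (fun x => negp (f x)) <= K * n2 mu (fun x => negp (f x)) ^+ 2.

Let N t f := n2 mu (fun x => negp (S t f x)).

(** One Gronwall step: expand by [negp_sqrD] with increment [z = h S_t g + r] and apply
    dissipativity at [S t f], which lies in D(A). *)
Lemma negp_orbit_right f g t e : A f g -> 0 <= t -> 0 < e ->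
  \forall h \near 0^'+, N (t + h) f ^+ 2 <= (1 + 2 * K * h) * N t f ^+ 2 + h * e.
Proof.
move=> Afg t0 e0; have Gfg := iffRL (SA f g) Afg.
have At : A (S t f) (S t g) by apply/SA; exact: generator_orbit.
pose n := N t f; pose y' := S t g.
have n0 : 0 <= n := n2_ge0 _ _.
have y0 : 0 <= nrm2 y' := nrm2_ge0 _.
(* Makes the remainder [r] cost at most [h e / 2]; the other half goes to the square of the norm of
   [z], through the bound on [h] below. *)
pose eta := Num.min 1 (e / (4 * (n + 1))).
have p4 : 0 < 4 * (n + 1) by lra.
have eta0 : 0 < eta by rewrite lt_min ltr01 divr_gt0.
have eta1 : eta <= 1 by rewrite ge_min lexx.
have etan : 2 * n * eta <= e / 2.
  have : eta <= e / (4 * (n + 1)) by rewrite ge_min lexx orbT.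
  by rewrite ler_pdivlMr// => H; nra.
have c0 : 0 < e / (2 * (nrm2 y' + 1) ^+ 2).
  by rewrite divr_gt0// mulr_gt0// exprn_gt0//; lra.
near=> h.
have h0 : 0 < h by near: h; exact: nbhs_right_gt.
have hc : h < e / (2 * (nrm2 y' + 1) ^+ 2) by near: h; exact: nbhs_right_lt.
have Hr : nrm2 (S (t + h) f - S t f - h *: y') <= h * eta.
  by near: h; exact: orbit_right.
set r := (S (t + h) f - S t f - h *: y') in Hr.
pose z := S (t + h) f - S t f.
have zE : z = h *: y' + r by rewrite /r [RHS]addrC subrK.
have zn : nrm2 z <= h * (nrm2 y' + 1).
  rewrite zE (le_trans (nrm2D _ _))// nrm2Z gtr0_norm// mulrDr mulr1 lerD2l.
  by rewrite (le_trans Hr)// ler_piMr// ltW.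
pose yn x := negp (S t f x).
have ynL : yn \in L2f := L2_negp (L2_in _).
have yhL : (fun x => negp (S (t + h) f x)) \in L2f := L2_negp (L2_in _).
have zL := L2_in z; have rL := L2_in r.
have step1 : N (t + h) f ^+ 2 <= n ^+ 2 - 2 * ip mu z yn + nrm2 z ^+ 2.
  rewrite nrm2E /N /n /N !n2_sqr//.
  have -> : ip mu yn yn - 2 * ip mu z yn + ip mu z z =
     \int[mu]_x (yn x * yn x - 2 * (z x * yn x) + z x * z x).
    have i1 := L2_ipitg ynL ynL; have i2 := L2_ipitg zL ynL; have i3 := L2_ipitg zL zL.
    have i4 : mu.-integrable setT (EFin \o (fun x => 2 * (z x * yn x))) by exact: itgZ.
    have i5 : mu.-integrable setT (EFin \o (fun x => yn x * yn x - 2 * (z x * yn x))) by exact: itgB.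
    by rewrite (RintD i5 i3) (RintB i1 i4) (RintZ 2 i2).
  apply: Rint_le.
  - exact: L2_ipitg.
  - apply: itgD; last exact: L2_ipitg.
    by apply: itgB; [exact: L2_ipitg|apply: itgZ; exact: L2_ipitg].
  apply: nearW => x.
  have -> : S (t + h) f x = S t f x + z x by rewrite /z L2BE [RHS]addrC subrK.
  by have := negp_sqrD (S t f x) (z x); rewrite /yn !expr2; lra.
have Hd : - ip mu y' yn <= K * n ^+ 2 := A_diss At.
have zip : ip mu z yn = h * ip mu y' yn + ip mu r yn.
  by rewrite zE ipOD// ipOZ.
have rip : - ip mu r yn <= h * eta * n.
  have := ip_nrm2 r ynL; rewrite ler_norml => /andP[H _].
  have : nrm2 r * n2 mu yn <= h * eta * n by rewrite ler_wpM2r.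
  lra.
have zz : nrm2 z ^+ 2 <= h * (e / 2).
  have : nrm2 z ^+ 2 <= (h * (nrm2 y' + 1)) ^+ 2.
    by rewrite lerXn2r ?nnegrE ?nrm2_ge0// mulr_ge0// ?(ltW h0)//; lra.
  move=> /le_trans; apply.
  rewrite exprMn expr2 -mulrA ler_wpM2l ?(ltW h0)//.
  move: hc; rewrite ltr_pdivlMr; last by rewrite mulr_gt0// exprn_gt0//; lra.
  lra.
have H1 : h * (- ip mu y' yn) <= h * (K * n ^+ 2) by rewrite ler_wpM2l// ltW.
have H2 : h * (2 * n * eta) <= h * (e / 2) by rewrite ler_wpM2l// ltW.
rewrite -/(N t f) -/n; nra.
Unshelve. all: by end_near.
Qed.

(** [exp(-2 K s) |(S_s f)^-|^2] satisfies the hypotheses of [dini_le] with slope 0. The estimate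
    does not presuppose [f >= 0], so it controls approximants of nonnegative data. *)
Lemma negp_decay f g t : A f g -> 0 <= t -> N t f <= expR (K * t) * n2 mu (fun x => negp (f x)).
Proof.
move=> Afg t0.
pose F s := expR (- (2 * K * s)) * N s f ^+ 2.
have N0 : N 0 f = n2 mu (fun x => negp (f x)).
  apply: n2_ae; try exact: (L2_negp (L2_in _)).
  by apply: filterS (C0_id S_C0 f) => x ->.
have Nge0 s : 0 <= N s f := n2_ge0 _ _.
have H : F t <= F 0 + 0 * t.
  apply: dini_le => //.
  - move=> s e /andP[s0 st] e0.
    have := negp_orbit_right Afg s0 e0 => H; near=> h.
    have h0 : 0 < h by near: h; exact: nbhs_right_gt.
    have Hh : N (s + h) f ^+ 2 <= (1 + 2 * K * h) * N s f ^+ 2 + h * e by near: h.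
    rewrite /F add0r.
    have E1 : expR (- (2 * K * (s + h))) <= 1.
      by rewrite -expR0 ler_expR oppr_le0 !mulr_ge0// addr_ge0// ltW.
    (* [(1 + x) exp(-x) <= 1] cancels the growth factor of [negp_orbit_right]. *)
    have E2 : expR (- (2 * K * (s + h))) * (1 + 2 * K * h) <= expR (- (2 * K * s)).
      rewrite (mulrDr (2 * K)) opprD expRD -mulrA ler_piMr ?expR_ge0//.
      by rewrite expRN mulrC ler_pdivrMr ?expR_gt0// mul1r expR_ge1Dx.
    apply: (le_trans (ler_wpM2l (expR_ge0 _) Hh)).
    rewrite mulrDr mulrA lerD//.
      by rewrite ler_wpM2r// sqr_ge0.
    by rewrite ler_piMl// mulr_ge0// ltW.
  - move=> s e /andP[s0 st] e0.
    (* A change of [N] by at most [dl] then lowers its square by at most [e]. *)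
    pose dl := e / (2 * N s f + 1).
    have p0 : 0 < 2 * N s f + 1 by have := Nge0 s; lra.
    have dl0 : 0 < dl by rewrite divr_gt0.
    have := C0_left S_C0 f s0 dl0 => H; near=> h.
    have h0 : 0 < h by near: h; exact: nbhs_right_gt.
    have Hh : nrm2 (S s f - S (s - h) f) < dl by near: h.
    have Hn : N s f <= N (s - h) f + nrm2 (S s f - S (s - h) f) by exact: n2_negp_dist.
    have Hd : dl * (2 * N s f + 1) = e by rewrite /dl divfK// gt_eqF.
    have H2 : N s f ^+ 2 <= N (s - h) f ^+ 2 + e.
      have := Nge0 s; have := Nge0 (s - h).
      have {Hn Hh} : N s f <= N (s - h) f + dl by lra.
      move: (N s f) (N (s - h) f) Hd => p q Hd Hpq q0 p0'.
      have [pd|pd] := leP p dl; nra.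
    rewrite /F.
    have E1 : expR (- (2 * K * s)) <= 1.
      by rewrite -expR0 ler_expR oppr_le0 !mulr_ge0// ltW.
    have E2 : expR (- (2 * K * s)) <= expR (- (2 * K * (s - h))).
      rewrite ler_expR lerN2 ler_wpM2l ?mulr_ge0//; lra.
    apply: (le_trans (ler_wpM2l (expR_ge0 _) H2)).
    rewrite mulrDr lerD//; first by rewrite ler_wpM2r ?sqr_ge0.
    by rewrite ler_piMl// ltW.
move: H; rewrite mul0r addr0 /F mulr0 oppr0 expR0 mul1r N0 => H.
rewrite -ler_sqr ?nnegrE ?mulr_ge0 ?expR_ge0 ?n2_ge0//.
have EE : expR (K * t) ^+ 2 = expR (2 * K * t).
  by rewrite expr2 -expRD; congr expR; ring.
rewrite exprMn EE.
move: H; rewrite expRN mulrC ler_pdivrMr ?expR_gt0// mulrC => H.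
exact: H.
Unshelve. all: by end_near.
Qed.

Section barrier.
Variables (Q G AQ AG : E -> R) (Tstar : R).
Hypotheses (QL : Q \in L2f) (GL : G \in L2f) (AQL : AQ \in L2f) (AGL : AG \in L2f).
Hypothesis adjQ : forall f g, A f g -> ip mu g Q = ip mu f AQ.
Hypothesis adjG : forall f g, A f g -> ip mu g G = ip mu f AG.
Hypothesis super : forall s, 0 <= s <= Tstar -> \forall x \ae mu, AQ x + s * AG x <= G x.
Hypothesis A_dense : forall v e, 0 < e -> exists f g, A f g /\ nrm2 (v - f) < e.

(** The pairing of [S t f] with [q(tau - t)], where [q(s) = Q + s G]. *)
Let m tau t f := ip mu (S t f) Q + (tau - t) * ip mu (S t f) G.

(** The right derivative of [m] is [<S_t f, w>] with [w = A* q - G <= 0], hence at most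
    [|(S_t f)^-| |w|]; [negp_decay] bounds this and yields the error term. *)
Lemma barrier_orbit f g tau : A f g -> 0 <= tau <= Tstar ->
  ip mu (S tau f) Q <= ip mu f Q + tau * ip mu f G +
    expR (K * tau) * (n2 mu (fun x => AQ x - G x) + tau * n2 mu AG) *
     n2 mu (fun x => negp (f x)) * tau.
Proof.
move=> Afg /andP[tau0 tauT].
pose W := n2 mu (fun x => AQ x - G x) + tau * n2 mu AG.
have W0 : 0 <= W by rewrite addr_ge0 ?mulr_ge0 ?n2_ge0.
pose nf := n2 mu (fun x => negp (f x)).
have nf0 : 0 <= nf := n2_ge0 _ _.
have Gfg := iffRL (SA f g) Afg.
have m0E : m tau 0 f = ip mu f Q + tau * ip mu f G.
  have e0 := C0_id S_C0 f; have eS : \forall x \ae mu, S 0 f x = f x by apply: filterS e0 => x; apply.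
  rewrite /m subr0 (ip_ae (L2_in _) (L2_in f) QL QL eS); last exact: nearW.
  by rewrite (ip_ae (L2_in _) (L2_in f) GL GL eS)//; exact: nearW.
have mtE : m tau tau f = ip mu (S tau f) Q by rewrite /m subrr mul0r addr0.
rewrite -m0E -mtE -/W -/nf.
apply: (@dini_le _ (fun t => m tau t f) tau (expR (K * tau) * W * nf)) => //.
- move=> t e /andP[t0 tt] e0.
  have At : A (S t f) (S t g) by apply/SA; exact: generator_orbit.
  pose s := tau - t.
  have s0 : 0 <= s by rewrite subr_ge0 ltW.
  pose y := S t f; pose y' := S t g.
  (* The total coefficient of [h eta] in the remainders of the expansion [E] below: [r] against [Q]
     and [s G], then the product of the two increments. The final 1 makes it positive. *)
  pose c1 := n2 mu Q + s * n2 mu G + (nrm2 y' + 1) * n2 mu G + 1.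
  have c10 : 0 < c1.
    have q1 := mulr_ge0 s0 (n2_ge0 mu G); have q2 := n2_ge0 mu Q.
    have q3 := mulr_ge0 (addr_ge0 (nrm2_ge0 y') ler01) (n2_ge0 mu G).
    by rewrite /c1; lra.
  pose eta := Num.min 1 (e / c1).
  have eta0 : 0 < eta by rewrite lt_min ltr01 divr_gt0.
  have eta1 : eta <= 1 by rewrite ge_min lexx.
  have etac : eta * c1 <= e.
    by rewrite -ler_pdivlMr// ge_min lexx orbT.
  (* Adjointness turns the left side into [<y, w>]; since [w <= 0], replacing [y] by [- y^-] can
     only increase it. *)
  have B1 : ip mu y' Q + s * ip mu y' G - ip mu y G <= expR (K * tau) * W * nf.
    have yL := L2_in y; have ynL : (fun x => negp (y x)) \in L2f := L2_negp yL.
    rewrite (adjQ At) (adjG At) -(ipZr s AGL)//.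
    pose w x := (AQ x - G x) + s * AG x.
    have aL : (fun x => AQ x - G x) \in L2f by exact: L2B.
    have sAL : (fun x => s * AG x) \in L2f by exact: L2Z.
    have wL : w \in L2f by exact: L2D.
    have -> : ip mu y AQ + ip mu y (fun x => s * AG x) - ip mu y G = ip mu y w.
      by rewrite /w ipDr// ipBr//; ring.
    have wn : n2 mu w <= W.
      rewrite (le_trans (n2_D aL sAL))// lerD2l n2_Z// ger0_norm// ler_wpM2r ?n2_ge0//.
      by rewrite /s gerBl.
    apply: (@le_trans _ _ (ip mu (fun x => negp (y x)) (fun x => - w x))).
      apply: Rint_le; [exact: L2_ipitg|apply: L2_ipitg => //; exact: L2N|].
      apply: filterS (super (s := s) _); last by rewrite s0/= (le_trans _ tauT)// /s gerBl.
      move=> x Hx; have w0 : w x <= 0 by rewrite /w; lra.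
      by have := negp_ge (y x); nra.
    apply: (le_trans (ip_le_n2 ynL (L2N wL))).
    rewrite n2_N// mulrAC ler_pM ?n2_ge0//.
    apply: (le_trans (negp_decay Afg t0)); rewrite ler_wpM2r// ler_expR ler_wpM2l//.
    exact: ltW.
  near=> h.
  have h0 : 0 < h by near: h; exact: nbhs_right_gt.
  have he : h < eta by near: h; exact: nbhs_right_lt.
  have Hr : nrm2 (S (t + h) f - S t f - h *: y') <= h * eta.
    by near: h; exact: orbit_right.
  set r := (S (t + h) f - S t f - h *: y') in Hr.
  have yhE : S (t + h) f = y + (h *: y' + r).
    by rewrite /r [h *: y' + _]addrC subrK [RHS]addrC subrK.
  have rQ : ip mu r Q <= h * eta * n2 mu Q.
    apply: (le_trans (ler_norm _)); apply: (le_trans (ip_nrm2 r QL)).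
    by rewrite ler_wpM2r ?n2_ge0.
  have rG : `|ip mu r G| <= h * eta * n2 mu G.
    by apply: (le_trans (ip_nrm2 r GL)); rewrite ler_wpM2r ?n2_ge0.
  have yG : `|ip mu y' G| <= nrm2 y' * n2 mu G := ip_nrm2 y' GL.
  have E : m tau (t + h) f - m tau t f =
     h * (ip mu y' Q + s * ip mu y' G - ip mu y G) + (ip mu r Q + s * ip mu r G)
      - h * (h * ip mu y' G + ip mu r G).
    rewrite /m yhE -/y !ipOD// !ipOZ//; rewrite /s; ring.
  have H1 : s * ip mu r G <= s * (h * eta * n2 mu G).
    by rewrite ler_wpM2l// (le_trans (ler_norm _)).
  have H2 : - (h * ip mu y' G + ip mu r G) <= eta * ((nrm2 y' + 1) * n2 mu G).
    rewrite (le_trans (ler_norm _))// normrN (le_trans (ler_normD _ _))//.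
    rewrite normrM gtr0_norm//.
    have : h * `|ip mu y' G| <= eta * (nrm2 y' * n2 mu G).
      by rewrite ler_pM// ?(ltW h0)// ltW.
    have : h * eta * n2 mu G <= eta * n2 mu G.
      rewrite ler_wpM2r ?n2_ge0// ler_piMl// ?(ltW eta0)//.
      by rewrite (le_trans (ltW he)).
    lra.
  have H3 : h * (- (h * ip mu y' G + ip mu r G)) <= h * (eta * ((nrm2 y' + 1) * n2 mu G)).
    by rewrite ler_wpM2l// ltW.
  have H4 : h * (ip mu y' Q + s * ip mu y' G - ip mu y G) <= h * (expR (K * tau) * W * nf).
    by rewrite ler_wpM2l// ltW.
  have H5 : h * (eta * c1) <= h * e by rewrite ler_wpM2l// ltW.
  have H6 : 0 <= h * eta by rewrite mulr_ge0// ltW.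
  rewrite -lerBlDl E.
  move: H5; rewrite /c1; lra.
(* Left semicontinuity, from [C0_left] and the affine dependence of the weight on time. *)
- move=> t e /andP[t0 tt] e0.
  pose s := tau - t.
  have s0 : 0 <= s by rewrite subr_ge0.
  pose y := S t f.
  pose c1 := n2 mu Q + s * n2 mu G + (nrm2 y + 1) * n2 mu G + 1.
  have c10 : 0 < c1.
    have q1 := mulr_ge0 s0 (n2_ge0 mu G); have q2 := n2_ge0 mu Q.
    have q3 := mulr_ge0 (addr_ge0 (nrm2_ge0 y) ler01) (n2_ge0 mu G).
    by rewrite /c1; lra.
  pose eta := Num.min 1 (e / c1).
  have eta0 : 0 < eta by rewrite lt_min ltr01 divr_gt0.
  have eta1 : eta <= 1 by rewrite ge_min lexx.
  have etac : eta * c1 <= e.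
    by rewrite -ler_pdivlMr// ge_min lexx orbT.
  have HL := C0_left S_C0 f t0 eta0.
  near=> h.
  have h0 : 0 < h by near: h; exact: nbhs_right_gt.
  have he : h < eta by near: h; exact: nbhs_right_lt.
  have Hr : nrm2 (S t f - S (t - h) f) < eta by near: h.
  pose r := S t f - S (t - h) f.
  have E : m tau t f - m tau (t - h) f = ip mu r Q + s * ip mu r G + h * (ip mu r G - ip mu y G).
    rewrite /m /r !ipOB// /s; ring.
  have rQ : ip mu r Q <= eta * n2 mu Q.
    apply: (le_trans (ler_norm _)); apply: (le_trans (ip_nrm2 r QL)).
    by rewrite ler_wpM2r ?n2_ge0// ltW.
  have rG : `|ip mu r G| <= eta * n2 mu G.
    by apply: (le_trans (ip_nrm2 r GL)); rewrite ler_wpM2r ?n2_ge0// ltW.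
  have yG : `|ip mu y G| <= nrm2 y * n2 mu G := ip_nrm2 y GL.
  have H1 : s * ip mu r G <= s * (eta * n2 mu G).
    by rewrite ler_wpM2l// (le_trans (ler_norm _)).
  have H2 : ip mu r G - ip mu y G <= (nrm2 y + 1) * n2 mu G.
    have : eta * n2 mu G <= n2 mu G by rewrite ler_piMl// n2_ge0.
    have := ler_norm (ip mu r G); have := ler_norm (- ip mu y G); rewrite normrN; lra.
  have H3 : h * (ip mu r G - ip mu y G) <= eta * ((nrm2 y + 1) * n2 mu G).
    apply: (@le_trans _ _ (h * ((nrm2 y + 1) * n2 mu G))).
      by rewrite ler_wpM2l// ltW.
    by rewrite ler_wpM2r ?(ltW he)// mulr_ge0 ?addr_ge0 ?nrm2_ge0 ?n2_ge0.
  rewrite -lerBlDl E.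
  move: etac; rewrite /c1; lra.
Unshelve. all: by end_near.
Qed.

(** Approximate [v] by [f] in D(A): the initial pairings and [f^-] are of the order of the distance
    to [v], so [barrier_orbit] passes to the limit. *)
Lemma barrier_le0 v tau : (\forall x \ae mu, 0 <= v x) ->
  ip mu v Q = 0 -> ip mu v G = 0 -> 0 <= tau <= Tstar -> ip mu (S tau v) Q <= 0.
Proof.
move=> v0 vQ vG tauT; have /andP[tau0 _] := tauT.
have [M M0 HM] := C0_sub_bounded S_C0 tau0.
pose W := expR (K * tau) * (n2 mu (fun x => AQ x - G x) + tau * n2 mu AG).
have W0 : 0 <= W by rewrite mulr_ge0 ?expR_ge0 ?addr_ge0 ?mulr_ge0 ?n2_ge0.
(* In order: the errors in [<f, Q>] and [<f, G>], the negative part of [f], and [S tau] applied to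
   [v - f]. *)
pose B := n2 mu Q + tau * n2 mu G + W * tau + M * n2 mu Q.
apply: (@ler_mul_eps _ _ B).
  have q1 := mulr_ge0 tau0 (n2_ge0 mu G); have q2 := n2_ge0 mu Q.
  have q3 := mulr_ge0 W0 tau0; have q4 := mulr_ge0 M0 (n2_ge0 mu Q).
  by rewrite /B; lra.
move=> e e0; have [f [g [Afg fv]]] := A_dense v e0.
have H := barrier_orbit Afg tauT; rewrite -/W in H.
have H1 : ip mu f Q <= e * n2 mu Q.
  have -> : ip mu f Q = ip mu (f - v) Q by rewrite ipOB// vQ subr0.
  apply: (le_trans (ler_norm _)); apply: (le_trans (ip_nrm2 _ QL)).
  by rewrite ler_wpM2r ?n2_ge0// nrm2_dist ltW.
have H2 : ip mu f G <= e * n2 mu G.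
  have -> : ip mu f G = ip mu (f - v) G by rewrite ipOB// vG subr0.
  apply: (le_trans (ler_norm _)); apply: (le_trans (ip_nrm2 _ GL)).
  by rewrite ler_wpM2r ?n2_ge0// nrm2_dist ltW.
have H3 : n2 mu (fun x => negp (f x)) <= e.
  apply: (le_trans (n2_negp_dist f v)); rewrite nrm2_dist.
  have -> : n2 mu (fun x => negp (v x)) = 0.
    have vL := L2_negp (L2_in v).
    apply/eqP; rewrite -sqrf_eq0 n2_sqr//; apply/eqP.
    rewrite (ip_ae vL (L2_0 mu) vL (L2_0 mu) (_ : \forall x \ae mu, negp (v x) = 0)).
    + by rewrite /ip; under eq_Rintegral do rewrite mulr0; rewrite Rintegral_cst// mul0r.
    + by apply: filterS v0 => x v0; case: (negpP (v x)) => -[? ->] //; lra.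
    + by apply: filterS v0 => x v0; case: (negpP (v x)) => -[? ->] //; lra.
  by rewrite add0r ltW.
have H4 : ip mu (S tau v) Q <= ip mu (S tau f) Q + M * e * n2 mu Q.
  rewrite -lerBlDl -ipOB//.
  apply: (le_trans (ler_norm _)); apply: (le_trans (ip_nrm2 _ QL)).
  rewrite ler_wpM2r ?n2_ge0// (le_trans (HM _ _))// ler_wpM2l// ltW//.
have H5 : W * n2 mu (fun x => negp (f x)) * tau <= W * e * tau.
  by rewrite ler_wpM2r// ler_wpM2l.
have H6 : tau * ip mu f G <= tau * (e * n2 mu G) by rewrite ler_wpM2l.
rewrite /B; lra.
Qed.

End barrier.
End orbits.

(** Here [u = 1/w], and the right side is [A* e(w)] divided by [e(w)]. The term in [u^4] dominates:
    [u >= 4] gives [u^4 - 2 u^3 >= u^4 / 2], and [hu] beats the lower orders. *)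
Lemma edge_bound (R : realFieldType) (u el rho theta c1 c0 s1 s0 : R) :
  4 <= u -> 0 < theta -> 0 < rho -> theta * (rho / 2) <= el ->
  s1 <= c1 -> - c0 <= s0 -> 0 <= c1 -> 0 <= c0 ->
  c1 + c0 + 1 <= u * (theta * rho) ->
  1 <= (u ^+ 4 - 2 * u ^+ 3) * (4 * el) - u ^+ 2 * s1 + s0.
Proof.
move=> u4 th0 rho0 hel h1 h0 c10 c00 hu.
have up : 0 <= u by lra.
have u3 : 0 <= u ^+ 3 by rewrite exprn_ge0.
have H1 : u ^+ 4 / 2 <= u ^+ 4 - 2 * u ^+ 3.
  by rewrite (exprS u 3); have : 4 * u ^+ 3 <= u * u ^+ 3; [rewrite ler_wpM2r|lra].
have H2 : u ^+ 4 * (theta * rho) <= (u ^+ 4 - 2 * u ^+ 3) * (4 * el).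
  have -> : u ^+ 4 * (theta * rho) = (u ^+ 4 / 2) * (4 * (theta * (rho / 2))) by field.
  apply: ler_pM => //; first by rewrite divr_ge0// exprn_ge0.
    by rewrite !mulr_ge0// ?divr_ge0// ltW.
  by rewrite ler_wpM2l.
have H3 : u ^+ 3 * (c1 + c0 + 1) <= u ^+ 4 * (theta * rho).
  by rewrite (exprSr u 3) -mulrA ler_wpM2l.
have H4 : u ^+ 2 * s1 <= u ^+ 3 * c1.
  apply: (@le_trans _ _ (u ^+ 2 * c1)); first by rewrite ler_wpM2l// sqr_ge0.
  by rewrite ler_wpM2r// ler_weXn2l//; lra.
have H5 : c0 + 1 <= u ^+ 3 * (c0 + 1).
  by rewrite ler_peMl ?addr_ge0// exprn_ege1//; lra.
by move: H1 H2 H3 H4 H5 h0; clear; lra.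
Qed.

Lemma exists_small_factor (R : realFieldType) (x y : R) : 0 <= x -> 0 < y ->
  exists2 e, 0 < e & e * x < y.
Proof.
move=> x0 y0; have x1 : 0 < x + 1 by rewrite ltr_wpDl.
exists (y / (x + 1)); first exact: divr_gt0.
by rewrite mulrAC ltr_pdivrMr// ltr_pM2l// ltrDl.
Qed.

(** * Construction of the radial supersolution *)

Section radial_barrier.
Context (R : realType) (d : nat) (Omega : set 'rV[R]_d) (oO : open Omega).
Hypothesis bO : bounded_set Omega.
Local Notation E := 'rV[R]_d.
Local Notation mu := (leb_on oO).
Local Notation L2f := (Lfun mu 2%:E).
Local Notation test := (test_function Omega).
Local Notation itg f := (mu.-integrable setT (EFin \o f)).

Lemma flat1_ge0 (t : R) : 0 <= flat 1 t.
Proof. by rewrite /flat; case: ifP => // _; rewrite hornerC mul1r expR_ge0. Qed.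

Lemma flat1_homo (s t : R) : s <= t -> flat 1 s <= flat 1 t.
Proof.
move=> st; have [s0|s0] := leP s 0; first by rewrite (flat_le0 _ s0) flat1_ge0.
have t0 : 0 < t by exact: lt_le_trans st.
by rewrite !flat1E// ler_expR lerN2 lef_pV2.
Qed.

Lemma flat1_gt0 (t : R) : 0 < t -> 0 < flat 1 t.
Proof. by move=> t0; rewrite flat1E// expR_gt0. Qed.

Lemma flat1_next2 (t : R) : 0 < t ->
  flat (flat_next (flat_next 1)) t = (t ^- 4 - 2 * t ^- 3) * flat 1 t.
Proof.
move=> t0; rewrite flat1E// /flat t0; congr (_ * _).
have -> : flat_next (1 : {poly R}) = 'X^2.
  by rewrite /flat_next -[X in X - _]/(1%:P) derivC subr0 mulr1.
rewrite /flat_next hornerM hornerXn hornerD hornerN hornerXn derivXn hornerMn hornerXn /=.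
by rewrite expr1 !exprVn -mulr_natl mulrBr -!exprVn; ring.
Qed.

Lemma Rint_gt0 f : itg f -> (\forall x \ae mu, 0 <= f x) ->
  ~ (\forall x \ae mu, f x = 0) -> 0 < \int[mu]_x f x.
Proof.
move=> fi f0 fN0; rewrite lt_neqAle Rint_ge0// andbT eq_sym; apply/negP => /eqP f00.
apply: fN0; have /integrableP[mf _] := fi.
have : (\int[mu]_x `|(f x)%:E| = 0)%E.
  have := integrable_fin_num measurableT fi => /fineK H.
  rewrite -[RHS]/(0%:E) -f00 /Rintegral H.
  apply: ae_eq_integral => //; first exact: measurableT_comp.
  by apply: filterS f0 => x f0 _; rewrite /= ger0_norm.
move=> /(ae_eq_integral_abs mu measurableT mf).
by apply: filterS => x /(_ I) [].
Qed.

Variable x0 : E.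
Local Notation z i x := (x ord0 i - x0 ord0 i).

(** For [P = 1] and [k = rho - delta] this is [e(w - delta)] of the overview; iterates of
    [flat_next] give its derivatives in [w]. *)
Definition radial P k (x : E) : R := flat P (k - sqdist x0 x).

Lemma radial_out P k x : k <= sqdist x0 x -> radial P k x = 0.
Proof. by move=> kx; rewrite /radial flat_le0// subr_le0. Qed.

Lemma Cinfty_radial P k : Cinfty (radial P k).
Proof.
apply: Cinfty_flat.
have -> : (fun x => k - sqdist x0 x) = (fun x => k + (-1) * sqdist x0 x).
  by apply/funext => x; rewrite mulN1r.
by apply: CinftyD; [exact: Cinfty_cst|apply: CinftyM; [exact: Cinfty_cst|exact: Cinfty_sqdist]].
Qed.

Lemma pdiff_radial P k i : pdiff i (radial P k).
Proof. by have [] := CinftyP (Cinfty_radial P k) i. Qed.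

Lemma Cinfty_z i : Cinfty (fun x : E => z i x).
Proof. by apply: CinftyD; [exact: Cinfty_coord|exact: Cinfty_cst]. Qed.

Lemma partial_radial P k i :
  partial i (radial P k) = (fun x => radial (flat_next P) k x * (- 2 * z i x)).
Proof.
have ds : pdiff i (sqdist x0) by have [] := CinftyP (Cinfty_sqdist x0) i.
have dm : pdiff i (fun x => -1 * sqdist x0 x).
  by apply: (pdiffM _ ds); exact: pdiff_cst.
have -> : radial P k = (fun x => flat P (k + (-1) * sqdist x0 x)).
  by apply/funext => x; rewrite /radial mulN1r.
rewrite partial_flat; last by apply: (pdiffD _ dm); exact: pdiff_cst.
rewrite (partialD (@pdiff_cst R d i k) dm).
rewrite (partialM (@pdiff_cst R d i (-1)) ds).
rewrite !partial_cst partial_sqdist; apply/funext => x.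
by rewrite /radial mulN1r; ring.
Qed.

Lemma partial_z i j : partial i (fun x : E => z j x) = (fun=> (i == j)%:R).
Proof.
rewrite partialD ?partial_coord ?partial_cst => [| y | y].
- by under eq_fun do rewrite addr0.
- by case: (is_derive_coord i j y).
- exact: derivable_cst.
Qed.

Lemma partial2_radial P k i j : partial i (partial j (radial P k)) =
  (fun x => radial (flat_next (flat_next P)) k x * (4 * (z i x * z j x))
            - radial (flat_next P) k x * (2 * (i == j)%:R)).
Proof.
have dz : pdiff i (fun x : E => z j x) by have [] := CinftyP (Cinfty_z j) i.
have dm : pdiff i (fun x : E => - 2 * z j x).
  by apply: (pdiffM _ dz); exact: pdiff_cst.
have dr : pdiff i (radial (flat_next P) k) := @pdiff_radial _ k i.
rewrite partial_radial (partialM dr dm).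
rewrite (partialM (@pdiff_cst R d i (- 2)) dz).
rewrite partial_cst partial_z partial_radial.
by apply/funext => x; ring.
Qed.

Variables (a : 'I_d -> 'I_d -> E -> R) (b : 'I_d -> E -> R) (c : E -> R).
Variables (da : 'I_d -> 'I_d -> 'I_d -> E -> R) (db : 'I_d -> E -> R).
Hypothesis a_b : forall i j, abdd mu (a i j).
Hypothesis da_b : forall i j k, abdd mu (da i j k).
Hypothesis b_b : forall i, abdd mu (b i).
Hypothesis db_b : forall i, abdd mu (db i).
Hypothesis c_b : abdd mu c.
Hypothesis a_ell : uniformly_elliptic oO a.
Local Notation adj := (adjoint_op a b c da db).

Let S1 x := \sum_i \sum_j (da i j i x * (2 * z j x) + a i j x * (2 * (i == j)%:R))
  + \sum_i b i x * (2 * z i x).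
Let S0 x := \sum_i db i x + c x.

Lemma adjoint_radial k x : adj (radial 1 k) x =
  radial (flat_next (flat_next 1)) k x * (4 * \sum_i \sum_j a i j x * z i x * z j x)
  - radial (flat_next 1) k x * S1 x + radial 1 k x * S0 x.
Proof.
set e2 := radial (flat_next (flat_next 1)) k x; set e1 := radial (flat_next 1) k x.
set e0 := radial 1 k x.
have A : \sum_i \sum_j (da i j i x * partial j (radial 1 k) x +
      a i j x * partial i (partial j (radial 1 k)) x) =
    \sum_i \sum_j e2 * (4 * (a i j x * z i x * z j x)) -
    \sum_i \sum_j e1 * (da i j i x * (2 * z j x) + a i j x * (2 * (i == j)%:R)).
  rewrite -sumrB; apply: eq_bigr => i _; rewrite -sumrB; apply: eq_bigr => j _.
  by rewrite partial2_radial partial_radial -/e1 -/e2; ring.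
have B : \sum_i (db i x * radial 1 k x + b i x * partial i (radial 1 k) x) =
    \sum_i e0 * db i x - \sum_i e1 * (b i x * (2 * z i x)).
  rewrite -sumrB; apply: eq_bigr => i _.
  by rewrite partial_radial -/e1 -/e0; ring.
rewrite /adjoint_op A B /S1 /S0.
under eq_bigr do rewrite -mulr_sumr -mulr_sumr.
under [X in _ - X + _]eq_bigr do rewrite -mulr_sumr.
rewrite -!mulr_sumr -/e0; ring.
Qed.

Lemma adjointD u v al be x : (forall i, pdiff i u) -> (forall i, pdiff i v) ->
  (forall i j, pdiff i (partial j u)) -> (forall i j, pdiff i (partial j v)) ->
  adj (fun x => al * u x + be * v x) x = al * adj u x + be * adj v x.
Proof.
move=> du dv ddu ddv.
have lin i (f g : E -> R) : pdiff i f -> pdiff i g ->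
    partial i (fun x => al * f x + be * g x) =
    (fun x => al * partial i f x + be * partial i g x).
  move=> df dg.
  have daf : pdiff i (fun x => al * f x) by apply: (pdiffM _ df); exact: pdiff_cst.
  have dbg : pdiff i (fun x => be * g x) by apply: (pdiffM _ dg); exact: pdiff_cst.
  rewrite (partialD daf dbg) (partialM (@pdiff_cst R d i al) df).
  rewrite (partialM (@pdiff_cst R d i be) dg) !partial_cst.
  by apply/funext => y; rewrite !mulr0 !addr0.
have l1 j := lin j u v (du j) (dv j).
have l2 i j := lin i (partial j u) (partial j v) (ddu i j) (ddv i j).
rewrite /adjoint_op !mulrDr !mulr_sumr [RHS]addrACA; congr (_ + _); last by ring.
rewrite [RHS]addrACA; congr (_ + _).
  rewrite -big_split; apply: eq_bigr => i _ /=.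
  rewrite !mulr_sumr -big_split; apply: eq_bigr => j _ /=.
  rewrite l1 l2 /=.
  move: (partial i (partial j u) x) (partial i (partial j v) x) (partial j u x) (partial j v x).
  by move=> *; ring.
rewrite -big_split; apply: eq_bigr => i _ /=.
by rewrite l1 /=; ring.
Qed.

(** Near the sphere the second derivative of [e] is of order [w^-4 e(w)], with a positive
    coefficient by ellipticity, whereas the remaining terms are [O(w^-2 e(w))]. *)
Lemma adjoint_radial_edge rho : 0 < rho -> exists2 dl, 0 < dl &
  \forall x \ae mu, 0 < rho - sqdist x0 x <= dl ->
    radial 1 rho x <= adj (radial 1 rho) x.
Proof.
move=> rho0.
have [theta th0 ell] := a_ell.
have [_ [C1 HC1]] : abdd mu S1.
  apply: abddD.
    apply: abdd_sum => i; apply: abdd_sum => j; apply: abddD; apply: abddM => //.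
      by apply: (Cinfty_abdd oO bO); apply: CinftyM; [exact: Cinfty_cst|exact: Cinfty_z].
    exact: abdd_cst.
  apply: abdd_sum => i; apply: abddM => //.
  by apply: (Cinfty_abdd oO bO); apply: CinftyM; [exact: Cinfty_cst|exact: Cinfty_z].
have [_ [C0 HC0]] : abdd mu S0 by apply: abddD => //; exact: abdd_sum.
pose C := `|C1| + `|C0| + 1.
have Cp : 0 < C by rewrite ltr_wpDl.
(* The three bounds give [1/w >= 4], then [|x - x0|^2 >= rho / 2], away from the centre where the
   gradient of [w] vanishes, and finally dominance over [S1] and [S0]. *)
pose dl := Num.min (4^-1) (Num.min (rho / 2) (theta * rho / C)).
have dl0 : 0 < dl by rewrite !lt_min invr_gt0 ltr0n/= !divr_gt0// mulr_gt0.
exists dl => //.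
apply: filterS3 ell HC1 HC0 => x ell HC1 HC0 /andP[t0].
set t := rho - sqdist x0 x in t0 *.
rewrite !le_min => /andP[t4 /andP[tr tC]].
rewrite adjoint_radial /radial -/t flat1_next2// flat1_next// -flat1E//.
set e := flat 1 t.
have e0 : 0 < e by exact: flat1_gt0.
have el : theta * (rho / 2) <= \sum_i \sum_j a i j x * z i x * z j x.
  have := ell (x - x0); rewrite eucl_norm_sqr => H.
  have -> : \sum_i \sum_j a i j x * z i x * z j x =
    \sum_i \sum_j a i j x * (x - x0) ord0 i * (x - x0) ord0 j.
    by apply: eq_bigr => i _; apply: eq_bigr => j _; rewrite !mxE.
  apply: le_trans H; rewrite ler_wpM2l ?(ltW th0)//.
  by move: tr; rewrite /t; lra.
set el' := \sum_i _ in el *.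
have n1 : S1 x <= `|C1| by rewrite (le_trans (ler_norm _))// (le_trans HC1)// ler_norm.
have n0 : - `|C0| <= S0 x.
  by rewrite lerNl -normrN in HC0 *; rewrite (le_trans (ler_norm _))// (le_trans HC0)// ler_norm.
have tN0 : t != 0 by rewrite gt_eqF.
have tC' : t * C <= theta * rho by rewrite -ler_pdivlMr.
have -> : (t ^- 4 - 2 * t ^- 3) * e * (4 * el') - t ^- 2 * e * S1 x + e * S0 x =
  e * ((t^-1 ^+ 4 - 2 * t^-1 ^+ 3) * (4 * el') - t^-1 ^+ 2 * S1 x + S0 x).
  by rewrite -!exprVn; ring.
rewrite -[leLHS]mulr1 ler_wpM2l ?(ltW e0)//.
apply: (edge_bound _ th0 rho0 el n1 n0) => //.
  by rewrite -[4]invrK lef_pV2 ?posrE// invr_gt0.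
by rewrite mulrC ler_pdivlMr// mulrC.
Qed.

Lemma radial_test k P r : 0 < r -> k < r ^+ 2 -> eucl_ball x0 r `<=` Omega ->
  test (radial P k).
Proof.
move=> r0 kr ballO; apply: (@test_sqdist R d Omega x0 k).
- exact: Cinfty_radial.
- by move=> y; exact: radial_out.
- move=> y /= yk; apply: ballO; rewrite eucl_ballE//=; exact: le_lt_trans kr.
Qed.

Lemma adjoint_radial_out k x : k <= sqdist x0 x -> adj (radial 1 k) x = 0.
Proof. by move=> kx; rewrite adjoint_radial !radial_out// !mul0r subrr addr0. Qed.

(** The concentric balls of squared radius [k n] exhaust the open ball. If [yf] paired to zero with
    all their bumps it would vanish a.e. in the ball, and it already does outside. *)
Lemma mass_in_ball (yf : E -> R) r : 0 < r -> eucl_ball x0 r `<=` Omega -> yf \in L2f ->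
  (\forall x \ae mu, 0 <= yf x) -> ~ (\forall x \ae mu, yf x = 0) ->
  ess_supp oO yf `<=` eucl_ball x0 r ->
  exists k, 0 < k < r ^+ 2 /\ 0 < ip mu yf (radial 1 k).
Proof.
move=> r0 ballO yL yf0 yfN0 ysub.
have r20 : 0 < r ^+ 2 by rewrite exprn_gt0.
(* The denominator [n + 2] keeps [k 0] positive. *)
pose k (n : nat) := r ^+ 2 - r ^+ 2 / n.+2%:R.
have k_lt n : 0 < k n < r ^+ 2.
  rewrite /k gtrBl divr_gt0// andbT subr_gt0 ltr_pdivrMr// ltr_pMr//.
  by rewrite ltr1n.
have kL n : radial 1 (k n) \in L2f.
  by apply: (test_L2 oO bO); apply: radial_test r0 _ ballO; case/andP: (k_lt n).
apply: contrapT => H; apply: yfN0.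
have Hn n : \forall x \ae mu, yf x * radial 1 (k n) x = 0.
  apply: contrapT => H'; apply: H; exists (k n); split; first exact: k_lt.
  apply: Rint_gt0 => //; first exact: L2_ipitg.
  by apply: filterS yf0 => x y0; rewrite mulr_ge0// flat1_ge0.
have /ae_foralln Hall := Hn.
apply: filterS2 Hall (ess_supp_ae oO yf) => x Hx [//|/ysub].
rewrite eucl_ballE//= => xr.
have [n xn] : exists n, sqdist x0 x < k n.
  pose g := r ^+ 2 - sqdist x0 x.
  have g0 : 0 < g by rewrite subr_gt0.
  exists (Num.bound (r ^+ 2 / g)).
  have : r ^+ 2 / g < (Num.bound (r ^+ 2 / g)).+2%:R.
    rewrite (lt_le_trans (archi_boundP _))//; first by rewrite divr_ge0// ltW.
    by rewrite ler_nat; exact/leqW/leqW.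
  rewrite /k; set m := (_.+2%:R : R) => gm.
  have m0 : 0 < m by rewrite ltr0n.
  rewrite ltrBrDr addrC -ltrBrDr -/g ltr_pdivrMr// mulrC -ltr_pdivrMr//.
have /eqP := Hx n; rewrite mulf_eq0 => /orP[/eqP //|/eqP rx].
have : 0 < radial 1 (k n) x by rewrite flat1_gt0// subr_gt0.
by rewrite rx ltxx.
Qed.

(* Near the sphere [sqdist x0 = rho] the negative part [- eta E_rho] of [Q] has
   [A* Q < 0], which pays for the diffusion of the positive part there. *)
Lemma barrier_exists (yf : E -> R) r : 0 < r -> eucl_ball x0 r `<=` Omega ->
  yf \in L2f -> (\forall x \ae mu, 0 <= yf x) -> ~ (\forall x \ae mu, yf x = 0) ->
  ess_supp oO yf `<=` eucl_ball x0 r ->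
  exists (Q G : E -> R) (Tstar : R),
  [/\ test Q, test G, 0 < Tstar,
      (forall x, ~ eucl_ball x0 r x -> Q x = 0 /\ G x = 0) &
      (forall s, 0 <= s <= Tstar -> \forall x \ae mu, adj Q x + s * adj G x <= G x) /\
      0 < ip mu yf Q].
Proof.
move=> r0 ballO yL yf0 yfN0 ysub.
have [k [/andP[k0 kr] yk]] := mass_in_ball r0 ballO yL yf0 yfN0 ysub.
(* Leaves room on both sides: [yf] has mass inside [k], and the support of [Q] stays inside the
   ball. *)
pose rho := (k + r ^+ 2) / 2.
have krho : k < rho by rewrite /rho; lra.
have rhor : rho < r ^+ 2 by rewrite /rho; lra.
have rho0 : 0 < rho by exact: lt_trans krho.
have [dl0 dl00 edge] := adjoint_radial_edge rho0.
(* Within the range of the edge estimate, and such that the positive bump of [Q] still dominates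
   [radial 1 k]. *)
pose dl := Num.min dl0 (rho - k).
have dlp : 0 < dl by rewrite lt_min dl00 subr_gt0.
have dldl : dl <= dl0 by rewrite ge_min lexx.
have dlk : k <= rho - dl.
  have : dl <= rho - k by rewrite ge_min lexx orbT.
  by rewrite !lerBrDr addrC.
pose k1 := rho - dl; pose k2 := rho - dl / 2.
have k1r : k1 < r ^+ 2 by rewrite /k1; lra.
have k2r : k2 < r ^+ 2 by rewrite /k2; lra.
have t0 : test (radial 1 rho) := radial_test 1 r0 rhor ballO.
have t1 : test (radial 1 k1) := radial_test 1 r0 k1r ballO.
have t2 : test (radial 1 k2) := radial_test 1 r0 k2r ballO.
have L0 := test_L2 oO bO t0; have L1 := test_L2 oO bO t1.
have Lk := test_L2 oO bO (radial_test 1 r0 kr ballO).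
have y1 : 0 < ip mu yf (radial 1 k1).
  apply: (lt_le_trans yk); apply: Rint_le; try exact: L2_ipitg.
  apply: filterS yf0 => x y0; rewrite ler_wpM2l//; apply: flat1_homo.
  by rewrite lerD2r.
have y0 : 0 <= ip mu yf (radial 1 rho).
  apply: Rint_ge0; first exact: L2_ipitg.
  by apply: filterS yf0 => x y0; rewrite mulr_ge0// flat1_ge0.
(* Small enough for the negative part of [Q] not to spoil [<yf, Q> > 0]. *)
have [eta eta0 etay] := exists_small_factor y0 y1.
pose e := flat 1 (dl / 2).
have e0 : 0 < e by rewrite flat1_gt0// divr_gt0.
have [_ [D0 HD0]] := adjoint_abdd a_b da_b b_b db_b c_b t0.
have [_ [D1 HD1]] := adjoint_abdd a_b da_b b_b db_b c_b t1.
have [_ [D2 HD2]] := adjoint_abdd a_b da_b b_b db_b c_b t2.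
pose D := `|D0| + `|D1| + `|D2|.
have D0' : 0 <= D by rewrite !addr_ge0.
(* Where [w >= dl], this gives [G >= D (1 + eta) + 1]: the first term bounds [A* Q], the spare 1 is
   for [s A* G]. *)
have [M M0 Me] : exists2 M, 0 < M & M * e = D * (1 + eta) + 1.
  exists ((D * (1 + eta) + 1) / e); last by rewrite divfK// gt_eqF.
  by apply: divr_gt0 => //; apply: ltr_wpDl => //; apply: mulr_ge0 => //; apply: addr_ge0 => //; exact: ltW.
have MD0 : 0 <= M * D by apply: mulr_ge0 => //; exact: ltW.
have ee0 : 0 < eta * e by exact: mulr_gt0.
(* [s A* G] must fit into the spare 1 where [w >= dl], and into [eta e] in the shell
   [dl / 2 < w < dl]. *)
have [Ts Ts0 [TsMD1 TsMDe]] : exists2 Ts, 0 < Ts & Ts * (M * D) <= 1 /\ Ts * (M * D) <= eta * e.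
  have [T1 T10 H1] := exists_small_factor MD0 ltr01.
  have [T2 T20 H2] := exists_small_factor MD0 ee0.
  exists (Num.min T1 T2); first by rewrite lt_min T10.
  split; [apply: le_trans (ltW H1)|apply: le_trans (ltW H2)]; apply: ler_wpM2r => //;
    by rewrite ge_min lexx ?orbT.
(* Both witnesses are written in the form [al * u + be * v] of [adjointD], hence the zero term in
   [G]. *)
exists (fun x => 1 * radial 1 k1 x + (- eta) * radial 1 rho x).
exists (fun x => M * radial 1 k2 x + 0 * radial 1 k2 x), Ts.
split => //.
- by apply: testD; apply: testM => //; exact: Cinfty_cst.
- by apply: testD; apply: testM => //; exact: Cinfty_cst.
- move=> x; rewrite eucl_ballE//= => /negP; rewrite -leNgt => rx.
  rewrite !radial_out ?mulr0 ?addr0//; apply: (le_trans _ rx); exact: ltW.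
split; last first.
  rewrite ipDr ?L2Z// !ipZr// mul1r mulNr subr_gt0//.
have pd P kk i : pdiff i (radial P kk) := @pdiff_radial P kk i.
have pdd kk i j : pdiff i (partial j (radial 1 kk)).
  by have [_ /CinftyP/(_ i)[]] := CinftyP (Cinfty_radial 1 kk) j.
move=> s /andP[s0 sT].
move: HD0; apply: filter_app; move: HD1; apply: filter_app; move: HD2; apply: filter_app.
apply: filterS edge => x Hedge HD2 HD1 HD0.
rewrite adjointD// adjointD// mul0r addr0 mul0r addr0 mul1r.
set A0 := adj (radial 1 rho) x in HD0 Hedge *.
set A1 := adj (radial 1 k1) x in HD1 *.
set A2 := adj (radial 1 k2) x in HD2 *.
have A0D : - A0 <= D.
  rewrite (le_trans (ler_norm _))// normrN (le_trans HD0)// (le_trans (ler_norm _))//.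
  by rewrite /D -addrA lerDl addr_ge0.
have A1D : A1 <= D.
  rewrite (le_trans (ler_norm _))// (le_trans HD1)// (le_trans (ler_norm _))//.
  by rewrite /D addrAC lerDr addr_ge0.
have A2D : s * (M * A2) <= Ts * (M * D).
  apply: (@le_trans _ _ (s * (M * D))).
    rewrite ler_wpM2l// ler_wpM2l ?(ltW M0)//.
    rewrite (le_trans (ler_norm _))// (le_trans HD2)// (le_trans (ler_norm _))//.
    by rewrite /D lerDr addr_ge0.
  by rewrite ler_wpM2r.
clear yk y0 y1 etay HD0 HD1 HD2.
pose t := rho - sqdist x0 x.
(* In the inner region the size of [M] decides; outside it the positive bump of [Q] has no
   contribution left. *)
have [tl|tg] := leP dl t.
  have G1 : D * (1 + eta) + 1 <= M * radial 1 k2 x.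
    rewrite -Me ler_wpM2l ?(ltW M0)//; apply: flat1_homo.
    by move: tl; rewrite /t /k2; move: (sqdist x0 x) => q; lra.
  have H : eta * - A0 <= eta * D by rewrite ler_wpM2l// ltW.
  by move: G1 H A1D A2D TsMD1; lra.
have A10 : A1 = 0 by apply: adjoint_radial_out; move: tg; rewrite /t /k1; lra.
have G0 : 0 <= M * radial 1 k2 x by rewrite mulr_ge0 ?(ltW M0)// flat1_ge0.
(* In the outer region [A* G] vanishes as well, and [A* e(w) >= 0] suffices. *)
have [tl2|tg2] := leP t (dl / 2).
  have A20 : A2 = 0 by apply: adjoint_radial_out; move: tl2; rewrite /t /k2; lra.
  have A0ge : 0 <= A0.
    have [tle|tgt] := leP t 0.
      by rewrite /A0 adjoint_radial_out// -subr_le0.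
    apply: le_trans (Hedge _); first exact: flat1_ge0.
    by rewrite -/t tgt/= (le_trans (ltW tg)).
  rewrite A10 A20; have H : 0 <= eta * A0 by rewrite mulr_ge0// ltW.
  by move: H G0; lra.
(* In the shell [e(w)] is at least [e = e(dl / 2)], so the edge estimate gives [A* Q <= - eta e],
   which pays for [s A* G]. *)
have A0e : e <= A0.
  apply: le_trans (Hedge _); first by apply: flat1_homo; exact: ltW tg2.
  rewrite -/t (le_trans (ltW tg))// andbT; apply: lt_trans tg2; exact: divr_gt0.
have H : eta * e <= eta * A0 by rewrite ler_wpM2l// ltW.
by rewrite A10; move: H A2D TsMDe G0; lra.
Qed.

End radial_barrier.

(** * Comparison of integrals when the larger function may fail to be measurable *)

Section lower_integral.
Context d (T : measurableType d) (R : realType) (mu : {measure set T -> \bar R}).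
Local Open Scope ereal_scope.

(* [G] need not be measurable: the integral is then a lower integral. *)
Lemma le_lower_integral (D : set T) (g G : T -> \bar R) :
  (forall x, D x -> 0 <= g x) -> (forall x, D x -> g x <= G x) ->
  \int[mu]_(x in D) g x <= \int[mu]_(x in D) G x.
Proof.
move=> g0 gG; have G0 x : D x -> 0 <= G x.
  by move=> Dx; exact: le_trans (g0 _ Dx) (gG _ Dx).
rewrite !ge0_integralE//.
apply: le_ereal_sup => _ [h hg <-]; exists h => // x.
apply: le_trans (hg x) _; rewrite !patchE; case: ifPn => // /set_mem; exact: gG.
Qed.

(** The null set is removed from [g], whose integral is unaffected by measurability; [G] is left
    alone. *)
Lemma ae_le_lower_integral (D : set T) (g G : T -> \bar R) : measurable D ->
  measurable_fun setT g -> (forall x, 0 <= g x) -> (forall x, 0 <= G x) ->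
  (\forall x \ae mu, D x -> g x <= G x) ->
  \int[mu]_(x in D) g x <= \int[mu]_(x in D) G x.
Proof.
move=> mD mg g0 G0 [N [mN N0 sub]].
pose g' := g \_ (~` N).
have mN' : measurable (~` N) by exact: measurableC.
have g'0 x : 0 <= g' x by rewrite /g' patchE; case: ifPn.
rewrite (_ : \int[mu]_(x in D) g x = \int[mu]_(x in D) g' x).
  apply: le_lower_integral => // x Dx; rewrite /g' patchE; case: ifPn => // /set_mem Nx.
  by apply: contrapT => H; apply/Nx/sub => /(_ Dx).
apply: ae_eq_integral => //.
- exact: measurable_funTS.
- apply: measurable_funTS; apply/(measurable_restrictT _ mN'); exact: measurable_funTS.
- exists N; split => // x /= H; apply: contrapT => Nx; apply: H => _.
  by rewrite /g' patchE mem_set.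
Qed.

End lower_integral.

(** * Pairing a Bochner integral with a fixed function *)

Section bochner.
Context (R : realType) (d : nat) (Omega : set 'rV[R]_d) (oO : open Omega).
Local Notation E := 'rV[R]_d.
Local Notation mu := (leb_on oO).
Local Notation L2f := (Lfun mu 2%:E).
Local Notation L2O := (L2 oO).

Lemma ip_sumO n (k : 'I_n -> R) (v : 'I_n -> L2O) (q : E -> R) : q \in L2f ->
  ip mu (\sum_i k i *: v i : L2O) q = \sum_i k i * ip mu (v i) q.
Proof.
move=> qL; elim: n k v => [|n ih] k v.
  rewrite !big_ord0 /ip; under eq_Rintegral do rewrite mul0r.
  by rewrite Rintegral_cst// mul0r.
by rewrite !big_ord_recl ipOD// ipOZ// ih.
Qed.

Lemma ip_sc_int (D : set (measurableTypeR R)) (s : simple_curve oO) (q : E -> R) : q \in L2f ->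
  measurable D -> (lebesgue_measure D < +oo)%E ->
  let h t := ip mu (sc_eval s t) q in
  [/\ measurable_fun setT h, lebesgue_measure.-integrable D (EFin \o h) &
    ip mu (sc_int D s) q = \int[lebesgue_measure]_(t in D) h t].
Proof.
move=> qL mD Dfin h.
have hE : h = (fun t => \sum_(i < sc_size s) ip mu (sc_val i) q * \1_(sc_set i) t).
  by apply/funext => t; rewrite /h /sc_eval ip_sumO//; apply: eq_bigr => i _; rewrite mulrC.
have mA (i : 'I_(sc_size s)) : measurable (sc_set i : set (measurableTypeR R)) := sc_meas i.
have i1 (i : 'I_(sc_size s)) : lebesgue_measure.-integrable D (EFin \o (\1_(sc_set i) : R -> R)).
  apply/integrableP; split; first by apply/measurable_EFinP; have := mA i; apply: measurable_indic.
  under eq_integral do rewrite /= ger0_norm//.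
  rewrite integral_indic//. apply: le_lt_trans Dfin.
  by apply: le_measure; rewrite ?inE//; exact: measurableI.
have iZ (i : 'I_(sc_size s)) : lebesgue_measure.-integrable D
    (EFin \o (fun t => ip mu (sc_val i) q * \1_(sc_set i) t)).
  by apply: eq_integrable (integrableZl mD (ip mu (sc_val i) q) (i1 i)).
have isum (r : seq 'I_(sc_size s)) : lebesgue_measure.-integrable D
     (EFin \o (fun t => \sum_(i <- r) ip mu (sc_val i) q * \1_(sc_set i) t)) /\
   \int[lebesgue_measure]_(t in D) (\sum_(i <- r) ip mu (sc_val i) q * \1_(sc_set i) t) =
   \sum_(i <- r) fine (lebesgue_measure (sc_set i `&` D)) * ip mu (sc_val i) q.
  elim: r => [|i r [ih1 ih2]].
    split; first by under [X in _.-integrable _ X]eq_fun do rewrite /= big_nil; exact: integrable0.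
    under eq_Rintegral do rewrite big_nil.
    by rewrite big_nil Rintegral_cst// mul0r.
  split.
    under [X in _.-integrable _ X]eq_fun do rewrite /= big_cons.
    by apply: eq_integrable (integrableD mD (iZ i) ih1).
  under eq_Rintegral do rewrite big_cons.
  rewrite RintegralD// ih2 big_cons RintegralZl//; congr (_ + _).
  by rewrite mulrC /Rintegral integral_indic.
split.
- rewrite hE; apply: measurable_sum => i; apply: measurable_funM => //.
  by have := @measurable_indic _ (measurableTypeR R) R setT _ (mA i).
- have [H _] := isum (index_enum _); rewrite -hE in H; exact: H.
- have [_] := isum (index_enum _); rewrite -hE => ->; by rewrite /sc_int ip_sumO.
Qed.

(** For a simple curve [s] near [F], the sign of [<F, q>] gives [<s, q> <= |q| |F - s|]. Integrating
    this needs no measurability of [F], and the right side tends to 0. *)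
Lemma bochner_le0 (D : set (measurableTypeR R)) (F : R -> L2O) (I : L2O) (q : E -> R) : q \in L2f ->
  measurable D -> (lebesgue_measure D < +oo)%E -> bochner_integral D F I ->
  (\forall t \ae @lebesgue_measure R, D t -> ip mu (F t) q <= 0) -> ip mu I q <= 0.
Proof.
move=> qL mD Dfin [s [_ intF intI]] F0.
(* The [+ 1] permits division by [c] when [q] is null. *)
pose c := n2 mu q + 1.
have c0 : 0 < c by rewrite ltr_wpDl// n2_ge0.
have key n (X := (\int[lebesgue_measure]_(t in D) (nrm2 (F t - sc_eval (s n) t))%:E)%E) :
    ((c^-1 * ip mu (sc_int D (s n)) q)%:E <= X)%E.
  have [mh ih ->] := ip_sc_int (s n) qL mD Dfin.
  set h := (fun t => ip mu (sc_eval (s n) t) q) in mh ih *.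
  (* A measurable nonnegative function lying a.e. below the possibly non-measurable [|F - s|], as
     the lower integral requires. *)
  pose g t := Num.max (c^-1 * h t) 0.
  have mg : measurable_fun setT g.
    by apply: measurable_maxr => //; exact: measurable_funM.
  have ich : lebesgue_measure.-integrable D (EFin \o (fun t => c^-1 * h t)).
    exact: (integrableZl mD c^-1 ih).
  have ig : lebesgue_measure.-integrable D (EFin \o g).
    apply: (le_integrable mD _ _ ich); first by apply/measurable_EFinP/measurable_funTS.
    by move=> t _ /=; rewrite lee_fin /g /Num.max; case: ifPn => // _; rewrite normr0.
  apply: (@le_trans _ _ (\int[lebesgue_measure]_(t in D) (g t)%:E)%E); last first.
    apply: ae_le_lower_integral => //.
    - exact/measurable_EFinP.
    - by move=> t; rewrite lee_fin le_max lexx orbT.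
    - by move=> t; rewrite lee_fin nrm2_ge0.
    - case: F0 => N [mN N0 sub]; exists N; split => // t /= H; apply: sub => Ft; apply: H => Dt.
      rewrite lee_fin ge_max nrm2_ge0 andbT mulrC ler_pdivrMr//.
      have -> : h t = ip mu (F t) q - ip mu (F t - sc_eval (s n) t) q.
        by rewrite ipOB// opprB addrC subrK.
      have := Ft Dt; have := ip_nrm2 (F t - sc_eval (s n) t) qL.
      rewrite ler_norml => /andP[H _].
      have : 0 <= nrm2 (F t - sc_eval (s n) t) := nrm2_ge0 _.
      by rewrite /c; move: H; move: (nrm2 _) (ip _ _ _) (ip _ _ _) => *; lra.
  rewrite -RintegralZl//.
  have /fineK <- := integrable_fin_num mD ig.
  rewrite lee_fin; apply: (le_Rintegral mD ich ig) => t _.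
  by rewrite /g le_max lexx.
apply: (@ler_mul_eps _ _ (n2 mu q + c)).
  by rewrite addr_ge0 ?n2_ge0// ltW.
move=> e e0.
have H1 : \forall n \near \oo, nrm2 (I - sc_int D (s n)) < e.
  move/cvgrPdist_lt : intI => /(_ _ e0); apply: filterS => n.
  by rewrite sub0r normrN ger0_norm// nrm2_ge0.
have H2 : \forall n \near \oo, (\int[lebesgue_measure]_(t in D)
     (nrm2 (F t - sc_eval (s n) t))%:E < e%:E)%E.
  have e0' : (0 < e%:E)%E by rewrite lte_fin.
  by have := intF _ (open_nbhs_nbhs (conj (@open_ereal_lt_ereal R e%:E) e0')).
have [n [n1 n2']] := filter_ex (filterI H1 H2).
have H3 : ip mu (sc_int D (s n)) q <= c * e.
  have := le_lt_trans (key n) n2'; rewrite lte_fin mulrC ltr_pdivrMr// => /ltW.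
  by rewrite mulrC.
have -> : ip mu I q = ip mu (I - sc_int D (s n)) q + ip mu (sc_int D (s n)) q.
  by rewrite ipOB// subrK.
rewrite mulrDl lerD//.
apply: (le_trans (ler_norm _)); apply: (le_trans (ip_nrm2 _ qL)).
by rewrite mulrC ler_wpM2l ?n2_ge0// ltW.
Qed.

End bochner.

(** * Separation of the reachable states from [yf] by the functional [Q] *)

Theorem theorem4p1 (R : realType) (d : nat) (d_gt0 : (0 < d)%N)
  (Omega : set 'rV[R]_d) (oO : open Omega) (bO : bounded_set Omega)
  (cO : connected Omega) (C2O : C2_boundary Omega)
  (a : 'I_d -> 'I_d -> 'rV[R]_d -> R) (b : 'I_d -> 'rV[R]_d -> R)
  (c : 'rV[R]_d -> R)
  (a_sym : \forall x \ae leb_on oO, forall i j, a i j x = a j i x)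
  (a_reg : forall i j, W1infty oO (a i j)) (b_reg : forall i, W1infty oO (b i))
  (c_reg : Linfty oO c) (a_ell : uniformly_elliptic oO a)
  (S : R -> L2 oO -> L2 oO) (S_gen : generates (elliptic_op a b c) S)
  (Uplus : set (L2 oO))
  (Uplus_ge0 : forall u, Uplus u -> \forall x \ae leb_on oO, 0 <= u x)
  (x0 : 'rV[R]_d) (r : R) (Ox0 : Omega x0) (r_gt0 : 0 < r)
  (ballO : eucl_ball x0 r `<=` Omega)
  (Uplus_supp : forall u, Uplus u -> ess_supp oO u `&` eucl_ball x0 r = set0)
  (yf : L2 oO) (yf_ge0 : \forall x \ae leb_on oO, 0 <= yf x)
  (yf_neq0 : ~ (yf = (0 : L2 oO) %[ae leb_on oO]))
  (yf_supp : ess_supp oO yf `<=` eucl_ball x0 r) :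
  exists Tstar eps : R, [/\ 0 < Tstar, 0 < eps &
    forall T : R, 0 < T <= Tstar ->
    forall u : L2cyl oO T,
      (\forall t \ae @lebesgue_measure R, t \in `]0, T[ ->
         exists2 v, Uplus v & slice u t = v %[ae leb_on oO]) ->
    forall y : R -> L2 oO,
      mild_solution S 0 (slice u) T y -> eps < nrm2 (y T - yf)].
Proof.
pose mu := leb_on oO.
have a_b i j : abdd mu (a i j) by apply: Linfty_abdd; case: (a_reg i j).
have b_b i : abdd mu (b i) by apply: Linfty_abdd; case: (b_reg i).
have c_b : abdd mu c := Linfty_abdd c_reg.
have /choice[da Hda] : forall k : 'I_d * 'I_d * 'I_d, exists g : 'rV[R]_d -> R,
    Linfty oO g /\ weak_partial oO k.2 (a k.1.1 k.1.2) g.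
  by move=> [[i j] k] /=; have [_ /(_ k)[g ? ?]] := a_reg i j; exists g.
have /choice[db Hdb] : forall i, exists g : 'rV[R]_d -> R,
    Linfty oO g /\ weak_partial oO i (b i) g.
  by move=> i; have [_ /(_ i)[g ? ?]] := b_reg i; exists g.
have da_b i j k : abdd mu (da (i, j, k)) by apply: Linfty_abdd; case: (Hda (i, j, k)).
have da_w i j k : weak_partial oO k (a i j) (da (i, j, k)) by case: (Hda (i, j, k)).
have db_b i : abdd mu (db i) by apply: Linfty_abdd; case: (Hdb i).
have db_w i : weak_partial oO i (b i) (db i) by case: (Hdb i).
have [S_C0 SA] := S_gen.
have [K K0 diss] := dissipative bO a_b b_b c_b a_ell.
have yfL := L2_in yf.
have yfN0 : ~ \forall x \ae mu, yf x = 0.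
  by move=> H; apply: yf_neq0; apply: filterS H => x.
have [Q [G [Ts [tQ tG Ts0 out [super yQ]]]]] :=
  barrier_exists bO a_b (fun i j k => da_b i j k) b_b db_b c_b a_ell r_gt0 ballO
    yfL yf_ge0 yfN0 yf_supp.
have QL := test_L2 oO bO tQ; have GL := test_L2 oO bO tG.
have adjL q (tq : test_function Omega q) :=
  abddL2 (leb_fin oO bO) (adjoint_abdd a_b (fun i j k => da_b i j k) b_b db_b c_b tq).
have nQ0 : 0 < n2 mu Q.
  rewrite lt_neqAle n2_ge0 andbT eq_sym; apply/negP => /eqP Q0.
  by have := lt_le_trans yQ (ip_le_n2 yfL QL); rewrite Q0 mulr0 ltxx.
have dense (v : L2 oO) e : 0 < e -> exists f g, elliptic_op a b c f g /\ nrm2 (v - f) < e.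
  move=> e0; have [phi tphi H] := approximable_L2 bO (L2_in v) e0.
  have [f [g [fE fg]]] := test_domain bO a_b (fun i j k => da_b i j k)
     (fun i j k => da_w i j k) b_b c_b tphi.
  by exists f, g; split => //; rewrite nrm2E; move: H; rewrite -fE.
(* Half of the separation supplied by Cauchy-Schwarz, so that the final inequality is strict. *)
exists Ts, (ip mu yf Q / (2 * n2 mu Q)); split => //.
  by rewrite divr_gt0// mulr_gt0.
move=> T /andP[T0 TTs] u uU y sol.
have [I [bI yI]] := sol T (ltac:(by rewrite (ltW T0) lexx)).
have IQ : ip mu I Q <= 0.
  apply: (bochner_le0 QL _ _ bI); first exact: measurable_itv.
    by rewrite /= lebesgue_measure_itv/=; case: ifPn => // _; rewrite -EFinB ltry.
  case: uU => N [mN N0 sub]; exists N; split => // t /= H; apply: sub => Ht; apply: H => tT.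
  have [v vU uv] := Ht tT.
  have v0 : \forall x \ae mu, slice u t x = v x by apply: filterS uv => x; apply.
  (* Off its essential support [v] is zero a.e., and that support misses the ball; so the control
     pairs to zero with [Q] and [G], which vanish outside the ball. *)
  have vout : \forall x \ae mu, ~ eucl_ball x0 r x \/ slice u t x = 0.
    apply: filterS2 v0 (ess_supp_ae oO v) => x -> [|vx]; first by right.
    left => Bx; have : (ess_supp oO v `&` eucl_ball x0 r) x by [].
    by rewrite Uplus_supp.
  have ip0 q : (forall x, ~ eucl_ball x0 r x -> q x = 0) -> q \in Lfun mu 2%:E ->
      ip mu (slice u t) q = 0.
    move=> q0 qL.
    have -> : ip mu (slice u t) q = \int[mu]_x (0 : R).
      apply: Rint_ae => //; first by apply: measurable_funM; [exact: L2_meas (L2_in _)|exact: L2_meas qL].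
      by apply: filterS vout => x [/q0 ->|->]; rewrite ?mulr0 ?mul0r.
    by rewrite Rintegral_cst// mul0r.
  (* Applied at elapsed time [T - t], which is at most [Ts]. *)
  apply: (barrier_le0 S_C0 SA K0 diss QL GL (adjL _ tQ) (adjL _ tG) _ _ super dense).
  - move=> f g fg; exact: (adjointP bO a_b (fun i j k => da_b i j k)
      (fun i j k => da_w i j k) b_b db_b db_w c_b fg tQ).
  - move=> f g fg; exact: (adjointP bO a_b (fun i j k => da_b i j k)
      (fun i j k => da_w i j k) b_b db_b db_w c_b fg tG).
  - by apply: filterS2 v0 (Uplus_ge0 _ vU) => x ->.
  - exact: (ip0 Q (fun x Hx => proj1 (out x Hx)) QL).
  - exact: (ip0 G (fun x Hx => proj2 (out x Hx)) GL).
  - by move: tT; rewrite /= in_itv/= => /andP[t0 tT]; apply/andP; split; lra.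
(* The initial state is 0, so [y T] agrees a.e. with the Duhamel integral. *)
have yQ0 : ip mu (y T) Q <= 0.
  have -> : ip mu (y T) Q = ip mu I Q => //.
  have z := C0_zero S_C0 (ltW T0).
  apply: ip_ae => //; try exact: L2_in; last exact: nearW.
  by apply: filterS2 yI z => x yIx zx; rewrite yIx// L2DE zx// L2_0E add0r.
have H : ip mu yf Q <= nrm2 (y T - yf) * n2 mu Q.
  rewrite nrm2_dist; apply: le_trans (_ : ip mu (yf - y T) Q <= _).
    by rewrite ipOB// lerBrDr gerDl.
  by apply: le_trans (ler_norm _) (ip_nrm2 _ QL).
rewrite ltr_pdivrMr ?mulr_gt0//.
have Y0 := lt_le_trans yQ H.
by rewrite mulrCA; apply: (le_lt_trans H); rewrite ltr_pMl// ltr1n.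
Qed.
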